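(* Let $c\ge2$ and $\varsigma\in\mathbb R$. Assume (A1) $\varsigma=m_c(3)$, and (A2) there is $s>0$ such that for every sequence $(G_n)$ of $c$-colorings with $v(G_n)\to\infty$, $$\liminf_{n\to\infty}\Big(p(\hat K_3;G_n)-\varsigma-s\big(p(\hat K_{3,1};G_n)+p(\hat K_{3,3};G_n)\big)\Big)\ge 0.$$ Then $\varsigma = (R_{c-1}(3)-1)^{-2}$, and there exists $n_0$ such that for every $\varepsilon>0$ there exists $\delta>0$ such that every $c$-coloring $G$ of $K_n$ with $n\ge n_0$ and $p(\hat K_3;G)\le m_c(3;n)+\delta$ can be turned into an element of $\mathcal G^{(c)}_{\mathrm{ex}}$ (on the same vertex set) by recoloring at most $\varepsilon\binom n2$ edges.
   Context: A $c$-coloring $G$ is a map from the $2$-subsets of a finite set $V(G)$ to $[c]$; $p(H;G)$ is the fraction of $v(H)$-subsets of $V(G)$ inducing a coloring isomorphic to $H$. $m_c(3;n)=\min_G p(\hat K_3;G)$ over $c$-colorings on $n$ vertices, $m_c(3)=\lim_n m_c(3;n)$. $R_{c-1}(3)$ is the smallest $N$ such that every $(c-1)$-coloring of $K_N$ has a monochromatic triangle. Notation: $p(\hat K_3;G)=\sum_{i=1}^c p(K_3^i;G)$ ($K_3^i$ = triangle of color $i$). $\hat K_{3,1}$ is the family of $4$-vertex colorings containing a monochromatic triangle of some color $a$ whose fourth vertex $x$ is joined to the triangle by edges of one of the following color patterns: (2,1,0) two edges of color $a$ and one of color $b\ne a$; (1,1,1) edges of three distinct colors, one of them $a$; (0,2,1)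 two edges of color $b$ and one of color $d$ with $a,b,d$ distinct. $\hat K_{3,3}$ is the family of $6$-vertex colorings consisting of two disjoint triangles, one monochromatic of color $a$, the other monochromatic of color $b$, with all nine edges between them of color $d$, where $a,b,d$ are distinct. $p(\hat K_{3,1};G)$ and $p(\hat K_{3,3};G)$ are the sums of $p(H;G)$ over the isomorphism classes in the respective families. A looped coloring $C$ assigns colors also to loops $\{u,u\}$. $\mathcal L^{(c)}_{\mathrm{ex}}$ is the set of looped $c$-colorings on $r=R_{c-1}(3)-1$ vertices in which all loops have the same color $c_\ell$ and the non-loop edges use only the other $c-1$ colors and contain no monochromatic triangle. For a looped $C$ on $r$ vertices, $\mathcal B_{\mathbf{1/r}}(C)$ is the set of colorings $G$ admitting $\varphi:V(G)\to V(C)$ with $G(\{u,v\})=C(\{\varphi(u),\varphi(v)\})$ for distinct $u,v$ and $\big||\varphi^{-1}(x)|-v(G)/r\big|\le1$ for all $x$. $\mathcal G^{(c)}_{\mathrm{ex}}$ is the set of colorings obtained from some $G\in\mathcal B_{\mathbf{1/r}}(E)$ with $E\in\mathcal L^{(c)}_{\mathrm{ex}}$ by recoloring some edges to the loop color of $E$ without creating additional monochromatic triangles. *)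

(* Defs.v *)
From HB Require Import structures.
From mathcomp Require Import all_boot all_order all_algebra.
From mathcomp Require Import all_classical all_reals all_analysis.
Set Implicit Arguments. Unset Strict Implicit. Unset Printing Implicit Defensive.
Import Order.TTheory GRing.Theory Num.Theory.
Local Open Scope ring_scope.

(* A c-coloring on vertex set 'I_n: a finite function on ordered pairs; the
   color of the 2-subset {u,v} (u <> v) is read off at (min, max), so every
   such function determines a coloring of the 2-subsets and every coloring
   arises.  Entries (u,u) and (v,u) with v > u are irrelevant. *)
Definition coloring (n c : nat) := {ffun 'I_n * 'I_n -> 'I_c}.

Definition col n c (G : coloring n c) (u v : 'I_n) : 'I_c :=
  if (u < v)%N then G (u, v) else G (v, u).

Definition mono_tri n c (G : coloring n c) (S : {set 'I_n}) : bool :=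
  (#|S| == 3)%N &&
  [forall u in S, forall v in S, forall u' in S, forall v' in S,
     (u != v) ==> (u' != v') ==> (col G u v == col G u' v')].

(* the 4-set {x} U T lies in the family \hat K_{3,1}: T a monochromatic
   triangle of color a, and the edges from x to T have color pattern
   (2,1,0), (1,1,1) or (0,2,1) relative to a. *)
Definition K31_pattern c (a e1 e2 e3 : 'I_c) : bool :=
  let na := ((e1 == a) + (e2 == a) + (e3 == a))%N in
  [|| (na == 2)%N
    , (na == 1)%N && [&& e1 != e2, e2 != e3 & e1 != e3]
    | (na == 0)%N && ((e1 == e2) (+) (e2 == e3) (+) (e1 == e3)) && ~~ [&& e1 == e2 & e2 == e3] ].

Definition in_K31 n c (G : coloring n c) (S : {set 'I_n}) : bool :=
  (#|S| == 4)%N &&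
  [exists x : 'I_n, exists y : 'I_n, exists z : 'I_n, exists w : 'I_n,
     [&& S == [set x; y; z; w], x \notin [set y; z; w],
         mono_tri G [set y; z; w] &
         K31_pattern (col G y z) (col G x y) (col G x z) (col G x w)]].

Definition in_K33 n c (G : coloring n c) (S : {set 'I_n}) : bool :=
  (#|S| == 6)%N &&
  [exists A : {set 'I_n}, exists a : 'I_c, exists b : 'I_c, exists d : 'I_c,
     [&& A \subset S, mono_tri G A, mono_tri G (S :\: A),
         [&& a != b, a != d & b != d],
         [forall u in A, forall v in A, (u != v) ==> (col G u v == a)],
         [forall u in S :\: A, forall v in S :\: A, (u != v) ==> (col G u v == b)] &
         [forall u in A, forall v in S :\: A, col G u v == d]]].

Definition dens (R : realType) n (k : nat) (P : {set 'I_n} -> bool) : R :=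
  (#|[set S : {set 'I_n} | (#|S| == k)%N && P S]|)%:R / ('C(n, k))%:R.

Definition pK3 (R : realType) n c (G : coloring n c) : R := dens R 3 (mono_tri G).
Definition pK31 (R : realType) n c (G : coloring n c) : R := dens R 4 (in_K31 G).
Definition pK33 (R : realType) n c (G : coloring n c) : R := dens R 6 (in_K33 G).

(* m_c(3;n): minimum of p(\hat K_3; G) over c-colorings G on n vertices
   (all densities are <= 1, so starting the min at 1 is harmless). *)
Definition mc3n (R : realType) (c n : nat) : R :=
  \big[Num.min/1]_(G : coloring n c) pK3 R G.

Definition ramsey_tri (k N : nat) : Prop :=
  forall G : coloring N k, exists S : {set 'I_N}, mono_tri G S.

Definition is_R3 (k N : nat) : Prop :=
  ramsey_tri k N /\ forall M, ramsey_tri k M -> (N <= M)%N.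

(* looped c-coloring on r vertices: E u v is the color of {u,v}, read
   symmetrically through [lcol]; loops are {u,u}. *)
Definition lcol r c (E : 'I_r -> 'I_r -> 'I_c) (u v : 'I_r) : 'I_c :=
  if (u <= v)%N then E u v else E v u.

Definition in_Lex r c (cl : 'I_c) (E : 'I_r -> 'I_r -> 'I_c) : Prop :=
  (forall u, lcol E u u = cl) /\
  (forall u v, u != v -> lcol E u v != cl) /\
  (forall u v w, u != v -> v != w -> u != w ->
     ~ (lcol E u v = lcol E v w /\ lcol E v w = lcol E u w)).

(* H is in G_ex^(c) (on vertex set 'I_n), where r = R_{c-1}(3) - 1 *)
Definition in_Gex (R : realType) (r n c : nat) (H : coloring n c) : Prop :=
  exists (cl : 'I_c) (E : 'I_r -> 'I_r -> 'I_c) (phi : 'I_n -> 'I_r)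
         (G : coloring n c),
    in_Lex cl E /\
    (forall u v : 'I_n, u != v -> col G u v = lcol E (phi u) (phi v)) /\
    (forall x : 'I_r, `|(#|[set u | phi u == x]|)%:R - (n%:R / r%:R) : R| <= 1) /\
    (forall u v : 'I_n, u != v -> col H u v = col G u v \/ col H u v = cl) /\
    (forall S : {set 'I_n}, mono_tri H S -> mono_tri G S).

Definition cdist n c (G H : coloring n c) : nat :=
  #|[set p : 'I_n * 'I_n | (p.1 < p.2)%N && (col G p.1 p.2 != col H p.1 p.2)]|.

(* Main.v *)
(** Counting tuples with repetitions, the densities of monochromatic triangles and of the
two families become invariant under blow-up, so (A2) turns into an exact inequality
mono(h) >= vs + s (k31(h) + k33(h)) for every finite symmetric "looped" coloring h.

If k31 is small, then for most pairs x, y in many monochromatic triangles the common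
neighborhood of color h x y is almost a clique of that color, and two such neighborhoods
are almost equal or almost disjoint. A maximal family of almost disjoint ones covers nearly
all vertices, as the rest spans few triangles; forbidden patterns make the cross colors
constant, k33 makes all loop colors equal, and k31 excludes triangles between three classes.
Hence h is close to a blow-up of a triangle-free coloring with at most r = R_{c-1}(3) - 1
classes, and convexity gives vs = 1/r^2 and equal class sizes.

Below the size from which this applies, delta forces exact minimizers. In a minimizer every
vertex lies in few forbidden configurations (otherwise increase its weight), hence is attached
like a vertex of the blow-up. By the inequality for blow-ups with one recolored pair,
every wrong edge not of the loop color costs triangles to first order, so there is none. *)

Require Import Defs.
From HB Require Import structures.
From mathcomp Require Import all_boot all_order all_algebra.
From mathcomp Require Import all_classical all_reals all_analysis.
From mathcomp Require Import ring lra zify.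
Set Implicit Arguments. Unset Strict Implicit. Unset Printing Implicit Defensive.
Import Order.TTheory GRing.Theory Num.Theory numFieldNormedType.Exports.
Local Open Scope ring_scope.

(** The blow-up inequality is used through suitable test colorings: [h] itself, its restriction to a
    subset (so every set [A] spans triangles of density at least [vs * Pr R A ^+ 3]), [h] with one
    vertex overweighted, and a blow-up with one recolored pair. The obstacle is that [n0] must be
    chosen before [eps]. Stability works only from a threshold that depends on [eps], so between
    [n0] and this threshold the minimizers have to be determined exactly, and averaged statements
    must be sharpened to statements about every vertex and every edge. The loop color escapes this:
    a single edge between two classes in that color need not create a triangle, and this is the
    freedom in the definition of the extremal class. For any other color [d] the inequality shows
    that the extremal [E] itself has triangles prepared for a wrong edge: every class sees at least
    two classes in color [d], and two classes joined by a color other than [d] have a common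
    neighbor in color [d]. Positivity of [vs], which limits the set outside all clusters, follows
    from Ramsey's theorem and the monotonicity of m_c(3;n). *)

(** * Expectations over a finite type *)

Section Expectation.
Variable R : realFieldType.

(* 0 on an empty type. *)
Definition Ex (V : finType) (F : V -> R) : R := (\sum_x F x) / #|V|%:R.
Definition Pr (V : finType) (P : V -> bool) : R := Ex (fun x => (P x)%:R).
Definition Pr2 (V : finType) (P : V -> V -> bool) : R := Ex (fun x => Pr (P x)).
Definition Pr3 (V : finType) (P : V -> V -> V -> bool) : R :=
  Ex (fun x => Pr2 (P x)).
Definition Pr4 (V : finType) (P : V -> V -> V -> V -> bool) : R :=
  Ex (fun x => Pr3 (P x)).

Section OneType.
Variable V : finType.
Implicit Types (F G : V -> R) (P Q : V -> bool).

Lemma eq_Ex F G : F =1 G -> Ex F = Ex G.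
Proof. by move=> FG; rewrite /Ex (eq_bigr _ (fun x _ => FG x)). Qed.

Lemma le_Ex F G : (forall x, F x <= G x) -> Ex F <= Ex G.
Proof. by move=> FG; rewrite ler_wpM2r ?invr_ge0 // ler_sum. Qed.

Lemma ExD F G : Ex (fun x => F x + G x) = Ex F + Ex G.
Proof. by rewrite /Ex big_split mulrDl. Qed.

Lemma ExZ (a : R) F : Ex (fun x => a * F x) = a * Ex F.
Proof. by rewrite /Ex -mulr_sumr mulrA. Qed.

Lemma Ex_sum (I : Type) (s : seq I) (p : pred I) (F : I -> V -> R) :
  Ex (fun x => \sum_(i <- s | p i) F i x) = \sum_(i <- s | p i) Ex (F i).
Proof. by rewrite /Ex exchange_big mulr_suml. Qed.

Lemma Ex_ge0 F : (forall x, 0 <= F x) -> 0 <= Ex F.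
Proof. by move=> F0; rewrite mulr_ge0 ?invr_ge0 // sumr_ge0. Qed.

Lemma Ex_swap (W : finType) (F : V -> W -> R) :
  Ex (fun x => Ex (F x)) = Ex (fun y => Ex (F^~ y)).
Proof.
rewrite /Ex -!mulr_suml exchange_big -!mulrA.
by congr (_ * _); rewrite mulrC.
Qed.

Lemma Ex_const (a : R) : (0 < #|V|)%N -> Ex (fun _ : V => a) = a.
Proof.
move=> V0; rewrite /Ex.
have -> : \sum_(x : V) a = a * #|V|%:R by rewrite sumr_const mulr_natr.
by rewrite mulfK // pnatr_eq0 -lt0n.
Qed.

Lemma Ex_le_const F (a : R) : 0 <= a -> (forall x, F x <= a) -> Ex F <= a.
Proof.
move=> a0 Fa; apply: le_trans (le_Ex Fa) _.
case: (posnP #|V|) => [V0|/Ex_const ->//].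
by rewrite /Ex V0 invr0 mulr0.
Qed.

Lemma Pr_ge0 P : 0 <= Pr P.
Proof. by apply: Ex_ge0. Qed.

Lemma Pr_le1 P : Pr P <= 1.
Proof. by apply: Ex_le_const => // x; rewrite lern1 leq_b1. Qed.

Lemma eq_Pr P Q : P =1 Q -> Pr P = Pr Q.
Proof. by move=> PQ; apply: eq_Ex => x; rewrite PQ. Qed.

Lemma PrE P : Pr P = #|[set x | P x]|%:R / #|V|%:R.
Proof.
rewrite /Pr /Ex; congr (_ / _).
rewrite -sum1_card natr_sum [RHS]big_mkcond /=.
by apply: eq_bigr => x _; rewrite inE; case: (P x).
Qed.

Lemma ind_le_sum (T : Type) (b : bool) (p : T -> bool) (s : seq T) :
  (b -> has p s) -> (b%:R : R) <= \sum_(i <- s) (p i)%:R.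
Proof.
case: b => [/(_ isT)|_]; last by apply: sumr_ge0.
elim: s => //= i s IH; rewrite big_cons.
case: (p i) => [_|/IH] /=; last by rewrite add0r.
by rewrite lerDl; apply: sumr_ge0.
Qed.

Lemma Pr_union P (Qs : seq (V -> bool)) :
  (forall x, P x -> has (fun q => q x) Qs) -> Pr P <= \sum_(Q <- Qs) Pr Q.
Proof. by move=> H; rewrite -Ex_sum; apply: le_Ex => x; exact: (ind_le_sum (H x)). Qed.

Lemma Pr2_union (P : V -> V -> bool) (Qs : seq (V -> V -> bool)) :
  (forall x y, P x y -> has (fun q => q x y) Qs) -> Pr2 P <= \sum_(Q <- Qs) Pr2 Q.
Proof.
move=> H; rewrite -Ex_sum; apply: le_Ex => x; rewrite -Ex_sum; apply: le_Ex => y.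
exact: (ind_le_sum (H x y)).
Qed.

Lemma Pr3_union (P : V -> V -> V -> bool) (Qs : seq (V -> V -> V -> bool)) :
  (forall x y z, P x y z -> has (fun q => q x y z) Qs) ->
  Pr3 P <= \sum_(Q <- Qs) Pr3 Q.
Proof.
move=> H; rewrite -Ex_sum; apply: le_Ex => x; rewrite -Ex_sum; apply: le_Ex => y.
by rewrite -Ex_sum; apply: le_Ex => z; exact: (ind_le_sum (H x y z)).
Qed.

Lemma Pr4_union (P : V -> V -> V -> V -> bool) (Qs : seq (V -> V -> V -> V -> bool)) :
  (forall x y z w, P x y z w -> has (fun q => q x y z w) Qs) ->
  Pr4 P <= \sum_(Q <- Qs) Pr4 Q.
Proof.
move=> H; rewrite -Ex_sum; apply: le_Ex => x; rewrite -Ex_sum; apply: le_Ex => y.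
rewrite -Ex_sum; apply: le_Ex => z; rewrite -Ex_sum; apply: le_Ex => w.
exact: (ind_le_sum (H x y z w)).
Qed.

Lemma Pr_mono P Q : (forall x, P x -> Q x) -> Pr P <= Pr Q.
Proof.
by move=> PQ; apply: le_Ex => x; rewrite ler_nat; case: (P x) (PQ x) => // ->.
Qed.

Lemma Pr2_mono (P Q : V -> V -> bool) : (forall x y, P x y -> Q x y) -> Pr2 P <= Pr2 Q.
Proof. by move=> PQ; apply: le_Ex => x; apply: Pr_mono => y; apply: PQ. Qed.

Lemma Pr3_mono (P Q : V -> V -> V -> bool) :
  (forall x y z, P x y z -> Q x y z) -> Pr3 P <= Pr3 Q.
Proof. by move=> PQ; apply: le_Ex => x; apply: Pr2_mono => y z; apply: PQ. Qed.

Lemma Pr4_mono (P Q : V -> V -> V -> V -> bool) :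
  (forall x y z w, P x y z w -> Q x y z w) -> Pr4 P <= Pr4 Q.
Proof. by move=> PQ; apply: le_Ex => x; apply: Pr3_mono => y z w; apply: PQ. Qed.

Lemma Pr2_ge0 (P : V -> V -> bool) : 0 <= Pr2 P.
Proof. by apply: Ex_ge0 => x; apply: Pr_ge0. Qed.

Lemma Pr3_ge0 (P : V -> V -> V -> bool) : 0 <= Pr3 P.
Proof. by apply: Ex_ge0 => x; apply: Pr2_ge0. Qed.

Lemma Pr2_swap (P : V -> V -> bool) : Pr2 (fun x y => P y x) = Pr2 P.
Proof. exact: Ex_swap. Qed.

Lemma Pr3_swap12 (P : V -> V -> V -> bool) : Pr3 (fun x y z => P y x z) = Pr3 P.
Proof. exact: Ex_swap. Qed.

Lemma Pr3_swap23 (P : V -> V -> V -> bool) : Pr3 (fun x y z => P x z y) = Pr3 P.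
Proof. by apply: eq_Ex => x; rewrite Pr2_swap. Qed.

Lemma Pr4_swap12 (P : V -> V -> V -> V -> bool) :
  Pr4 (fun x y z w => P y x z w) = Pr4 P.
Proof. exact: Ex_swap. Qed.

Lemma Pr4_swap23 (P : V -> V -> V -> V -> bool) :
  Pr4 (fun x y z w => P x z y w) = Pr4 P.
Proof. by apply: eq_Ex => x; rewrite Pr3_swap12. Qed.

Lemma Pr4_swap34 (P : V -> V -> V -> V -> bool) :
  Pr4 (fun x y z w => P x y w z) = Pr4 P.
Proof. by apply: eq_Ex => x; rewrite Pr3_swap23. Qed.

Lemma markov F (t : R) : (forall x, 0 <= F x) -> 0 <= t ->
  Pr (fun x => t < F x) * t <= Ex F.
Proof.
move=> F0 t0; rewrite mulrC -ExZ; apply: le_Ex => x.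
by case: ltP => /= [/ltW|_]; rewrite ?mulr1 ?mulr0.
Qed.

Lemma markov2 (F : V -> V -> R) (t : R) : (forall x y, 0 <= F x y) -> 0 <= t ->
  Pr2 (fun x y => t < F x y) * t <= Ex (fun x => Ex (F x)).
Proof.
move=> F0 t0; rewrite mulrC -ExZ; apply: le_Ex => x.
by rewrite mulrC; apply: markov.
Qed.

Hypothesis V0 : (0 < #|V|)%N.

Lemma lt_Ex F G : (forall x, F x <= G x) -> (exists x, F x < G x) -> Ex F < Ex G.
Proof.
move=> FG [x0 lt0]; rewrite /Ex ltr_pM2r ?invr_gt0 ?ltr0n //.
rewrite (bigD1 x0) //= [ltRHS](bigD1 x0) //=.
by apply: ltr_leD => //; apply: ler_sum.
Qed.

(** First moment method: conditioned on [P], the mean of [G] is at most [a / Pr P], and some [x] in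
    [P] does not exceed the mean. *)
Lemma Ex_cond_le P (G : V -> R) (a : R) : (forall x, 0 <= G x) ->
  0 < Pr P -> Ex (fun x => (P x)%:R * G x) <= a -> exists2 x, P x & G x * Pr P <= a.
Proof.
move=> G0 P0 Ha.
case: (pickP (fun x => P x && (G x * Pr P <= a))) => [x /andP[]|no]; first by exists x.
have no' x : P x -> a < G x * Pr P.
  by move=> Px; have := no x; rewrite Px /= leNgt => /negbFE.
have [x0 Px0] : exists x, P x.
  case: (pickP P) => [x|P_0]; first by exists x.
  by move: P0; rewrite (eq_Pr P_0) /Pr Ex_const // ltxx.
suff : a * Pr P < Ex (fun x => (P x)%:R * G x) * Pr P.
  by rewrite ltr_pM2r // ltNge Ha.
rewrite -ExZ [_ * Pr P]mulrC -ExZ; apply: lt_Ex => [x|]; last first.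
  by exists x0; rewrite Px0 mulr1 mul1r mulrC; apply: no'.
case Px: (P x); first by rewrite mulr1 mul1r mulrC ltW ?no'.
by rewrite !(mulr0, mul0r).
Qed.

Lemma Pr3_12 (Q : V -> V -> bool) : Pr3 (fun x y z => Q x y) = Pr2 Q.
Proof. by apply: eq_Ex => x; apply: eq_Ex => y; rewrite /Pr Ex_const. Qed.

Lemma Pr3_13 (Q : V -> V -> bool) : Pr3 (fun x y z => Q x z) = Pr2 Q.
Proof. by apply: eq_Ex => x; rewrite /Pr2 Ex_const. Qed.

Lemma Pr3_23 (Q : V -> V -> bool) : Pr3 (fun x y z => Q y z) = Pr2 Q.
Proof. by rewrite /Pr3 Ex_const. Qed.

Lemma Pr2_2 P : Pr2 (fun x y => P y) = Pr P.
Proof. by rewrite /Pr2 Ex_const. Qed.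

Lemma Pr2_1 P : Pr2 (fun x y => P x) = Pr P.
Proof. by apply: eq_Ex => x; rewrite /Pr Ex_const. Qed.

Lemma Pr4_234 (Q : V -> V -> V -> bool) : Pr4 (fun x y z w => Q y z w) = Pr3 Q.
Proof. by rewrite /Pr4 Ex_const. Qed.

Lemma Pr4_123 (Q : V -> V -> V -> bool) : Pr4 (fun x y z w => Q x y z) = Pr3 Q.
Proof. by apply: eq_Ex => x; rewrite Pr3_12. Qed.

Lemma Pr4_124 (Q : V -> V -> V -> bool) : Pr4 (fun x y z w => Q x y w) = Pr3 Q.
Proof. by apply: eq_Ex => x; rewrite Pr3_13. Qed.

Lemma Pr_andl (b : bool) P : Pr (fun x => b && P x) = b%:R * Pr P.
Proof. by rewrite -ExZ; apply: eq_Ex => x; rewrite -natrM mulnb. Qed.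

Lemma Pr2_andl (b : bool) (Q : V -> V -> bool) : Pr2 (fun x y => b && Q x y) = b%:R * Pr2 Q.
Proof. by rewrite -ExZ; apply: eq_Ex => x; rewrite Pr_andl. Qed.

Lemma Pr2_prod P Q : Pr2 (fun x y => P x && Q y) = Pr P * Pr Q.
Proof.
rewrite mulrC -ExZ; apply: eq_Ex => x.
by rewrite Pr_andl mulrC.
Qed.

Lemma Pr3_prod P Q (S : V -> bool) :
  Pr3 (fun x y z => [&& P x, Q y & S z]) = Pr P * (Pr Q * Pr S).
Proof.
rewrite mulrC -ExZ; apply: eq_Ex => x.
by rewrite Pr2_andl Pr2_prod mulrC.
Qed.

Lemma Pr4_prod P Q (S T : V -> bool) :
  Pr4 (fun x y z w => [&& P x, Q y, S z & T w]) = Pr P * (Pr Q * (Pr S * Pr T)).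
Proof.
rewrite mulrC -ExZ; apply: eq_Ex => x; rewrite -Pr3_prod mulrC -ExZ.
by apply: eq_Ex => y; rewrite Pr2_andl.
Qed.

Lemma Pr_compl P : Pr (fun x => ~~ P x) = 1 - Pr P.
Proof.
apply/eqP; rewrite eq_sym subr_eq -ExD -[X in X == _](Ex_const 1 V0); apply/eqP.
by apply: eq_Ex => x; case: (P x); rewrite ?addr0 ?add0r.
Qed.

End OneType.
End Expectation.

(** * Random tuples as uniform finite functions *)

Section FiniteFunctions.
Variables (R : realFieldType) (V : finType).
Hypothesis V0 : (0 < #|V|)%N.

Lemma Ex_ffun_prod (I : finType) (F : I -> V -> R) :
  Ex (fun t : {ffun I -> V} => \prod_i F i (t i)) = \prod_i Ex (F i).
Proof.
rewrite /Ex -bigA_distr_bigA /= big_split /= prodr_const card_ffun.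
by rewrite natrX exprVn.
Qed.

Lemma Pr_ffun_forall (I : finType) (A : I -> V -> bool) :
  Pr R (fun t : {ffun I -> V} => [forall i, A i (t i)]) = \prod_i Pr R (A i).
Proof.
rewrite -Ex_ffun_prod; apply: eq_Ex => t.
case: forallP => [H|/forallP]; first by rewrite big1 // => i _; rewrite H.
rewrite negb_forall => /existsP[i /negbTE Hi].
by rewrite (bigD1 i) //= Hi mul0r.
Qed.

Lemma Pr_eq1 (p : V) : Pr R (fun x => x == p) = #|V|%:R^-1.
Proof.
by rewrite /Pr /Ex (bigD1 p) //= eqxx big1 ?addr0 ?mul1r // => x /negbTE->.
Qed.

(** Expanding [Q] over the pairs of values [p], [q] gives products of functions of single
    coordinates, to which [Ex_ffun_prod] applies. *)
Lemma Pr_ffun2 (I : finType) (i j : I) (Q : V -> V -> bool) : i != j ->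
  Pr R (fun t : {ffun I -> V} => Q (t i) (t j)) = Pr2 R Q.
Proof.
move=> ij.
pose F (p q : V) (l : I) (x : V) : R :=
  if l == i then (x == p)%:R else if l == j then (x == q)%:R else 1.
transitivity (Ex (fun t : {ffun I -> V} =>
    \sum_p \sum_q (Q p q)%:R * \prod_l F p q l (t l))).
  apply: eq_Ex => t; rewrite (bigD1 (t i)) //= (bigD1 (t j)) //=.
  have -> : \prod_l F (t i) (t j) l (t l) = 1.
    by apply: big1 => l _; rewrite /F; case: eqP => [->|_]; [|case: eqP => [->|]]; rewrite ?eqxx.
  rewrite mulr1 big1 => [|q qj]; last first.
    rewrite (bigD1 j) //= /F eq_sym (negbTE ij) eqxx eq_sym (negbTE qj).
    by rewrite mul0r mulr0.
  rewrite big1 ?addr0 // => p pi; apply: big1 => q _.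
  by rewrite (bigD1 i) //= /F eqxx eq_sym (negbTE pi) mul0r mulr0.
rewrite Ex_sum /Pr2 [RHS]/Ex mulr_suml; apply: eq_bigr => p _.
rewrite Ex_sum /Pr [in RHS]/Ex !mulr_suml; apply: eq_bigr => q _.
rewrite ExZ Ex_ffun_prod (bigD1 i) //= (bigD1 j) 1?eq_sym //=.
rewrite big1 => [|l /andP[li lj]]; last first.
  by rewrite -[RHS](Ex_const 1 V0); apply: eq_Ex => x; rewrite /F (negbTE li) (negbTE lj).
rewrite mulr1 -mulrA; congr (_ * (_ * _)).
  by rewrite -(Pr_eq1 p); apply: eq_Ex => x; rewrite /F eqxx.
by rewrite -(Pr_eq1 q); apply: eq_Ex => x; rewrite /F eq_sym (negbTE ij) eqxx.
Qed.

Definition fcons k (x : V) (s : {ffun 'I_k -> V}) : {ffun 'I_k.+1 -> V} :=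
  [ffun i => oapp s x (unlift ord0 i)].

Lemma Ex_ffunS k (F : {ffun 'I_k.+1 -> V} -> R) :
  Ex F = Ex (fun x => Ex (fun s : {ffun 'I_k -> V} => F (fcons x s))).
Proof.
rewrite /Ex -mulr_suml pair_bigA /= !card_ffun !card_ord expnS natrM invfM mulrA.
rewrite [RHS]mulrAC; congr (_ / _ / _).
rewrite (reindex (fun p : V * {ffun 'I_k -> V} => fcons p.1 p.2)) //.
exists (fun t : {ffun 'I_k.+1 -> V} =>
  (t ord0, [ffun i : 'I_k => t (lift ord0 i)])) => [[x s] _|t _] /=.
  rewrite /fcons ffunE unlift_none /=; congr (_, _).
  by apply/ffunP => i; rewrite !ffunE liftK.
apply/ffunP => i; rewrite ffunE; case: unliftP => [j ->|->] //=.
by rewrite ffunE.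
Qed.

Lemma Ex_ffun0 (F : {ffun 'I_0 -> V} -> R) (t : {ffun 'I_0 -> V}) : Ex F = F t.
Proof.
have H : forall s, s = t by move=> s; apply/ffunP => -[].
rewrite /Ex card_ffun card_ord expn0 invr1 mulr1 (bigD1 t) //= big1 ?addr0 //.
by move=> s; rewrite (H s) eqxx.
Qed.

Local Notation o0 := ord0.
Local Notation o1 := (lift ord0 ord0).
Local Notation o2 := (lift ord0 (lift ord0 ord0)).
Local Notation o3 := (lift ord0 (lift ord0 (lift ord0 ord0))).

Lemma Pr_ffun3 (P : V -> V -> V -> bool) :
  Pr R (fun t : {ffun 'I_3 -> V} => P (t o0) (t o1) (t o2)) = Pr3 R P.
Proof.
rewrite /Pr Ex_ffunS; apply: eq_Ex => x; rewrite Ex_ffunS; apply: eq_Ex => y.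
rewrite Ex_ffunS; apply: eq_Ex => z.
have t0 : {ffun 'I_0 -> V} by apply: finfun; case.
rewrite (Ex_ffun0 _ t0) /fcons !ffunE unlift_none /=.
by rewrite !liftK /= !ffunE unlift_none liftK /= ffunE unlift_none.
Qed.

Lemma Pr_ffun4 (P : V -> V -> V -> V -> bool) :
  Pr R (fun t : {ffun 'I_4 -> V} => P (t o0) (t o1) (t o2) (t o3)) = Pr4 R P.
Proof.
rewrite /Pr Ex_ffunS; apply: eq_Ex => x; rewrite Ex_ffunS; apply: eq_Ex => y.
rewrite Ex_ffunS; apply: eq_Ex => z; rewrite Ex_ffunS; apply: eq_Ex => w.
have t0 : {ffun 'I_0 -> V} by apply: finfun; case.
rewrite (Ex_ffun0 _ t0) /fcons !ffunE unlift_none /=.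
by rewrite !liftK /= !ffunE unlift_none !liftK /= !ffunE unlift_none liftK /= ffunE unlift_none.
Qed.
End FiniteFunctions.

Lemma Ex_pair (R : realFieldType) (V W : finType) (F : V * W -> R) :
  Ex F = Ex (fun x => Ex (fun y => F (x, y))).
Proof.
rewrite /Ex -mulr_suml pair_bigA /= card_prod natrM invfM mulrA [RHS]mulrAC.
by congr (_ / _ / _); apply: eq_bigr => -[].
Qed.

Lemma Ex_enum_val (R : realFieldType) (W : finType) (F : W -> R) :
  Ex (fun i : 'I_#|W| => F (enum_val i)) = Ex F.
Proof.
by rewrite /Ex card_ord; congr (_ / _); rewrite -(big_enum_val F).
Qed.

(** * Forbidden patterns and near-cliques *)

Section Patterns.
Variable c : nat.
Implicit Types a b e d : 'I_c.

Lemma K31_aab a e : e != a -> K31_pattern a e a a.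
Proof. by rewrite /K31_pattern eqxx => /negbTE->. Qed.

Lemma K31_baa a e : e != a -> K31_pattern a a a e.
Proof. by rewrite /K31_pattern eqxx => /negbTE->. Qed.

Lemma K31_dee a d e : d != a -> e != a -> d != e -> K31_pattern a d e e.
Proof. by rewrite /K31_pattern eqxx => /negbTE-> /negbTE-> /negbTE->. Qed.

End Patterns.

Section Structure.
Variables (R : realFieldType) (c : nat) (V : finType).
Variable h : V -> V -> 'I_c.

Definition mono3 x y z := (h x y == h x z) && (h x y == h y z).

(* The vertices may coincide: the densities of mono3, k31 and k33 run over all
   tuples and then depend on h only up to blow-up; x is the apex. *)
Definition k31 x y z w :=
  mono3 y z w && K31_pattern (h y z) (h x y) (h x z) (h x w).

Definition common x y z := (h x z == h x y) && (h y z == h x y).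

Hypothesis hC : forall x y, h x y = h y x.
Hypothesis V0 : (0 < #|V|)%N.

Definition near_clique (nu : R) (A : V -> bool) (a : 'I_c) :=
  Pr2 R (fun z z' => [&& A z, A z' & h z z' != a]) <= nu.

(** In [k31 h w x z z'] the apex is [w], so [x] is a vertex of the triangle. The two ends of a clean
    pair are anchors of its common neighborhood. *)
Definition anchor (nu : R) (A : V -> bool) (a : 'I_c) (x : V) :=
  (forall z, A z -> h x z = a) /\ Pr3 R (fun w z z' => k31 w x z z') <= nu.

Implicit Types (nu : R) (A B I : V -> bool) (a b : 'I_c).

(** Either [z z'] is one of the few pairs of [A] in a wrong color, or [x z z'] is a triangle of
    color [a] to which [u] sends two edges of color [a] and one of another color. *)
Lemma anchor_bound nu A a x B I : near_clique nu A a -> anchor nu A a x ->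
  (forall u, B u -> h u x != a) -> (forall z, I z -> A z) ->
  Pr3 R (fun u z z' => [&& B u, I z, I z', h u z == a & h u z' == a]) <= 2 * nu.
Proof.
move=> Acl [xA xk] Bx IA.
apply: le_trans (_ : Pr3 R (fun w z z' => k31 w x z z') +
   Pr3 R (fun u z z' => [&& A z, A z' & h z z' != a]) <= _); last first.
  by rewrite (Pr3_23 _ V0); move: Acl; rewrite /near_clique; lra.
apply: le_trans (Pr3_union (Qs := [:: fun w z z' => k31 w x z z';
   fun u z z' => [&& A z, A z' & h z z' != a]]) _ _) _; last first.
  by rewrite !big_cons big_nil addr0.
move=> u z z' /and5P[/Bx ux /IA Az /IA Az' uz uz'] /=.
rewrite Az Az' /=; case: eqVneq => [zz'|_]; last by rewrite orbT.
rewrite orbF /k31 /mono3 (xA _ Az) (xA _ Az') zz' eqxx /=.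
by rewrite (eqP uz) (eqP uz') K31_aab.
Qed.

Lemma overlap_color nu A a B b : near_clique nu A a -> near_clique nu B b ->
  2 * nu < Pr R (fun z => A z && B z) ^+ 2 -> a = b.
Proof.
move=> Acl Bcl lt; apply/eqP; case: (eqVneq a b) => // ab.
suff : Pr R (fun z => A z && B z) ^+ 2 <= 2 * nu by rewrite leNgt lt.
rewrite expr2 -Pr2_prod; apply: le_trans (_ : nu + nu <= _); last by lra.
apply: le_trans (lerD Acl Bcl).
apply: le_trans (Pr2_union (Qs := [:: fun z z' => [&& A z, A z' & h z z' != a];
   fun z z' => [&& B z, B z' & h z z' != b]]) _ _) _; last first.
  by rewrite !big_cons big_nil addr0.
move=> z z' /andP[/andP[Az Bz] /andP[Az' Bz']] /=; rewrite Az Bz Az' Bz' /=.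
by case: eqVneq => // ->; rewrite ab.
Qed.

(** As [B] is a near-clique, a vertex of [B] is mostly joined in color [a] to two random vertices of
    the overlap; those with a wrong color to [x] are then limited by [anchor_bound]. *)
Lemma overlap_sub nu A a x B : near_clique nu A a -> anchor nu A a x ->
  near_clique nu B a ->
  Pr R (fun u => B u && (h u x != a)) * Pr R (fun z => A z && B z) ^+ 2 <= 4 * nu.
Proof.
move=> Acl xA Bcl; rewrite expr2 -Pr3_prod.
have bd := anchor_bound (B := fun u => B u && (h u x != a))
  (I := fun z => A z && B z) Acl xA.
have {}bd := bd (fun u P => proj2 (andP P)) (fun u P => proj1 (andP P)).
pose Bad := fun z z' => [&& B z, B z' & h z z' != a].
apply: le_trans (Pr3_union (Qs := [:: fun u z z' => [&& B u && (h u x != a),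
   A z && B z, A z' && B z', h u z == a & h u z' == a];
   fun u z z' => Bad u z; fun u z z' => Bad u z']) _ _) _; last first.
  rewrite !big_cons big_nil addr0 Pr3_12 ?Pr3_13 //.
  by move: Bcl; rewrite /near_clique -/Bad; lra.
move=> u z z' /and3P[/andP[Bu ux] /andP[Az Bz] /andP[Az' Bz']] /=.
rewrite /Bad Bu Bz Bz' ux Az Az' /=.
by case: (h u z == a); case: (h u z' == a).
Qed.

(** Two random vertices of [A] are both joined to such a [u] in color [a] with probability at least
    [(Pr R A / 2) ^+ 2], and [anchor_bound] applies with [I = A]. *)
Lemma anchored_half nu A a x : near_clique nu A a -> anchor nu A a x ->
  Pr R (fun u => (h u x != a) && (Pr R A / 2 <= Pr R (fun z => A z && (h u z == a))))
   * (Pr R A) ^+ 2 <= 8 * nu.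
Proof.
move=> Acl xA.
set B := fun u => _ && _.
have bd := anchor_bound (B := B) (I := A) Acl xA.
have {}bd := bd (fun u P => proj1 (andP P)) (fun u => id).
suff : Pr R B * (Pr R A / 2) ^+ 2 <= 2 * nu by lra.
apply: le_trans bd; rewrite mulrC -ExZ; apply: le_Ex => u.
rewrite Pr2_andl mulrC; case Bu: (B u); last by rewrite !mul0r.
rewrite !mul1r; move: Bu => /andP[_ half].
have -> : Pr2 R (fun z z' => [&& A z, A z', h u z == a & h u z' == a]) =
   Pr2 R (fun z z' => (A z && (h u z == a)) && (A z' && (h u z' == a))).
  apply: eq_Ex => z; apply: eq_Pr => z'.
  by case: (A z); case: (A z'); rewrite ?andbF.
rewrite Pr2_prod -expr2; apply: lerXn2r half; rewrite ?nnegrE.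
  by rewrite divr_ge0 // Pr_ge0.
by rewrite Pr_ge0.
Qed.

Definition spread (eps : R) A v :=
  [forall b, eps < Pr R (fun z => A z && (h v z != b))].

Lemma spreadPn eps A v : ~~ spread eps A v ->
  exists b, Pr R (fun z => A z && (h v z != b)) <= eps.
Proof.
by rewrite negb_forall => /existsP[b]; rewrite -leNgt => ?; exists b.
Qed.

(* For most u two random v, v0 in B agree at u, so a typical v0 carries the color
   that it has on A over to all of A x B. *)
Lemma two_sided_concentration (eps eta : R) A B : 0 <= eps -> eps <= eta / 2 -> eta <= Pr R B ->
  Pr R (spread eps A) <= eps -> Pr R (spread eps B) <= eps -> 0 < eta ->
  exists b, Pr2 R (fun u v => [&& A u, B v & h u v != b]) * eta <= 7 * eps.
Proof.
move=> eps0 epseta etaB sA sB eta0.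
pose P v0 := B v0 && ~~ spread eps A v0.
have PP : eta / 2 <= Pr R P.
  have : Pr R B <= Pr R P + Pr R (spread eps A).
    apply: le_trans (Pr_union (Qs := [:: P; spread eps A]) _ _) _; last first.
      by rewrite !big_cons big_nil addr0.
    by move=> v Bv; rewrite /= /P Bv /=; case: (spread _ _ _).
  by lra.
have P0 : 0 < Pr R P by lra.
pose Q v0 u v := [&& A u, B v & h u v != h u v0].
have H : Ex (fun v0 => (P v0)%:R * Pr2 R (Q v0)) <= 3 * eps.
  apply: le_trans (_ : Pr3 R (fun v0 u v => P v0 && Q v0 u v) <= _).
    by apply: le_Ex => v0; rewrite Pr2_andl.
  rewrite -Pr3_swap12.
  apply: le_trans (_ : Ex (fun u => 2 * eps + (spread eps B u)%:R) <= _); last first.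
    by rewrite ExD Ex_const //; move: sB; rewrite /Pr; lra.
  apply: le_Ex => u; case Su: (spread eps B u).
    apply: le_trans (_ : 1 <= _); last by rewrite lerDr mulr_ge0.
    by apply: Ex_le_const => // x; apply: Pr_le1.
  rewrite addr0; have [b Hb] := spreadPn (negbT Su).
  apply: le_trans (_ : Pr2 R (fun v0 v => B v0 && (h u v0 != b)) +
                       Pr2 R (fun v0 v => B v && (h u v != b)) <= _); last first.
    by rewrite Pr2_1 ?Pr2_2 //; lra.
  apply: le_trans (Pr2_union (Qs := [:: fun v0 v => B v0 && (h u v0 != b);
    fun v0 v => B v && (h u v != b)]) _ _) _; last first.
    by rewrite !big_cons big_nil addr0.
  move=> v0 v /andP[/andP[Bv0 _] /and3P[_ Bv uv]] /=.
  rewrite Bv0 Bv /= orbF; case: (eqVneq (h u v0) b) uv => // ->.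
  by move=> /negbTE->.
have [v0 /andP[Bv0 /spreadPn[b Hb]] HQ] :=
  Ex_cond_le V0 (fun v => @Pr2_ge0 R V (Q v)) P0 H.
exists b.
have : Pr2 R (fun u v => [&& A u, B v & h u v != b]) <= Pr2 R (Q v0) + eps.
  apply: le_trans (lerD (lexx _) Hb).
  rewrite -[X in _ <= _ + X](Pr2_1 _ V0).
  apply: le_trans (Pr2_union (Qs := [:: Q v0; fun u v => A u && (h v0 u != b)]) _ _) _; last first.
    by rewrite !big_cons big_nil addr0.
  move=> u v /and3P[Au Bv uv]; rewrite /= /Q Au Bv /= orbF (hC v0).
  by case: (eqVneq (h u v0) b) => [->|]; rewrite ?orbT ?uv.
move=> Hle; have Q0 := @Pr2_ge0 R V (Q v0).
have etale1 : eta <= 1 by apply: le_trans etaB (Pr_le1 _ _).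
have : Pr2 R (Q v0) * (eta / 2) <= 3 * eps.
  by apply: le_trans HQ; rewrite ler_wpM2l.
nra.
Qed.
End Structure.

Lemma mul3_gt (R : realFieldType) (m x y z : R) : 0 < m -> m < x -> m <= y -> m <= z ->
  m ^+ 3 < x * (y * z).
Proof.
move=> m0 mx my mz; have mm : m * m <= y * z by apply: ler_pM => //; apply: ltW.
rewrite exprS expr2; apply: lt_le_trans (_ : x * (m * m) <= _).
  by rewrite ltr_pM2r // mulr_gt0.
by rewrite ler_wpM2l // ltW // (lt_trans m0).
Qed.

(* A color b of A-density at least eta/c leaves no room: if b = a, then a third
   vertex of another color gives the pattern (2,1,0); if b <> a, then a third color
   gives (0,2,1), and two vertices of color a give (2,1,0). *)
Lemma concentration (R : realFieldType) (c : nat) (eps eta : R) : 0 < eps -> 0 < eta ->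
  exists2 kap : R, 0 < kap & forall (V : finType) (A : V -> bool) (g : V -> 'I_c) (a : 'I_c),
    (0 < #|V|)%N -> eta <= Pr R A ->
    Pr3 R (fun z z' z'' => [&& A z, A z', A z'' & K31_pattern a (g z) (g z') (g z'')]) <= kap ->
    exists b, Pr R (fun z => A z && (g z != b)) <= eps.
Proof.
move=> eps0 eta0.
(* Dividing by [c.+1] makes the pigeonhole strict: [c] colors of density below [t] do not fill [A].
   Three events of probability above [m / 2] would exceed the bound [(m / 2) ^+ 3]. *)
pose t := eta / c.+1%:R; pose m := Num.min eps t.
have t0 : 0 < t by rewrite divr_gt0.
have m0 : 0 < m by rewrite lt_min eps0.
have meps : m <= eps by rewrite ge_min lexx.
have mt : m <= t by rewrite ge_min lexx orbT.
exists ((m / 2) ^+ 3) => [|V A g a V0 etaA HK]; first by rewrite exprn_gt0 ?divr_gt0.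
pose al b := Pr R (fun z => A z && (g z == b)).
have Asum : Pr R A = \sum_b al b.
  rewrite -Ex_sum; apply: eq_Ex => z; case: (A z) => /=; last by rewrite big1.
  by rewrite (bigD1 (g z)) //= eqxx big1 ?addr0 // => b /negbTE; rewrite eq_sym => ->.
have [b Hb] : exists b, m <= al b.
  case: (pickP (fun b => m <= al b)) => [b ?|no]; first by exists b.
  suff : Pr R A < eta by rewrite ltNge etaA.
  rewrite Asum; apply: le_lt_trans (_ : _ <= \sum_(b < c) m) _.
    by apply: ler_sum => b _; rewrite ltW // ltNge no.
  rewrite sumr_const card_ord -mulr_natr.
  apply: le_lt_trans (_ : _ <= t * c%:R) _; first by rewrite ler_wpM2r.
  by rewrite /t mulrAC ltr_pdivrMr // ltr_pM2l // ltr_nat.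
have small3 (P Q S : V -> bool) :
    (forall z z' z'', P z -> Q z' -> S z'' ->
      [&& A z, A z', A z'' & K31_pattern a (g z) (g z') (g z'')]) ->
    Pr R P * (Pr R Q * Pr R S) <= (m / 2) ^+ 3.
  move=> H; apply: le_trans HK; rewrite -Pr3_prod; apply: Pr3_mono.
  by move=> z z' z'' /and3P[*]; apply: H.
exists b; case: (eqVneq b a) Hb => [->|ba] Hb.
  have H := small3 (fun z => A z && (g z != a)) (fun z => A z && (g z == a))
    (fun z => A z && (g z == a)).
  have {}H : Pr R (fun z => A z && (g z != a)) * (al a * al a) <= (m / 2) ^+ 3.
    apply: H => z z' z'' /andP[-> ?] /andP[-> /eqP->] /andP[-> /eqP->] /=.
    exact: K31_aab.
  have X0 := Pr_ge0 R (fun z => A z && (g z != a)).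
  case: (leP (Pr R (fun z => A z && (g z != a))) eps) => // lt.
  by move: H; rewrite leNgt mul3_gt //; lra.
have H1 := small3 (fun z => [&& A z, g z != a & g z != b]) (fun z => A z && (g z == b))
    (fun z => A z && (g z == b)).
have {}H1 : Pr R (fun z => [&& A z, g z != a & g z != b]) * (al b * al b) <= (m / 2) ^+ 3.
  apply: H1 => z z' z'' /and3P[-> ? ?] /andP[-> /eqP->] /andP[-> /eqP->] /=.
  exact: K31_dee.
have H2 := small3 (fun z => A z && (g z == b)) (fun z => A z && (g z == a))
    (fun z => A z && (g z == a)).
have {}H2 : al b * (al a * al a) <= (m / 2) ^+ 3.
  apply: H2 => z z' z'' /andP[-> /eqP->] /andP[-> /eqP->] /andP[-> /eqP->] /=.
  exact: K31_aab.
apply: le_trans (_ : Pr R (fun z => [&& A z, g z != a & g z != b]) + al a <= _).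
  apply: le_trans (Pr_union (Qs := [:: fun z => [&& A z, g z != a & g z != b];
     fun z => A z && (g z == a)]) _ _) _; last by rewrite !big_cons big_nil addr0.
  by move=> z /andP[Az gz]; rewrite /= Az gz /=; case: eqVneq.
have X0 := Pr_ge0 R (fun z => [&& A z, g z != a & g z != b]).
have a0 : 0 <= al a by apply: Pr_ge0.
have : Pr R (fun z => [&& A z, g z != a & g z != b]) <= eps / 2.
  case: leP => // lt.
  by move: H1; rewrite leNgt mul3_gt //; lra.
have : al a <= eps / 2.
  case: leP => // lt.
  by move: H2; rewrite mulrA [al b * _]mulrC -mulrA leNgt mul3_gt //; lra.
lra.
Qed.

(** * Clusters: common neighborhoods of clean pairs *)

Section Clusters.
Variables (R : realFieldType) (c : nat) (V : finType).
Variable h : V -> V -> 'I_c.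
Hypothesis hC : forall x y, h x y = h y x.
Hypothesis V0 : (0 < #|V|)%N.

Definition q31 : R := Pr4 R (k31 h).

(** The index [bool] selects the triangle. Distinct indices may carry the same vertex, whose loop
    color is then read. *)
Definition k33 (t : {ffun bool * 'I_3 -> V}) :=
  [exists a, exists b, exists d, [&& a != b, a != d, b != d &
    [forall p, forall q, (p != q) ==>
      (h (t p) (t q) == if p.1 != q.1 then d else if p.1 then a else b)]]].

Definition q33 : R := Pr R k33.

Lemma Pr2_exists (I : finType) (Q : I -> V -> V -> bool) :
  Pr2 R (fun u v => [exists i, Q i u v]) <= \sum_i Pr2 R (Q i).
Proof.
rewrite -Ex_sum; apply: le_Ex => u; rewrite -Ex_sum; apply: le_Ex => v.
case: existsP => [[i Qi]|_]; last by apply: sumr_ge0.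
by rewrite (bigD1 i) //= Qi lerDl; apply: sumr_ge0.
Qed.

(** [nu] bounds the defects of a clean pair, [eta] is the least size of a cluster, [theta] the
    largest overlap of clusters that count as different, and [e3] the error of the color between two
    clusters. *)
Variables nu eta theta e3 : R.

Let U (p : V * V) := common h p.1 p.2.
Let col p := h p.1 p.2.

Definition clean p :=
  [&& Pr2 R (fun z z' => [&& U p z, U p z' & h z z' != col p]) <= nu,
      Pr3 R (fun w z z' => k31 h w p.1 z z') <= nu &
      Pr3 R (fun w z z' => k31 h w p.2 z z') <= nu].

Lemma clean_near p : clean p -> near_clique h nu (U p) (col p).
Proof. by case/and3P. Qed.

Lemma clean_anchor1 p : clean p -> anchor h nu (U p) (col p) p.1.
Proof. by case/and3P => _ ? _; split=> // z /andP[/eqP]. Qed.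

Lemma clean_anchor2 p : clean p -> anchor h nu (U p) (col p) p.2.
Proof. by case/and3P => _ _ ?; split=> // z /andP[_ /eqP]. Qed.

(** Markov's inequality for each of the three conditions. For the first one, a wrong pair [z], [w]
    in the common neighborhood of [x], [y] is itself a forbidden configuration: the triangle [x y z]
    with apex [w] has pattern (2,1,0). *)
Lemma not_clean_le : 0 <= nu -> Pr2 R (fun x y => ~~ clean (x, y)) * nu <= 3 * q31.
Proof.
move=> nu0.
pose F1 x y : R := Pr2 R (fun z z' => [&& U (x, y) z, U (x, y) z' & h z z' != col (x, y)]).
pose F2 x (y : V) : R := Pr3 R (fun w z z' => k31 h w x z z').
pose F3 (x : V) y : R := Pr3 R (fun w z z' => k31 h w y z z').
have E2 : Ex (fun x => Ex (F2 x)) = q31.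
  rewrite /q31 -Pr4_swap12; apply: eq_Ex => x; exact: Ex_const.
have E3 : Ex (fun x => Ex (F3 x)) = q31.
  by rewrite -E2 Ex_swap.
have E1 : Ex (fun x => Ex (F1 x)) <= q31.
  rewrite /q31 -Pr4_swap12 -Pr4_swap23 -Pr4_swap34.
  apply: Pr4_mono => x y z w /and3P[/andP[/eqP /= xz /eqP yz] /andP[/eqP xw /eqP yw] zw].
  rewrite /k31 /mono3 /= !xz !yz eqxx /=.
  by rewrite (hC w x) (hC w y) (hC w z) /= xw yw K31_baa.
apply: le_trans (_ : (Pr2 R (fun x y => nu < F1 x y) + (Pr2 R (fun x y => nu < F2 x y)
   + Pr2 R (fun x y => nu < F3 x y))) * nu <= _).
  rewrite ler_wpM2r //.
  apply: le_trans (Pr2_union (Qs := [:: fun x y => nu < F1 x y;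
    fun x y => nu < F2 x y; fun x y => nu < F3 x y]) _ _) _; last first.
    by rewrite !big_cons big_nil addr0.
  by move=> x y; rewrite /clean /= !negb_and -!ltNge orbF.
have M1 := markov2 (F := F1) (fun x y => Pr2_ge0 _ _) nu0.
have M2 := markov2 (F := F2) (fun x y => Pr3_ge0 _ _) nu0.
have M3 := markov2 (F := F3) (fun x y => Pr3_ge0 _ _) nu0.
rewrite !mulrDl; lra.
Qed.

Definition good p := clean p && (eta <= Pr R (U p)).

Definition overlap p q : R := Pr R (fun z => U p z && U q z).

Lemma overlapC p q : overlap p q = overlap q p.
Proof. by apply: eq_Pr => z; rewrite andbC. Qed.

Definition scattered (F : {set V * V}) :=
  [forall p in F, good p] &&
  [forall p in F, forall q in F, (p != q) ==> (overlap p q <= theta)].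

Hypotheses (theta0 : 0 < theta) (nu_theta : 2 * nu < theta ^+ 2).

(** A large overlap forces equal colors, so [overlap_sub] applies at both ends of [q], and a vertex
    outside [U q] has a wrong color to one of them. *)
Lemma overlap_cover p q : clean p -> clean q -> theta < overlap p q ->
  Pr R (fun u => U p u && ~~ U q u) * theta ^+ 2 <= 8 * nu.
Proof.
move=> cp cq ov.
have ov2 : theta ^+ 2 < overlap q p ^+ 2.
  by rewrite overlapC ltr_pXn2r // nnegrE ltW // (lt_trans theta0).
have eqc : col q = col p.
  apply: (overlap_color (clean_near cq) (clean_near cp)).
  exact: lt_trans nu_theta ov2.
have cp' := clean_near cp; rewrite -eqc in cp'.
have H1 := overlap_sub V0 (clean_near cq) (clean_anchor1 cq) cp'.
have H2 := overlap_sub V0 (clean_near cq) (clean_anchor2 cq) cp'.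
have le_th X : 0 <= X -> X * overlap q p ^+ 2 <= 4 * nu -> X * theta ^+ 2 <= 4 * nu.
  by move=> X0; apply: le_trans; rewrite ler_wpM2l // ltW.
have {}H1 := le_th _ (Pr_ge0 _ _) H1; have {}H2 := le_th _ (Pr_ge0 _ _) H2.
have : Pr R (fun u => U p u && ~~ U q u) <=
    Pr R (fun u => U p u && (h u q.1 != col q)) +
    Pr R (fun u => U p u && (h u q.2 != col q)).
  apply: le_trans (Pr_union (Qs := [:: fun u => U p u && (h u q.1 != col q);
    fun u => U p u && (h u q.2 != col q)]) _ _) _; last first.
    by rewrite !big_cons big_nil addr0.
  move=> u /andP[pu qu]; rewrite /= pu /= orbF; move: qu.
  by rewrite /U /common negb_and (hC u q.1) (hC u q.2).
have th2 : 0 < theta ^+ 2 by rewrite exprn_gt0.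
move/(ler_wpM2r (ltW th2)) => H; apply: le_trans H _.
by rewrite mulrDl; lra.
Qed.

(** A good pair that overlaps no member of a maximal family belongs to it and covers itself; all
    others are covered by [overlap_cover]. *)
Lemma max_scattered : exists F, scattered F /\
  forall p, good p -> exists2 q, q \in F &
    Pr R (fun u => U p u && ~~ U q u) * theta ^+ 2 <= 8 * nu.
Proof.
have s0 : scattered finset.set0.
  by apply/andP; split; apply/forallP => p; rewrite inE.
have [F /finset.maxsetP[sF maxF]] := finset.ex_maxset (ex_intro scattered _ s0).
exists F; split=> // p gp; have cp : clean p by case/andP: gp.
case: (boolP [exists q in F, theta < overlap p q]) => [|no].
  move=> /existsP[q /andP[qF ov]]; exists q => //; apply: overlap_cover => //.
  by case/andP: sF => /forall_inP/(_ q qF)/andP[].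
have pF : p \in F.
  rewrite -(maxF (p |: F)) ?finset.setU11 ?finset.subsetUr //.
  case/andP: sF => /forall_inP sg /forall_inP so; apply/andP; split.
    by apply/forall_inP => q; rewrite !inE => /orP[/eqP->|/sg].
  have no' q : q \in F -> overlap p q <= theta.
    move=> qF; rewrite leNgt; apply/negP => lt; case/negP: no.
    by apply/existsP; exists q; rewrite qF.
  apply/forall_inP => q qF; apply/forall_inP => r rF; apply/implyP => qr.
  move: qF rF qr; rewrite !inE => /predU1P[->|qF] /predU1P[->|rF].
  - by rewrite eqxx.
  - by rewrite no'.
  - by rewrite overlapC no'.
  - by move=> qr; move/forall_inP: (so q qF) => /(_ r rF)/implyP; apply.
exists p => //.
have nu0 : 0 <= nu.
  by case/and3P: cp => H _ _; apply: le_trans H; apply: Pr2_ge0.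
have -> : Pr R (fun u => U p u && ~~ U p u) = 0.
  by rewrite -(Ex_const 0 V0); apply: eq_Ex => u; rewrite andbN.
by rewrite mul0r mulr_ge0.
Qed.

Definition leftover (F : {set V * V}) u := [forall q in F, ~~ U q u].

Hypotheses (nu0 : 0 < nu) (eta0 : 0 < eta).

(** For a triangle [x y z] with [z] left over, either [(x, y)] is not clean, or its common
    neighborhood is smaller than [eta], or [z] lies in the small part of it that the covering
    cluster misses. The three terms of the bound correspond to these cases. *)
Lemma leftover_triangles (F : {set V * V}) : (forall p, good p -> exists2 q, q \in F &
    Pr R (fun u => U p u && ~~ U q u) * theta ^+ 2 <= 8 * nu) ->
  Pr3 R (fun x y z => leftover F z && mono3 h x y z)
    <= eta + 3 * q31 / nu + 8 * nu / theta ^+ 2.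
Proof.
move=> cov.
have th2 : 0 < theta ^+ 2 by rewrite exprn_gt0.
have H8 : 0 <= 8 * nu / theta ^+ 2 by rewrite divr_ge0 ?mulr_ge0 // ltW.
apply: le_trans (_ : Ex (fun x => Ex (fun y => (eta + 8 * nu / theta ^+ 2)
   + (~~ clean (x, y))%:R)) <= _); last first.
  have -> : Ex (fun x => Ex (fun y => (eta + 8 * nu / theta ^+ 2) + (~~ clean (x, y))%:R))
    = (eta + 8 * nu / theta ^+ 2) + Pr2 R (fun x y => ~~ clean (x, y)).
    under eq_Ex do rewrite ExD Ex_const //.
    by rewrite ExD Ex_const.
  have : Pr2 R (fun x y => ~~ clean (x, y)) <= 3 * q31 / nu.
    by rewrite ler_pdivlMr // not_clean_le // ltW.
  lra.
apply: le_Ex => x; apply: le_Ex => y.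
case cl: (clean (x, y)); last first.
  apply: le_trans (Pr_le1 _ _) _; by rewrite lerDr addr_ge0 // ltW.
rewrite addr0.
case: (leP eta (Pr R (U (x, y)))) => [hv|lt]; last first.
  apply: le_trans (_ : Pr R (U (x, y)) <= _); last by rewrite (le_trans (ltW lt)) // lerDl.
  apply: Pr_mono => z /andP[_ /andP[xz yz]].
  by rewrite /U /common /= eq_sym xz eq_sym yz.
have [|q qF Hq] := cov (x, y); first by rewrite /good cl.
apply: le_trans (_ : Pr R (fun u => U (x, y) u && ~~ U q u) <= _).
  apply: Pr_mono => z /andP[/forall_inP/(_ q qF)-> /andP[xz yz]].
  by rewrite /U /common /= eq_sym xz eq_sym yz.
apply: le_trans (_ : 8 * nu / theta ^+ 2 <= _); last by rewrite lerDr ltW.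
by rewrite ler_pdivlMr.
Qed.

(** By the contrapositive of [conc] a spread vertex sees many patterns over [U p]. Each is a
    forbidden configuration unless one of its three pairs in [U p] has a wrong color, which costs
    [3 * nu]. *)
Lemma spread_le (e kap : R) p : clean p -> eta <= Pr R (U p) -> 0 < kap ->
  (forall (V : finType) (A : V -> bool) (g : V -> 'I_c) (a : 'I_c),
    (0 < #|V|)%N -> eta <= Pr R A ->
    Pr3 R (fun z z' z'' => [&& A z, A z', A z'' & K31_pattern a (g z) (g z') (g z'')]) <= kap ->
    exists b, Pr R (fun z => A z && (g z != b)) <= e) ->
  Pr R (spread h e (U p)) * kap <= q31 + 3 * nu.
Proof.
move=> cp hp kap0 conc.
pose X v := Pr3 R (fun z z' z'' => [&& U p z, U p z', U p z'' &
  K31_pattern (col p) (h v z) (h v z') (h v z'')]).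
apply: le_trans (_ : Pr R (fun v => kap < X v) * kap <= _).
  apply: ler_wpM2r; first exact: ltW.
  apply: Pr_mono => v; apply: contraTT.
  rewrite -leNgt => /(conc _ _ _ _ V0 hp)[b Hb].
  by apply/forallPn; exists b; rewrite -leNgt.
apply: le_trans (markov (F := X) (fun v => Pr3_ge0 _ _) (ltW kap0)) _.
have ncl := clean_near cp.
pose Bad z z' := [&& U p z, U p z' & h z z' != col p].
apply: le_trans (_ : Pr4 R (fun v z z' z'' => k31 h v z z' z'') + (Pr4 R (fun v z z' z'' => Bad z z')
  + (Pr4 R (fun v z z' z'' => Bad z z'') + Pr4 R (fun v z z' z'' => Bad z' z''))) <= _).
  apply: le_trans (Pr4_union (Qs := [:: fun v z z' z'' => k31 h v z z' z'';
    fun v z z' z'' => Bad z z'; fun v z z' z'' => Bad z z'';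
    fun v z z' z'' => Bad z' z'']) _ _) _; last by rewrite !big_cons big_nil addr0.
  move=> v z z' z'' /and4P[Uz Uz' Uz'' K] /=.
  rewrite /Bad Uz Uz' Uz'' /= orbF.
  case: (eqVneq (h z z') (col p)) => [E1|_]; last by rewrite orbT.
  case: (eqVneq (h z z'') (col p)) => [E2|_]; last by rewrite !orbT.
  case: (eqVneq (h z' z'') (col p)) => [E3|_]; last by rewrite !orbT.
  by rewrite /k31 /mono3 E1 E2 E3 eqxx K.
rewrite !Pr4_234 // Pr3_12 // Pr3_13 // Pr3_23 //.
by move: ncl; rewrite /near_clique -/Bad -/(q31); lra.
Qed.

(** Otherwise most vertices of [U q] have color [col p] to at least half of [U p]. Outside [U p]
    such vertices are rare by [anchored_half] at both ends of [p], and inside by the small overlap,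
    so [U q] would have measure less than [eta]. *)
Lemma cross_not_own p q : clean p -> clean q ->
  eta <= Pr R (U p) -> eta <= Pr R (U q) -> overlap p q <= theta ->
  4 * theta <= eta -> 8 * e3 <= eta ^+ 2 -> 32 * nu < eta ^+ 3 ->
  e3 < Pr2 R (fun u v => [&& U p u, U q v & h u v != col p]).
Proof.
move=> cp cq hp hq ov th1 e31 nu1; rewrite ltNge; apply/negP => H.
pose G v := Pr R (fun u => U p u && (h v u == col p)).
pose N v := Pr R (fun u => U p u && (h v u != col p)).
have GN v : Pr R (U p) <= G v + N v.
  apply: le_trans (Pr_union (Qs := [:: fun u => U p u && (h v u == col p);
    fun u => U p u && (h v u != col p)]) _ _) _; last by rewrite !big_cons big_nil addr0.
  by move=> u Uu; rewrite /= Uu /=; case: eqP.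
pose P1 v := U q v && (eta / 2 < N v).
have HP1 : Pr R P1 * (eta / 2) <= e3.
  apply: le_trans H; rewrite -Pr2_swap mulrC -ExZ; apply: le_Ex => v.
  rewrite /P1; case Uv: (U q v); rewrite ?mulr0 ?Pr_ge0 //=.
  case: ltP => [lt|_]; rewrite ?mulr0 ?Pr_ge0 // mulr1.
  apply: le_trans (ltW lt) _; apply: Pr_mono => u /andP[-> ne].
  by rewrite hC.
have A1 := anchored_half V0 (clean_near cp) (clean_anchor1 cp).
have A2 := anchored_half V0 (clean_near cp) (clean_anchor2 cp).
set Q1 := Pr R _ in A1; set Q2 := Pr R _ in A2.
have : Pr R (U q) <= Pr R P1 + (Q1 + (Q2 + overlap p q)).
  apply: le_trans (Pr_union (Qs := [:: P1;
    fun u => (h u p.1 != col p) && (Pr R (U p) / 2 <= Pr R (fun z => U p z && (h u z == col p)));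
    fun u => (h u p.2 != col p) && (Pr R (U p) / 2 <= Pr R (fun z => U p z && (h u z == col p)));
    fun z => U p z && U q z]) _ _) _; last by rewrite !big_cons big_nil addr0.
  move=> v Uv; rewrite /= /P1 Uv /=.
  case: ltP => //= le; have half : Pr R (U p) / 2 <= G v by have := GN v; lra.
  rewrite -/(G v) half !andbT orbF /U /common.
  by rewrite -/(col p) (hC v p.1) (hC v p.2); case: eqP; case: eqP.
have P1_0 := Pr_ge0 R P1.
have Q1_0 : 0 <= Q1 by apply: Pr_ge0.
have Q2_0 : 0 <= Q2 by apply: Pr_ge0.
have sq : eta ^+ 2 <= Pr R (U p) ^+ 2.
  by apply: lerXn2r hp; rewrite nnegrE ?Pr_ge0 // ltW.
have B1 : Q1 * eta ^+ 2 <= 8 * nu by apply: le_trans A1; rewrite ler_wpM2l.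
have B2 : Q2 * eta ^+ 2 <= 8 * nu by apply: le_trans A2; rewrite ler_wpM2l.
have e2 : eta / 4 * eta ^+ 2 = eta ^+ 3 / 4 by rewrite mulrAC -exprS.
have C1 : Q1 < eta / 4 by rewrite -(ltr_pM2r (exprn_gt0 2 eta0)) e2; lra.
have C2 : Q2 < eta / 4 by rewrite -(ltr_pM2r (exprn_gt0 2 eta0)) e2; lra.
have C3 : Pr R P1 <= eta / 4.
  by rewrite -(ler_pM2r (_ : 0 < eta / 2)) ?divr_gt0 //; lra.
lra.
Qed.

Lemma cross_swap p q b : Pr2 R (fun u v => [&& U p u, U q v & h u v != b]) =
  Pr2 R (fun u v => [&& U q u, U p v & h u v != b]).
Proof.
rewrite -Pr2_swap; apply: eq_Ex => u; apply: eq_Pr => v.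
by rewrite hC andbCA.
Qed.

Lemma cross_color (e kap : R) p q : good p -> good q -> overlap p q <= theta ->
  4 * theta <= eta -> 8 * e3 <= eta ^+ 2 -> 32 * nu < eta ^+ 3 ->
  0 < kap ->
  (forall (V : finType) (A : V -> bool) (g : V -> 'I_c) (a : 'I_c),
    (0 < #|V|)%N -> eta <= Pr R A ->
    Pr3 R (fun z z' z'' => [&& A z, A z', A z'' & K31_pattern a (g z) (g z') (g z'')]) <= kap ->
    exists b, Pr R (fun z => A z && (g z != b)) <= e) ->
  q31 + 3 * nu <= e * kap -> 0 <= e -> e <= eta / 2 -> 7 * e <= e3 * eta ->
  exists b, [/\ b != col p, b != col q &
    Pr2 R (fun u v => [&& U p u, U q v & h u v != b]) <= e3].
Proof.
move=> /andP[cp hp] /andP[cq hq] ov th1 e31 nu1 kap0 conc small e0 eeta e3eta.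
have sp r : clean r -> eta <= Pr R (U r) -> Pr R (spread h e (U r)) <= e.
  move=> cr hr; rewrite -(ler_pM2r kap0); apply: le_trans small.
  exact: spread_le.
have [b Hb] := two_sided_concentration hC V0 e0 eeta hq (sp p cp hp) (sp q cq hq) eta0.
have {}Hb : Pr2 R (fun u v => [&& U p u, U q v & h u v != b]) <= e3.
  by rewrite -(ler_pM2r eta0); apply: le_trans Hb e3eta.
exists b; split=> //; apply/eqP => E; move: Hb; rewrite leNgt E => /negP; apply.
  exact: cross_not_own.
by rewrite cross_swap; apply: cross_not_own => //; rewrite overlapC.
Qed.

(** Three random vertices for each side fall into the two clusters with probability at least
    [eta ^+ 6]. They form two triangles of different colors joined in color [b] unless one of at
    most 36 ordered pairs of indices has a wrong color. *)
Lemma same_color p q b : good p -> good q -> b != col p -> b != col q ->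
  Pr2 R (fun u v => [&& U p u, U q v & h u v != b]) <= e3 -> 0 <= e3 ->
  col p != col q -> eta ^+ 6 <= q33 + 36 * (nu + e3).
Proof.
move=> /andP[cp hp] /andP[cq hq] bp bq Hb e30 pq.
pose A (i : bool * 'I_3) := if i.1 then U p else U q.
pose C (i j : bool * 'I_3) := if i.1 != j.1 then b else if i.1 then col p else col q.
pose Bad i j x y := [&& A i x, A j y & h x y != C i j].
have HA : eta ^+ 6 <= Pr R (fun t : {ffun bool * 'I_3 -> V} => [forall i, A i (t i)]).
  rewrite Pr_ffun_forall; apply: le_trans (_ : \prod_(i : bool * 'I_3) eta <= _).
    by rewrite prodr_const card_prod card_bool card_ord.
  by apply: ler_prod => -[i j] _; rewrite ltW //= /A /=; case: i.
have HB i j : Pr2 R (Bad i j) <= nu + e3.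
  have Hp := clean_near cp; have Hq := clean_near cq.
  rewrite /Bad /A /C; case: i.1; case: j.1 => /=.
  - by apply: le_trans Hp _; rewrite lerDl.
  - by apply: le_trans Hb _; rewrite lerDr ltW.
  - by rewrite cross_swap; apply: le_trans Hb _; rewrite lerDr ltW.
  - by apply: le_trans Hq _; rewrite lerDl.
apply: le_trans HA _.
apply: le_trans (_ : Ex (fun t : {ffun bool * 'I_3 -> V} => (k33 t)%:R +
   \sum_(ij : (bool * 'I_3) * (bool * 'I_3) | ij.1 != ij.2)
     (Bad ij.1 ij.2 (t ij.1) (t ij.2))%:R) <= _).
  apply: le_Ex => t; case: forallP => [At|_]; last first.
    by apply: addr_ge0 => //; apply: sumr_ge0.
  case K: (k33 t); first by rewrite lerDl; apply: sumr_ge0.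
  rewrite add0r.
  case: (pickP (fun ij : (bool * 'I_3) * (bool * 'I_3) =>
      (ij.1 != ij.2) && Bad ij.1 ij.2 (t ij.1) (t ij.2))) => [ij /andP[ne bad]|no].
    by rewrite (bigD1 ij) //= bad lerDl; apply: sumr_ge0.
  suff : k33 t by rewrite K.
  apply/existsP; exists (col p); apply/existsP; exists (col q); apply/existsP; exists b.
  rewrite pq eq_sym bp eq_sym bq /=; apply/forallP => i; apply/forallP => j.
  apply/implyP => ij; have := no (i, j); rewrite /= ij /Bad !At /= => /negbFE/eqP->.
  by rewrite /C.
rewrite ExD -/(Pr R k33) -/q33 lerD2l Ex_sum.
apply: le_trans (_ : \sum_(ij : (bool * 'I_3) * (bool * 'I_3) | ij.1 != ij.2) (nu + e3) <= _).
  by apply: ler_sum => ij ne; rewrite -/(Pr R _) (Pr_ffun2 R V0 (Bad ij.1 ij.2) ne).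
rewrite sumr_const -[X in X <= _]mulr_natl.
apply: ler_wpM2r; first by rewrite addr_ge0 // ltW.
rewrite ler_nat.
apply: leq_trans (max_card _) _.
by rewrite !card_prod card_bool card_ord.
Qed.

(** A second vertex [x] of [U p] is the apex of a forbidden configuration: it sees the triangle
    [u v w] of color [b] in the colors [col p], [b], [b]. *)
Lemma no_mono_triangle p q r b : good p -> good q -> good r -> b != col p ->
  Pr2 R (fun u v => [&& U p u, U q v & h u v != b]) <= e3 ->
  Pr2 R (fun u v => [&& U q u, U r v & h u v != b]) <= e3 ->
  Pr2 R (fun u v => [&& U p u, U r v & h u v != b]) <= e3 ->
  eta ^+ 4 <= q31 + nu + 5 * e3.
Proof.
move=> /andP[cp hp] /andP[cq hq] /andP[cr hr] bp Hpq Hqr Hpr.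
have le4 : eta ^+ 4 <= Pr4 R (fun x u v w => [&& U p x, U p u, U q v & U r w]).
  rewrite Pr4_prod !exprS expr0 mulr1.
  have e0 := ltW eta0.
  by rewrite !ler_pM ?mulr_ge0.
apply: le_trans le4 _.
pose Bpp x y := [&& U p x, U p y & h x y != col p].
pose Bpq x y := [&& U p x, U q y & h x y != b].
pose Bpr x y := [&& U p x, U r y & h x y != b].
pose Bqr x y := [&& U q x, U r y & h x y != b].
apply: le_trans (Pr4_union (Qs := [:: fun x u v w => k31 h x u v w;
   fun x u v w => Bpp x u; fun x u v w => Bpq x v; fun x u v w => Bpr x w;
   fun x u v w => Bpq u v; fun x u v w => Bpr u w; fun x u v w => Bqr v w]) _ _) _.
  move=> x u v w /and4P[Ux Uu Uv Uw]; rewrite /= /Bpp /Bpq /Bpr /Bqr Ux Uu Uv Uw /= orbF.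
  case: (eqVneq (h x u) (col p)) => [E1|_]; last by rewrite !orbT.
  case: (eqVneq (h x v) b) => [E2|_]; last by rewrite !orbT.
  case: (eqVneq (h x w) b) => [E3|_]; last by rewrite !orbT.
  case: (eqVneq (h u v) b) => [E4|_]; last by rewrite !orbT.
  case: (eqVneq (h u w) b) => [E5|_]; last by rewrite !orbT.
  case: (eqVneq (h v w) b) => [E6|_]; last by rewrite !orbT.
  by rewrite /k31 /mono3 E1 E2 E3 E4 E5 E6 eqxx /= K31_aab // eq_sym.
rewrite !big_cons big_nil -/q31.
have M1 : Pr4 R (fun x u v w => Bpp x u) <= nu by rewrite (Pr4_123 _ V0 (fun x u _ => Bpp x u)) Pr3_12 //; apply: clean_near.
have M2 : Pr4 R (fun x u v w => Bpq x v) <= e3 by rewrite (Pr4_123 _ V0 (fun x _ v => Bpq x v)) Pr3_13.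
have M3 : Pr4 R (fun x u v w => Bpr x w) <= e3 by rewrite (Pr4_124 _ V0 (fun x _ w => Bpr x w)) Pr3_13.
have M4 : Pr4 R (fun x u v w => Bpq u v) <= e3 by rewrite (Pr4_234 _ V0 (fun u v _ => Bpq u v)) Pr3_12.
have M5 : Pr4 R (fun x u v w => Bpr u w) <= e3 by rewrite (Pr4_234 _ V0 (fun u _ w => Bpr u w)) Pr3_13.
have M6 : Pr4 R (fun x u v w => Bqr v w) <= e3 by rewrite (Pr4_234 _ V0 (fun _ v w => Bqr v w)) Pr3_23.
lra.
Qed.
End Clusters.

(* R_{c-1}(3) <= N, the c - 1 colors being those of 'I_c other than a. *)
Definition ramsey_free (c N : nat) := forall (a : 'I_c) (g : 'I_N -> 'I_N -> 'I_c),
  (forall x y, g x y = g y x) -> (forall x y, x != y -> g x y != a) ->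
  exists x y z, [/\ x != y, y != z, x != z & g x y = g y z /\ g y z = g x z].

(** [in_Lex] for an [E] that is itself symmetric instead of being read through [lcol]. *)
Definition looped_ex (c m : nat) (a : 'I_c) (E : 'I_m -> 'I_m -> 'I_c) :=
  [/\ forall i, E i i = a, forall i j, E i j = E j i,
      forall i j, i != j -> E i j != a &
      forall i j k, i != j -> j != k -> i != k -> ~ (E i j = E j k /\ E j k = E i k)].

(** * Colorings with few forbidden configurations *)

Section Blowup.
Variables (R : realFieldType) (c N : nat) (V : finType).
Variable h : V -> V -> 'I_c.
Hypothesis hC : forall x y, h x y = h y x.
Hypothesis V0 : (0 < #|V|)%N.
Hypothesis ram : ramsey_free c N.
Variables nu eta theta e3 : R.
Variable F : {set V * V}.
Let U (p : V * V) := common h p.1 p.2.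
Let col (p : V * V) := h p.1 p.2.
Hypothesis goodF : forall p, p \in F -> good h nu eta p.
Hypothesis colF : forall p q, p \in F -> q \in F -> col p = col q.
Hypothesis crossF : forall p q, p \in F -> q \in F -> p != q ->
  exists b, [/\ b != col p, b != col q &
    Pr2 R (fun u v => [&& U p u, U q v & h u v != b]) <= e3].
Hypothesis triF : forall p q r b, p \in F -> q \in F -> r \in F -> b != col p ->
  Pr2 R (fun u v => [&& U p u, U q v & h u v != b]) <= e3 ->
  Pr2 R (fun u v => [&& U q u, U r v & h u v != b]) <= e3 ->
  Pr2 R (fun u v => [&& U p u, U r v & h u v != b]) <= e3 -> False.
Hypotheses (nu0 : 0 <= nu) (e30 : 0 <= e3).

Lemma blowup_structure (eps : R) : 
  Pr R (leftover h F) <= eps -> eps < 1 ->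
  exists m (a : 'I_c) (E : 'I_m -> 'I_m -> 'I_c) (phi : V -> 'I_m),
    [/\ (m < N)%N, looped_ex a E &
      Pr2 R (fun u v => h u v != E (phi u) (phi v)) <= 2 * eps + N%:R ^+ 2 * (nu + e3)].
Proof.
move=> U0 eps1.
have [p0 p0F] : exists p, p \in F.
  case: (finset.set_0Vmem F) => [F0|[p pF]]; last by exists p.
  suff : Pr R (leftover h F) = 1 by move=> E; move: U0; rewrite E leNgt eps1.
  rewrite -[RHS](Ex_const 1 V0); apply: eq_Ex => u.
  by rewrite /leftover F0; case: forallP => // -[] p; rewrite inE.
pose a := col p0.
pose m := #|F|; pose e (i : 'I_m) : V * V := enum_val i.
have eF i : e i \in F by apply: enum_valP.
have ea i : col (e i) = a by apply: colF.
pose ok p q b := [&& b != a & Pr2 R (fun u v => [&& U p u, U q v & h u v != b]) <= e3].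
pose B p q := odflt a [pick b | ok p q b].
have BP p q : p \in F -> q \in F -> p != q -> ok p q (B p q).
  move=> pF qF pq; rewrite /B; case: pickP => //= no.
  have [b [bp bq Hb]] := crossF pF qF pq.
  by have := no b; rewrite /ok Hb /a (colF p0F pF) bp.
(* Ordering the two indices makes [E] symmetric by definition; [cross_swap] shows that either order
   is valid. *)
pose E (i j : 'I_m) := if i == j then a else if (i < j)%N then B (e i) (e j) else B (e j) (e i).
have EE i : E i i = a by rewrite /E eqxx.
have EC i j : E i j = E j i.
  rewrite /E eq_sym; case: eqVneq => // ij.
  by case: ltngtP => // /val_inj E0; rewrite E0 eqxx in ij.
have okE i j : i != j -> ok (e i) (e j) (E i j).
  move=> ij; rewrite /E (negbTE ij).
  have eij : e i != e j by apply: contra ij => /eqP/enum_val_inj->.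
  case: ltnP => _; first exact: BP.
  rewrite /ok cross_swap //; apply: BP => //; by rewrite eq_sym.
have Ea i j : i != j -> E i j != a by move=> /okE/andP[].
have Ebad i j : Pr2 R (fun u v => [&& U (e i) u, U (e j) v & h u v != E i j]) <= nu + e3.
  case: (eqVneq i j) => [<-|/okE/andP[_]]; last by move=> H; apply: le_trans H _; rewrite lerDr.
  have /andP[/clean_near H _] := goodF (eF i).
  rewrite EE -(ea i); apply: le_trans H _; by rewrite lerDl.
have Etri i j k : i != j -> j != k -> i != k -> ~ (E i j = E j k /\ E j k = E i k).
  move=> ij jk ik [E1 E2]; have /andP[b1 H1] := okE _ _ ij.
  have /andP[_ H2] := okE _ _ jk; have /andP[_ H3] := okE _ _ ik.
  rewrite -E1 in H2; rewrite -E2 -E1 in H3.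
  by apply: (triF (eF i) (eF j) (eF k) _ H1 H2 H3); rewrite ea.
(* With [N] or more clusters, [ram] would find a triangle among the first [N], which [Etri]
   excludes. *)
have mN : (m < N)%N.
  rewrite ltnNge; apply/negP => Nm.
  pose w := widen_ord Nm.
  have winj x y : x != y -> w x != w y.
    by apply: contra => /eqP[/val_inj->].
  have [x [y [z [xy yz xz T]]]] := ram (a := a) (g := fun x y => E (w x) (w y))
    (fun x y => EC _ _) (fun x y xy => Ea _ _ (winj _ _ xy)).
  exact: (Etri (w x) (w y) (w z) (winj _ _ xy) (winj _ _ yz) (winj _ _ xz) T).
(* A leftover vertex is put into class 0, which costs [2 * eps]; a vertex in several clusters may
   take any of them. *)
have m0 : (0 < m)%N by apply/card_gt0P; exists p0.
pose phi u := odflt (Ordinal m0) [pick i | U (e i) u].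
have phiP u : leftover h F u \/ U (e (phi u)) u.
  rewrite /phi; case: pickP => [i Ui|no]; [by right|left].
  apply/forall_inP => q qF; have := no (enum_rank_in p0F q).
  by rewrite /e enum_rankK_in // => /negbT.
exists m, a, E, phi; split=> //.
pose Q (ij : 'I_m * 'I_m) u v := [&& U (e ij.1) u, U (e ij.2) v & h u v != E ij.1 ij.2].
apply: le_trans (Pr2_union (Qs := [:: fun u v => leftover h F u; fun u v => leftover h F v;
   fun u v => [exists ij, Q ij u v]]) _ _) _.
  move=> u v hn; rewrite /= orbF.
  case: (phiP u) => [->//|Uu]; case: (phiP v) => [->|Uv]; first by rewrite orbT.
  suff -> : [exists ij, Q ij u v] by rewrite !orbT.
  by apply/existsP; exists (phi u, phi v); rewrite /Q /= Uu Uv.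
rewrite !big_cons big_nil addr0 Pr2_1 // Pr2_2 //.
have : Pr2 R (fun u v => [exists ij, Q ij u v]) <= N%:R ^+ 2 * (nu + e3).
  apply: le_trans (Pr2_exists _ Q) _.
  apply: le_trans (_ : \sum_(ij : 'I_m * 'I_m) (nu + e3) <= _).
    by apply: ler_sum => ij _; apply: Ebad.
  rewrite sumr_const card_prod card_ord -[X in X <= _]mulr_natl.
  apply: ler_wpM2r; first by rewrite addr_ge0.
  by rewrite -natrX ler_nat -mulnn leq_mul // ltnW.
lra.
Qed.
End Blowup.

(** The constants are fixed in the order [u0], [eta], [e3], [e], [kap], [nu], [mu], each small
    compared with those before it. The hypothesis on subsets limits the leftover: a set of measure
    above [u0] spans triangles of density above [3 * eta], more than [leftover_triangles] allows. *)
Lemma structure_theorem (R : realFieldType) (c N : nat) (vs eps : R) :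
  0 < vs -> 0 < eps -> ramsey_free c N ->
  exists2 mu : R, 0 < mu & forall (V : finType) (h : V -> V -> 'I_c),
    (forall x y, h x y = h y x) -> (0 < #|V|)%N ->
    q31 R h <= mu -> q33 R h <= mu ->
    (forall A : V -> bool,
       vs * Pr R A ^+ 3 <= Pr3 R (fun x y z => [&& A x, A y, A z & mono3 h x y z])) ->
    exists m (a : 'I_c) (E : 'I_m -> 'I_m -> 'I_c) (phi : V -> 'I_m),
    [/\ (m < N)%N, looped_ex a E &
      Pr2 R (fun u v => h u v != E (phi u) (phi v)) <= eps].
Proof.
move=> vs0 eps0 ram.
pose u0 : R := Num.min (eps / 4) (1 / 2).
have u00 : 0 < u0 by rewrite lt_min !divr_gt0.
have u0e : u0 <= eps / 4 by rewrite ge_min lexx.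
have u01 : u0 <= 1 / 2 by rewrite ge_min lexx orbT.
pose eta : R := Num.min (vs * u0 ^+ 3 / 4) (1 / 2).
have eta0 : 0 < eta by rewrite lt_min !divr_gt0 ?mulr_gt0 ?exprn_gt0.
have eta1 : eta <= 1 / 2 by rewrite ge_min lexx orbT.
have etav : eta <= vs * u0 ^+ 3 / 4 by rewrite ge_min lexx.
clearbody eta.
have e60 : 0 < eta ^+ 6 by rewrite exprn_gt0.
pose N2 : R := N%:R ^+ 2 + 1.
have N20 : 0 < N2 by rewrite ltr_wpDl // exprn_ge0.
(* The final error consists of [2 * u0 <= eps / 2] and of at most [N ^ 2] pairs of classes, for
   which [N2 * (e3 + e3) <= eps / 2]. *)
pose e3 : R := Num.min (eta ^+ 6 / 100) (eps / (4 * N2)).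
have e30 : 0 < e3 by rewrite lt_min !divr_gt0 ?mulr_gt0.
have e36 : e3 <= eta ^+ 6 / 100 by rewrite ge_min lexx.
have e3N : N2 * e3 <= eps / 4.
  apply: le_trans (_ : N2 * (eps / (4 * N2)) <= _).
    by rewrite ler_pM2l // ge_min lexx orbT.
  by rewrite (_ : N2 * _ = eps / 4) //; field; rewrite gt_eqF.
clearbody e3.
pose theta := eta / 4.
have theta0 : 0 < theta by rewrite divr_gt0.
pose e := e3 * eta / 7.
have e0 : 0 < e by rewrite divr_gt0 ?mulr_gt0.
have [kap kap0 conc] := concentration c e0 eta0.
pose nu := Num.min e3 (Num.min (eta ^+ 3 / 200) (e * kap / 6)).
have nu0 : 0 < nu.
  rewrite !lt_min e30 /=; apply/andP; split; apply: divr_gt0 => //.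
    exact: exprn_gt0.
  exact: mulr_gt0.
have nu3 : nu <= e3 by rewrite ge_min lexx.
have nueta : nu <= eta ^+ 3 / 200 by rewrite !ge_min lexx !orbT.
have nuk : nu <= e * kap / 6 by rewrite !ge_min lexx !orbT.
clearbody nu.
pose mu := Num.min e3 (Num.min (eta * nu / 3) (e * kap / 6)).
have mu0 : 0 < mu.
  rewrite !lt_min e30 /=; apply/andP; split; apply: divr_gt0 => //.
    exact: mulr_gt0.
  exact: mulr_gt0.
have mu3 : mu <= e3 by rewrite ge_min lexx.
have munu : mu <= eta * nu / 3 by rewrite !ge_min lexx !orbT.
have muk : mu <= e * kap / 6 by rewrite !ge_min lexx !orbT.
have pw k : 0 < eta ^+ k by rewrite exprn_gt0.
have pwle k l : (k <= l)%N -> eta ^+ l <= eta ^+ k.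
  by move=> kl; rewrite ler_wiXn2l // ?(ltW eta0) //; lra.
have theta2 : theta ^+ 2 = eta ^+ 2 / 16 by rewrite /theta; field.
have n1 : 2 * nu < theta ^+ 2.
  rewrite theta2; move: nueta (pwle 2%N 3%N isT) (pw 2%N); clear; lra.
have n2 : 4 * theta <= eta by rewrite /theta; clear; lra.
have n3 : 8 * e3 <= eta ^+ 2.
  by move: e36 (pwle 2%N 6%N isT) (pw 2%N); clear; lra.
have n4 : 32 * nu < eta ^+ 3 by move: nueta (pw 3%N); clear; lra.
have n5 : mu + 3 * nu <= e * kap.
  by move: muk nuk (mulr_gt0 e0 kap0); clear; lra.
have n6 : e <= eta / 2.
  rewrite /e; have : e3 * eta <= eta.
    rewrite ler_piMl ?(ltW eta0) //.
    by move: e36 (pwle 0%N 6%N isT); rewrite expr0; clear; lra.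
  by move: eta0; clear; lra.
have n7 : 7 * e <= e3 * eta by rewrite /e; clear; lra.
have n8 : mu + 36 * (nu + e3) < eta ^+ 6 by move: mu3 nu3 e36 e60; clear; lra.
have n9 : mu + nu + 5 * e3 < eta ^+ 4.
  by move: mu3 nu3 e36 e60 (pwle 4%N 6%N isT); clear; lra.
have n10 : 3 * mu <= eta * nu by move: munu; clear; lra.
have n11 : 8 * nu <= eta * theta ^+ 2.
  have -> : eta * theta ^+ 2 = eta ^+ 3 / 16 by rewrite theta2; field.
  by move: nueta (pw 3%N); clear; lra.
exists mu => // V h hC V0 H31 H33 H0.
have [F [sF cov]] := max_scattered hC V0 eta theta0 n1.
have /andP[/forall_inP gF /forall_inP ovF] := sF.
have q310 : 0 <= q31 R h by apply: Ex_ge0 => x; apply: Pr3_ge0.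
have ov p q : p \in F -> q \in F -> p != q -> overlap R h p q <= theta.
  by move=> pF qF pq; have /forall_inP/(_ q qF)/implyP := ovF p pF; apply.
have cross p q : p \in F -> q \in F -> p != q ->
  exists b, [/\ b != h p.1 p.2, b != h q.1 q.2 &
    Pr2 R (fun u v => [&& common h p.1 p.2 u, common h q.1 q.2 v & h u v != b]) <= e3].
  move=> pF qF pq.
  apply: (@cross_color R c V h hC V0 nu eta theta e3 eta0 e kap) => //.
  - exact: gF.
  - exact: gF.
  - exact: ov.
  - by apply: le_trans n5; rewrite lerD2r.
  - exact: ltW.
have colF p q : p \in F -> q \in F -> h p.1 p.2 = h q.1 q.2.
  move=> pF qF; apply/eqP; case: (eqVneq p q) => [->//|pq].
  have [b [bp bq Hb]] := cross _ _ pF qF pq; apply/negPn/negP => ne.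
  have := same_color hC V0 nu0 eta0 (gF _ pF) (gF _ qF) bp bq Hb (ltW e30) ne.
  by rewrite leNgt (le_lt_trans _ n8) // lerD2r.
have U0 : Pr R (leftover h F) <= u0.
  have L := leftover_triangles hC V0 theta0 nu0 eta0 cov.
  have L0 := H0 (leftover h F).
  have L1 : vs * Pr R (leftover h F) ^+ 3 <= 3 * eta.
    apply: le_trans L0 _; apply: le_trans (Pr3_mono _ _) (le_trans L _).
      by move=> x y z /and4P[_ _ -> ->].
    have : 3 * q31 R h / nu <= eta.
      by rewrite ler_pdivrMr //; apply: le_trans n10; rewrite ler_pM2l.
    have : 8 * nu / theta ^+ 2 <= eta by rewrite ler_pdivrMr ?exprn_gt0.
    by clear; lra.
  rewrite leNgt; apply/negP => lt.
  have : u0 ^+ 3 < Pr R (leftover h F) ^+ 3.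
    by rewrite ltr_pXn2r // nnegrE ?Pr_ge0 // ltW.
  by rewrite -(ltr_pM2l vs0); move: L1 etav eta0; clear; lra.
have U1 : u0 < 1 by move: u01; clear; lra.
have [|m [a [E [phi [mN LE bad]]]]] := blowup_structure hC V0 ram gF colF cross _ (ltW nu0) (ltW e30) U0 U1.
  move=> p q r b pF qF rF bp H1 H2 H3.
  have := no_mono_triangle V0 eta0 (gF _ pF) (gF _ qF) (gF _ rF) bp H1 H2 H3.
  by rewrite leNgt (le_lt_trans _ n9) // !lerD2r.
exists m, a, E, phi; split=> //; apply: le_trans bad _.
have : N%:R ^+ 2 * (nu + e3) <= N2 * (e3 + e3).
  apply: ler_pM => //; rewrite ?exprn_ge0 ?addr_ge0 ?lerDl ?lerD2r // ltW //.
by move: e3N u0e; clear; lra.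
Qed.

(** * Triangle counts under recoloring and cloning *)

Section TriangleCounts.
Variables (c : nat) (V : finType).
Implicit Types (h : V -> V -> 'I_c) (u v x y z : V).

Definition tri h x y z := [&& x != y, y != z, x != z & mono3 h x y z].
Definition tri_count h := (\sum_x \sum_y \sum_z tri h x y z)%N.
Definition tri_deg h v := (\sum_y \sum_z tri h v y z)%N.
Definition codeg h u v (e : 'I_c) :=
  #|[set z | [&& z != u, z != v, h u z == e & h v z == e]]|.

Definition recolor h u v (d : 'I_c) x y :=
  if ((x == u) && (y == v)) || ((x == v) && (y == u)) then d else h x y.

Section Symmetric.
Variable h : V -> V -> 'I_c.
Hypothesis hC : forall x y, h x y = h y x.

Lemma tri_swap12 x y z : tri h x y z = tri h y x z.
Proof.
rewrite /tri /mono3 (eq_sym y x) (hC y x); case: (x != y) => //=.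
by rewrite andbCA; congr [&& _, _ & _]; rewrite andbC.
Qed.

Lemma tri_swap23 x y z : tri h x y z = tri h x z y.
Proof.
rewrite /tri /mono3 (eq_sym z y) (hC z y) andbCA [RHS]andbCA; congr (_ && _).
rewrite [RHS]andbCA; congr (_ && (_ && _)).
by case: (eqVneq (h x y) (h x z)) => [->|].
Qed.

Lemma tri_xx x z : tri h x x z = false.
Proof. by rewrite /tri eqxx. Qed.

Lemma tri_yy x y : tri h x y y = false.
Proof. by rewrite /tri eqxx andbF. Qed.

Definition tri_off v := (\sum_(x | x != v) \sum_(y | y != v) \sum_(z | z != v) tri h x y z)%N.

(** The counts are over ordered triples, so [v] can stand in three positions. *)
Lemma tri_count_split v : tri_count h = (tri_off v + 3 * tri_deg h v)%N.
Proof.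
have D1 : (\sum_(x | x != v) \sum_z tri h x v z = tri_deg h v)%N.
  rewrite /tri_deg [RHS](bigD1 v) //= [X in _ = (X + _)%N]big1 => [|z _]; last by rewrite tri_xx.
  by rewrite add0n; apply: eq_bigr => x _; apply: eq_bigr => z _; rewrite tri_swap12.
have D2 : (\sum_(x | x != v) \sum_(y | y != v) tri h x y v = tri_deg h v)%N.
  rewrite -D1; apply: eq_bigr => x xv; rewrite [RHS](bigD1 v) //=.
  rewrite tri_yy add0n.
  by apply: eq_bigr => y _; rewrite tri_swap23.
rewrite /tri_count (bigD1 v) //= -/(tri_deg h v).
have -> : (\sum_(x | x != v) \sum_y \sum_z tri h x y z =
   \sum_(x | x != v) \sum_z tri h x v z + (\sum_(x | x != v) \sum_(y | y != v) tri h x y v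
   + tri_off v))%N.
  rewrite -!big_split /=; apply: eq_bigr => x xv.
  rewrite (bigD1 v) //=; congr (_ + _)%N; rewrite -big_split /=.
  by apply: eq_bigr => y yv; rewrite (bigD1 v).
rewrite D1 D2; lia.
Qed.

Definition tri_off2 v u := (\sum_(y | y != u) \sum_(z | z != u) tri h v y z)%N.

Lemma tri_deg_split v u : v != u ->
  tri_deg h v = (tri_off2 v u + 2 * codeg h v u (h v u))%N.
Proof.
move=> vu.
have C : (codeg h v u (h v u) = \sum_z tri h v u z)%N.
  rewrite /codeg -sum1_card big_mkcond /=; apply: eq_bigr => z _; rewrite inE.
  rewrite /tri /mono3 vu /= (eq_sym v z) (eq_sym u z) (eq_sym (h v u) (h v z)).
  rewrite (eq_sym (h v u) (h u z)) andbCA.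
  by case: ifP => //= ->.
rewrite /tri_deg (bigD1 u) //= C.
have D : (\sum_z tri h v u z = \sum_(y | y != u) tri h v y u)%N.
  rewrite (bigD1 u) //= tri_yy add0n.
  by apply: eq_bigr => z _; rewrite tri_swap23.
have -> : (\sum_(y | y != u) \sum_z tri h v y z = \sum_z tri h v u z + tri_off2 v u)%N.
  by rewrite D /tri_off2 -big_split /=; apply: eq_bigr => y yu; rewrite [LHS](bigD1 u).
lia.
Qed.
End Symmetric.

Lemma recolor_sym h u v d : (forall x y, h x y = h y x) ->
  forall x y, recolor h u v d x y = recolor h u v d y x.
Proof.
move=> hC x y; rewrite /recolor (hC y x) orbC.
by rewrite [(y == u) && _]andbC [(y == v) && _]andbC orbC.
Qed.

(** Each common neighbor in the color of the pair accounts for six ordered triangles. The additive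
    form avoids truncated subtraction. *)
Lemma tri_count_recolor h u v d : (forall x y, h x y = h y x) -> u != v ->
  (tri_count (recolor h u v d) + 6 * codeg h u v (h u v) =
   tri_count h + 6 * codeg h u v d)%N.
Proof.
move=> hC uv; have rC := recolor_sym u v d hC.
rewrite (tri_count_split hC u) (tri_count_split rC u).
rewrite (tri_deg_split hC uv) (tri_deg_split rC uv).
have -> : tri_off (recolor h u v d) u = tri_off h u.
  apply: eq_bigr => x xu; apply: eq_bigr => y yu; apply: eq_bigr => z zu.
  by rewrite /tri /mono3 /recolor (negbTE xu) (negbTE yu) (negbTE zu) !andbF.
have -> : tri_off2 (recolor h u v d) u v = tri_off2 h u v.
  apply: eq_bigr => y yv; apply: eq_bigr => z zv; rewrite /tri.
  case: (eqVneq u y) => //= uy; case: (eqVneq u z) => //= uz; rewrite ?andbF //.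
  congr (nat_of_bool (_ && _)); rewrite /mono3 /recolor eqxx (negbTE uv).
  by rewrite (negbTE yv) (negbTE zv) ![_ == u]eq_sym (negbTE uy) (negbTE uz) /=.
have -> : codeg (recolor h u v d) u v (recolor h u v d u v) = codeg h u v d.
  rewrite /recolor !eqxx /=; apply: eq_card => z; rewrite !inE.
  case: (eqVneq z u) => //= zu; case: (eqVneq z v) => //= zv.
  by rewrite ?andbF.
lia.
Qed.

Definition clone u v x := if x == v then u else x.

(** After [v] becomes a twin of [u], a triangle at [v] that avoids [u] is also one at [u];
    [2 * #|V|] absorbs the ordered pairs [(y, z)] that contain [u]. *)
Lemma tri_deg_clone h u v : u != v -> (forall x y, h x y = h y x) ->
  (tri_count (fun x y => h (clone u v x) (clone u v y)) + 3 * tri_deg h v <=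
   tri_count h + 3 * (tri_deg h u + 2 * #|V|))%N.
Proof.
move=> uv hC; set h' := fun x y => h (clone u v x) (clone u v y).
have h'C x y : h' x y = h' y x by apply: hC.
rewrite (tri_count_split hC v) (tri_count_split h'C v).
have -> : tri_off h' v = tri_off h v.
  apply: eq_bigr => x xv; apply: eq_bigr => y yv; apply: eq_bigr => z zv.
  by rewrite /tri /mono3 /h' /clone (negbTE xv) (negbTE yv) (negbTE zv).
suff : (tri_deg h' v <= tri_deg h u + 2 * #|V|)%N by lia.
have -> : (2 * #|V| = \sum_y \sum_z ((y == u) + (z == u)))%N.
  under eq_bigr do rewrite big_split /= sum_nat_const.
  rewrite big_split /= -big_distrr /= sum_nat_const.
  have -> : (\sum_(i : V) (i == u) = 1)%N.
    by rewrite (bigD1 u) //= eqxx big1 // => i /negbTE->.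
  by rewrite cardE; lia.
rewrite /tri_deg -big_split /=; apply: leq_sum => y _; rewrite -big_split /=.
apply: leq_sum => z _; case yu: (y == u); first by rewrite addnA addnC addnA; case: (tri _ _ _ _) => //=; lia.
case zu: (z == u); first by case: (tri h' _ _ _) => //=; lia.
rewrite addn0 /tri; case: (eqVneq v y) => //= vy; case: (eqVneq v z) => //= vz; rewrite ?andbF //.
rewrite ![u == _]eq_sym yu zu /= /mono3 /h' /clone eqxx.
by rewrite ![_ == v]eq_sym (negbTE vy) (negbTE vz).
Qed.
End TriangleCounts.

(** * Stability *)

Section Blocks.
Variables (R : realFieldType) (V : finType).
Hypothesis V0 : (0 < #|V|)%N.

Lemma Pr_classes_sum m (phi : V -> 'I_m) : \sum_i Pr R (fun u => phi u == i) = 1.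
Proof.
rewrite -Ex_sum -[RHS](Ex_const 1 V0); apply: eq_Ex => u.
by rewrite (bigD1 (phi u)) //= eqxx big1 ?addr0 // => i /negbTE; rewrite eq_sym => ->.
Qed.

Lemma Pr_same_class m (phi : V -> 'I_m) :
  Pr3 R (fun x y z => (phi x == phi y) && (phi y == phi z)) =
  \sum_i Pr R (fun u => phi u == i) ^+ 3.
Proof.
transitivity (\sum_i Pr3 R (fun x y z => [&& phi x == i, phi y == i & phi z == i])).
  rewrite -Ex_sum; apply: eq_Ex => x; rewrite -Ex_sum; apply: eq_Ex => y.
  rewrite -Ex_sum; apply: eq_Ex => z.
  rewrite (bigD1 (phi x)) //= eqxx big1 ?addr0 => [|i /negbTE]; last first.
    by rewrite eq_sym => ->.
  by rewrite (eq_sym (phi x)) (eq_sym (phi y) (phi z)); case: eqP => [->|].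
by apply: eq_bigr => i _; rewrite Pr3_prod !exprS expr0 mulr1.
Qed.

Lemma blowup_mono_ge c (h : V -> V -> 'I_c) m a (E : 'I_m -> 'I_m -> 'I_c) (phi : V -> 'I_m) eps :
  looped_ex a E -> Pr2 R (fun u v => h u v != E (phi u) (phi v)) <= eps ->
  \sum_i Pr R (fun u => phi u == i) ^+ 3 <= Pr3 R (mono3 h) + 3 * eps.
Proof.
move=> [EE _ _ _] bad; rewrite -Pr_same_class.
pose B u v := h u v != E (phi u) (phi v).
apply: le_trans (Pr3_union (Qs := [:: mono3 h; fun x y z => B x y; fun x y z => B x z;
   fun x y z => B y z]) _ _) _.
  move=> x y z /andP[/eqP xy /eqP yz]; rewrite /= /B xy yz !EE orbF.
  case: eqVneq => [E1|]; last by rewrite !orbT.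
  case: eqVneq => [E2|]; last by rewrite !orbT.
  case: eqVneq => [E3|]; last by rewrite !orbT.
  by rewrite /mono3 E1 E2 E3 eqxx.
rewrite !big_cons big_nil Pr3_12 // Pr3_13 // Pr3_23 //.
by move: bad; rewrite -/B => bad; lra.
Qed.

(** The tangent to the cube at [q = m^-1] gives [x ^+ 3 - 3 * q ^+ 2 * x + 2 * q ^+ 3 = (x - q) ^+ 2
    * (x + 2 * q)]. The remainder is kept because it later controls the class sizes. *)
Lemma power_mean m (w : 'I_m -> R) : (0 < m)%N -> \sum_i w i = 1 ->
  \sum_i w i ^+ 3 = (m%:R ^+ 2)^-1 + \sum_i (w i - m%:R^-1) ^+ 2 * (w i + 2 * m%:R^-1).
Proof.
move=> m0 w1; set q := m%:R^-1 : R.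
have mq : m%:R * q = 1 by rewrite mulfV // pnatr_eq0 -lt0n.
have -> : \sum_i (w i - q) ^+ 2 * (w i + 2 * q) =
   \sum_i w i ^+ 3 - 3 * q ^+ 2 * \sum_i w i + \sum_(i < m) 2 * q ^+ 3.
  rewrite mulr_sumr -sumrB -big_split /=; apply: eq_bigr => i _; ring.
have -> : \sum_(i < m) 2 * q ^+ 3 = 2 * q ^+ 2 * (m%:R * q).
  by rewrite sumr_const card_ord -[LHS]mulr_natl; ring.
by rewrite mq w1 -exprVn -/q; ring.
Qed.
End Blocks.

Section Arithmetic.
Variable R : realFieldType.
Implicit Types x y z t k q e : R.

(** Excludes fewer than [r] classes: for [q = r^-1] and [m < r] one has [m^-1 >= q + q * q]. *)
Lemma sum_squares_gap q k : 0 < q -> k <= q ^+ 3 -> q ^+ 2 + k / 2 < (q + q * q) ^+ 2.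
Proof.
move=> q0 kq; have -> : (q + q * q) ^+ 2 = q ^+ 2 + 2 * q ^+ 3 + q ^+ 4 by ring.
have := exprn_gt0 3 q0; have := exprn_gt0 4 q0; lra.
Qed.

Lemma le_add3 x y z k e : e <= k / 8 -> x <= z + k / 8 -> y <= x + 3 * e -> y <= z + k / 2.
Proof. by move=> *; lra. Qed.

End Arithmetic.

Section Extremal.
Variables (R : realFieldType) (c r : nat) (vs s : R).
Hypothesis r2 : (2 <= r)%N.
Hypothesis ram : ramsey_free c r.+1.
Hypothesis lex : exists (a : 'I_c) (E : 'I_r -> 'I_r -> 'I_c), looped_ex a E.
Hypotheses (vs0 : 0 < vs) (s0 : 0 < s).
Hypothesis ineq : forall (V : finType) (h : V -> V -> 'I_c),
  (forall x y, h x y = h y x) -> (0 < #|V|)%N ->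
  vs + s * (q31 R h + q33 R h) <= Pr3 R (mono3 h).
Hypothesis tight : forall delta : R, 0 < delta -> exists (V : finType) (h : V -> V -> 'I_c),
  [/\ forall x y, h x y = h y x, (0 < #|V|)%N & Pr3 R (mono3 h) <= vs + delta].

Lemma q31_ge0 (V : finType) (h : V -> V -> 'I_c) : 0 <= q31 R h.
Proof. by apply: Ex_ge0 => x; apply: Pr3_ge0. Qed.

Lemma q33_ge0 (V : finType) (h : V -> V -> 'I_c) : 0 <= q33 R h.
Proof. exact: Pr_ge0. Qed.

Lemma mono_ge (V : finType) (h : V -> V -> 'I_c) :
  (forall x y, h x y = h y x) -> (0 < #|V|)%N -> vs <= Pr3 R (mono3 h).
Proof.
move=> hC V0; apply: le_trans (ineq hC V0).
by rewrite lerDl mulr_ge0 ?addr_ge0 ?q31_ge0 ?q33_ge0 ?ltW.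
Qed.

Lemma looped_ex_mono m a (E : 'I_m -> 'I_m -> 'I_c) x y z : looped_ex a E ->
  mono3 E x y z = (x == y) && (y == z).
Proof.
move=> [EE EC Ea Et]; rewrite /mono3.
case: (eqVneq x y) => [->|xy]; case: (eqVneq y z) => [<-|yz] //=.
- by rewrite !eqxx.
- by rewrite EE [a == _]eq_sym (negbTE (Ea _ _ yz)).
- by rewrite eqxx EE (negbTE (Ea _ _ xy)).
case: (eqVneq x z) => [<-|xz].
  by rewrite EE (negbTE (Ea _ _ xy)).
apply/negP => /andP[/eqP h1 /eqP h2]; apply: (Et x y z) => //.
by rewrite -h2 h1.
Qed.

Lemma vs_le : vs <= (r%:R ^+ 2)^-1.
Proof.
have [a [E LE]] := lex; have [_ EC _ _] := LE.
have r0 : (0 < #|'I_r|)%N by rewrite card_ord; lia.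
apply: le_trans (mono_ge EC r0) _.
have -> : Pr3 R (mono3 E) = Pr3 R (fun x y z : 'I_r => (x == y) && (y == z)).
  apply: eq_Ex => x; apply: eq_Ex => y; apply: eq_Ex => z.
  by rewrite (looped_ex_mono _ _ _ LE).
rewrite (Pr_same_class R id) (eq_bigr (fun=> r%:R^-1 ^+ 3)) => [|i _].
  rewrite sumr_const card_ord -[X in X <= _]mulr_natl exprSr mulrCA mulfV ?mulr1 ?exprVn //.
  by rewrite pnatr_eq0; lia.
by rewrite Pr_eq1 card_ord.
Qed.

(** This is [mono_ge] for the restriction of [h] to [A], rescaled by [Pr R A ^+ 3]. *)
Lemma subset_mono (V : finType) (h : V -> V -> 'I_c) (A : V -> bool) :
  (forall x y, h x y = h y x) -> (0 < #|V|)%N ->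
  vs * Pr R A ^+ 3 <= Pr3 R (fun x y z => [&& A x, A y, A z & mono3 h x y z]).
Proof.
move=> hC V0; pose S := [set x | A x].
have PA : Pr R A = #|S|%:R / #|V|%:R by apply: PrE.
have [S0|S0] := posnP #|S|.
  by rewrite PA S0 mul0r expr0n /= mulr0; apply: Pr3_ge0.
have ES (F : V -> R) : Ex (fun x => (A x)%:R * F x) = Pr R A * Ex (fun i : 'I_(#|S|) => F (enum_val i)).
  rewrite /Ex card_ord -(big_enum_val F) PA.
  have -> : \sum_x (A x)%:R * F x = \sum_(x in S) F x.
    rewrite [RHS]big_mkcond; apply: eq_bigr => x _.
    by rewrite inE; case: (A x); rewrite ?mul1r ?mul0r.
  by rewrite [RHS]mulrCA [#|S|%:R / _ / _]mulrAC mulfV ?mul1r // pnatr_eq0 -lt0n.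
pose h' (i j : 'I_(#|S|)) := h (enum_val i) (enum_val j).
have S0' : (0 < #|{: 'I_(#|S|)}|)%N by rewrite card_ord.
have := mono_ge (h := h') (fun x y => hC _ _) S0'.
rewrite -(ler_pM2l (_ : 0 < Pr R A ^+ 3)); last first.
  by rewrite exprn_gt0 // PA divr_gt0 ?ltr0n.
rewrite mulrC => /le_trans; apply.
have -> : Pr3 R (fun x y z => [&& A x, A y, A z & mono3 h x y z]) =
   Ex (fun x => (A x)%:R * Ex (fun y => (A y)%:R * Ex (fun z => (A z)%:R * (mono3 h x y z)%:R))).
  apply: eq_Ex => x; rewrite Pr2_andl; congr (_ * _); apply: eq_Ex => y.
  rewrite Pr_andl; congr (_ * _); apply: eq_Ex => z.
  by rewrite -natrM mulnb.
have : 0 < Pr R A by rewrite PA divr_gt0 ?ltr0n.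
move: (Pr R A) ES => p ES p0.
rewrite ES !exprS expr0 mulr1 -!mulrA ler_pM2l //.
rewrite -ExZ -ExZ; apply: le_Ex => i; rewrite ES ler_pM2l //.
rewrite -ExZ; apply: le_Ex => j; rewrite ES; exact: lexx.
Qed.

(** An excess of at most [s * mu] over [vs] leaves at most [mu] for [q31 + q33] in the
    inequality. *)
Lemma near_structure eps : 0 < eps -> exists2 delta : R, 0 < delta &
  forall (V : finType) (h : V -> V -> 'I_c),
  (forall x y, h x y = h y x) -> (0 < #|V|)%N -> Pr3 R (mono3 h) <= vs + delta ->
  exists m (a : 'I_c) (E : 'I_m -> 'I_m -> 'I_c) (phi : V -> 'I_m),
    [/\ (m <= r)%N, looped_ex a E & Pr2 R (fun u v => h u v != E (phi u) (phi v)) <= eps].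
Proof.
move=> eps0; have [mu mu0 Hmu] := structure_theorem vs0 eps0 ram.
exists (s * mu) => [|V h hC V0 Hh]; first exact: mulr_gt0.
have Q : q31 R h + q33 R h <= mu.
  rewrite -(ler_pM2l s0); have := le_trans (ineq hC V0) Hh.
  by rewrite lerD2l.
have q1 := q31_ge0 h; have q3 := q33_ge0 h.
have [|||m [a [E [phi [mr LE bad]]]]] := Hmu V h hC V0.
- by apply: le_trans Q; rewrite lerDl.
- by apply: le_trans Q; rewrite lerDr.
- by move=> A; apply: subset_mono.
by exists m, a, E, phi; split.
Qed.

Lemma classes_gt0 (V : finType) m (phi : V -> 'I_m) : (0 < #|V|)%N -> (0 < m)%N.
Proof. by case/card_gt0P => v _; case: m phi => // phi; case: (phi v). Qed.

Lemma power_mean_ge m (w : 'I_m -> R) : (0 < m)%N -> (forall i, 0 <= w i) -> \sum_i w i = 1 ->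
  (m%:R ^+ 2)^-1 <= \sum_i w i ^+ 3.
Proof.
move=> m0 w0 w1; rewrite power_mean // lerDl; apply: sumr_ge0 => i _.
by rewrite mulr_ge0 ?sqr_ge0 ?addr_ge0 // mulr_ge0 // invr_ge0.
Qed.

Lemma sqr_inv_le m : (0 < m)%N -> (m <= r)%N -> (r%:R ^+ 2)^-1 <= (m%:R ^+ 2)^-1 :> R.
Proof.
move=> m0 mr; rewrite lef_pV2 ?posrE ?exprn_gt0 ?ltr0n //; last by lia.
by rewrite lerXn2r ?nnegrE // ler_nat.
Qed.

Lemma vsE : vs = (r%:R ^+ 2)^-1.
Proof.
apply: le_anti; rewrite vs_le /=; apply/ler_addgt0Pr => e e0.
have e80 : 0 < e / 8 by rewrite divr_gt0.
have [d d0 Hd] := near_structure e80.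
have m0 : 0 < Num.min d (e / 8) by rewrite lt_min d0.
have [V [h [hC V0 Hh]]] := tight m0.
have [|m [a [E [phi [mr LE bad]]]]] := Hd V h hC V0.
  by apply: le_trans Hh _; rewrite lerD2l ge_min lexx.
have mp := classes_gt0 phi V0.
have := blowup_mono_ge V0 LE bad.
have := power_mean_ge mp (fun i => Pr_ge0 R (fun u => phi u == i)) (Pr_classes_sum R V0 phi).
have : Num.min d (e / 8) <= e / 8 by rewrite ge_min lexx orbT.
have := sqr_inv_le mp mr.
lra.
Qed.

Lemma stability eps : 0 < eps -> exists2 delta : R, 0 < delta &
  forall (V : finType) (h : V -> V -> 'I_c),
  (forall x y, h x y = h y x) -> (0 < #|V|)%N -> Pr3 R (mono3 h) <= vs + delta ->
  exists (a : 'I_c) (E : 'I_r -> 'I_r -> 'I_c) (phi : V -> 'I_r),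
    [/\ looped_ex a E, Pr2 R (fun u v => h u v != E (phi u) (phi v)) <= eps &
      forall i, `|Pr R (fun u => phi u == i) - r%:R^-1| <= eps].
Proof.
move=> eps0; have rp : 0 < r%:R :> R by rewrite ltr0n; lia.
set q := r%:R^-1 : R; have q0 : 0 < q by rewrite invr_gt0.
have rq : r%:R * q = 1 by rewrite mulfV // gt_eqF.
(* The entry [q ^+ 3] is for [sum_squares_gap], which excludes [m < r]; the entry [eps ^+ 2 * q]
   turns the remainder in [power_mean] into the bound on the class sizes. *)
pose k := Num.min (q ^+ 3) (eps ^+ 2 * q).
have k0 : 0 < k by rewrite lt_min exprn_gt0 //= mulr_gt0 // exprn_gt0.
have kq : k <= q ^+ 3 by rewrite ge_min lexx.
have ke : k <= eps ^+ 2 * q by rewrite ge_min lexx orbT.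
pose e := Num.min eps (k / 8); have e0 : 0 < e by rewrite lt_min eps0 divr_gt0.
have e1 : e <= eps by rewrite ge_min lexx.
have e2 : e <= k / 8 by rewrite ge_min lexx orbT.
have [d d0 Hd] := near_structure e0.
exists (Num.min d (k / 8)) => [|V h hC V0 Hh]; first by rewrite lt_min d0 divr_gt0.
have d1 : Num.min d (k / 8) <= d by rewrite ge_min lexx.
have d2 : Num.min d (k / 8) <= k / 8 by rewrite ge_min lexx orbT.
have [|m [a [E [phi [mr LE bad]]]]] := Hd V h hC V0.
  by apply: le_trans Hh _; rewrite lerD2l.
have mp := classes_gt0 phi V0.
pose w i := Pr R (fun u => phi u == i).
have w0 i : 0 <= w i by apply: Pr_ge0.
have w1 : \sum_i w i = 1 by apply: Pr_classes_sum.
have T3 : \sum_i w i ^+ 3 <= q ^+ 2 + k / 2.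
  move: (blowup_mono_ge V0 LE bad); rewrite -/w.
  have : Pr3 R (mono3 h) <= q ^+ 2 + k / 8.
    by apply: le_trans Hh _; rewrite vsE -exprVn lerD2l.
  exact: le_add3.
have mE : m = r.
  apply/eqP; rewrite eqn_leq mr /= leqNgt; apply/negP => mlt.
  have := le_trans (power_mean_ge mp w0 w1) T3; apply/negP; rewrite -ltNge.
  have mp' : 0 < m%:R :> R by rewrite ltr0n.
  have m1 : m%:R + 1 <= r%:R :> R by rewrite natr1 ler_nat.
  rewrite -exprVn.
  set p := m%:R^-1; have p0 : 0 < p by rewrite invr_gt0.
  have mpp : m%:R * p = 1 by rewrite mulfV // gt_eqF.
  have qp : q <= p by rewrite lef_pV2 ?posrE // (le_trans _ m1) // lerDl.
  have pq : q + q * q <= p.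
    have -> : p = q + p * q * (r%:R - m%:R).
      have -> : p * q * (r%:R - m%:R) = p * (r%:R * q) - q * (m%:R * p) by ring.
      by rewrite rq mpp !mulr1 addrC subrK.
    rewrite lerD2l; apply: le_trans (_ : p * q <= _); first by rewrite ler_pM2r.
    apply: ler_peMr; first by rewrite mulr_ge0 ?ltW.
    by rewrite lerBrDr addrC.
  apply: lt_le_trans (_ : (q + q * q) ^+ 2 <= _); last first.
    by apply: lerXn2r pq; rewrite nnegrE ?ltW // addr_gt0 // mulr_gt0.
  exact: sum_squares_gap.
move: E phi LE bad @w w0 w1 T3; rewrite mE => E phi LE bad w w0 w1 T3.
exists a, E, phi; split=> [//||i]; first exact: le_trans bad e1.
have rp' : (0 < r)%N by apply: ltnW r2.
move: T3; rewrite (power_mean rp' w1) -exprVn -/q lerD2l => T3.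
have Hi : (w i - q) ^+ 2 * (2 * q) <= k / 2.
  apply: le_trans T3; rewrite (bigD1 i) //=.
  have H0 : 0 <= \sum_(j | j != i) (w j - q) ^+ 2 * (w j + 2 * q).
    apply: sumr_ge0 => j _; rewrite mulr_ge0 ?sqr_ge0 // addr_ge0 // mulr_ge0 // ltW //.
  have : (w i - q) ^+ 2 * (2 * q) <= (w i - q) ^+ 2 * (w i + 2 * q).
    by rewrite ler_wpM2l ?sqr_ge0 // lerDr.
  by move=> H1; apply: le_trans H1 _; rewrite lerDl.
have H2 : (w i - q) ^+ 2 <= eps ^+ 2.
  rewrite -(ler_pM2r (_ : 0 < 2 * q)) ?mulr_gt0 //; apply: le_trans Hi _.
  rewrite ler_pdivrMr // mulrCA -mulrA; apply: le_trans ke _.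
  have : 0 < eps ^+ 2 * q by rewrite mulr_gt0 // exprn_gt0.
  by rewrite mulrCA; move: (eps ^+ 2 * q) => t t0; rewrite -subr_ge0; nra.
rewrite -(@ler_pXn2r _ 2) // ?nnegrE ?normr_ge0 ?(ltW eps0) //.
by rewrite real_normK ?num_real //; exact: H2.
Qed.
End Extremal.

(** * Recoloring one pair of a blow-up *)

Section FullCount.
Variables (R : realFieldType) (c : nat) (V : finType).
Implicit Types (h : V -> V -> 'I_c).

Definition mono_count h := (\sum_x \sum_y \sum_z mono3 h x y z)%N.

Lemma mono_countE h : (0 < #|V|)%N ->
  (mono_count h)%:R = #|V|%:R ^+ 3 * Pr3 R (mono3 h).
Proof.
move=> V0; have n0 : #|V|%:R != 0 :> R by rewrite pnatr_eq0 -lt0n.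
have nEx (F : V -> R) : #|V|%:R * Ex F = \sum_x F x by rewrite mulrC divfK.
rewrite exprSr -mulrA nEx natr_sum mulr_sumr; apply: eq_bigr => x _.
rewrite exprSr expr1 -mulrA nEx natr_sum mulr_sumr; apply: eq_bigr => y _.
by rewrite nEx natr_sum.
Qed.

Definition degenerate_count h :=
  (\sum_x \sum_y \sum_z (~~ [&& x != y, y != z & x != z] && mono3 h x y z))%N.

Lemma mono_count_split h : mono_count h = (tri_count h + degenerate_count h)%N.
Proof.
rewrite /mono_count /tri_count /degenerate_count -big_split /=; apply: eq_bigr => x _.
rewrite -big_split /=; apply: eq_bigr => y _; rewrite -big_split /=; apply: eq_bigr => z _.
by rewrite /tri; case: (x != y); case: (y != z); case: (x != z); rewrite ?addn0.
Qed.

Lemma recolor_other h u v d x z : z != u -> z != v -> recolor h u v d x z = h x z.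
Proof. by rewrite /recolor => /negbTE-> /negbTE->; rewrite !andbF. Qed.

Lemma recolor_uv h u v d : recolor h u v d u v = d.
Proof. by rewrite /recolor !eqxx. Qed.

Lemma recolor_vu h u v d : recolor h u v d v u = d.
Proof. by rewrite /recolor !eqxx orbT. Qed.

(** A triple with a repetition that meets the recolored pair consists of [u] and [v] only; there are
    six such triples. *)
Lemma degenerate_recolor h u v d : u != v -> (forall x y, h x y = h y x) ->
  (degenerate_count (recolor h u v d) <= degenerate_count h + 6)%N.
Proof.
move=> uv hC.
pose t (p : V * V * V) x y z := (x, y, z) == p.
have t1 p : (\sum_x \sum_y \sum_z t p x y z = 1)%N.
  case: p => [[p q] w]; rewrite /t (bigD1 p) //= (bigD1 q) //= (bigD1 w) //= eqxx.
  rewrite big1 => [|z /negbTE zw]; last by rewrite !xpair_eqE zw andbF.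
  rewrite big1 => [|y /negbTE yq]; last first.
    by apply: big1 => z _; rewrite !xpair_eqE yq andbF.
  rewrite big1 // => x /negbTE xp; apply: big1 => y _; apply: big1 => z _.
  by rewrite !xpair_eqE xp.
have -> : (degenerate_count h + 6 = \sum_x \sum_y \sum_z
   ((~~ [&& x != y, y != z & x != z] && mono3 h x y z) +
   (t (u, u, v) x y z + (t (u, v, u) x y z + (t (v, u, u) x y z +
   (t (v, v, u) x y z + (t (v, u, v) x y z + t (u, v, v) x y z)))))))%N.
  under eq_bigr do under eq_bigr do rewrite !big_split /=.
  under eq_bigr do rewrite !big_split /=.
  by rewrite !big_split /= !t1.
apply: leq_sum => x _; apply: leq_sum => y _; apply: leq_sum => z _.
rewrite /t !xpair_eqE /mono3 /recolor.
have vu : (v == u) = false by rewrite eq_sym (negbTE uv).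
have third w : w = u \/ w = v \/ ((w == u) = false) * ((w == v) = false) *
     ((u == w) = false) * ((v == w) = false).
  rewrite (eq_sym u) (eq_sym v); case: (eqVneq w u) => [|_]; first by left.
  by case: (eqVneq w v) => [|_]; right; [left|right].
by case: (third x) => [->|[->|Hx]]; case: (third y) => [->|[->|Hy]];
  case: (third z) => [->|[->|Hz]];
  rewrite ?eqxx ?(negbTE uv) ?vu ?Hx ?Hy ?Hz ?andbF ?orbF ?andbT /= ?addn0 //;
  do ?case: (_ == _).
Qed.
End FullCount.

Section ForcedColors.
Variables (R : realFieldType) (c r : nat) (vs s : R).
Hypothesis r0 : (0 < r)%N.
Hypothesis s0 : 0 < s.
Hypothesis vsE : vs = (r%:R ^+ 2)^-1.
Hypothesis ineq : forall (V : finType) (h : V -> V -> 'I_c),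
  (forall x y, h x y = h y x) -> (0 < #|V|)%N ->
  vs + s * (q31 R h + q33 R h) <= Pr3 R (mono3 h).
Hypothesis unbounded : forall x : R, exists n : nat, x < n%:R.
Variables (a : 'I_c) (E : 'I_r -> 'I_r -> 'I_c).
Hypothesis LE : looped_ex a E.

Section Flip.
Variables (M : nat) (i j : 'I_r) (d : 'I_c).
Let V : finType := ('I_r * 'I_M.+4)%type.
Let h0 (p q : V) := E p.1 q.1.
(** The second coordinates of [u] and [v] differ, so the two vertices are distinct even for
    [i = j]. *)
Let u : V := (i, ord0).
Let v : V := (j, lift ord0 ord0).
Let h' := recolor h0 u v d.

Let V0 : (0 < #|V|)%N. Proof. by rewrite card_prod !card_ord muln_gt0 r0. Qed.
Let uv : u != v. Proof. by rewrite /u /v xpair_eqE andbF. Qed.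
Let h0C x y : h0 x y = h0 y x. Proof. by case: LE => _ EC _ _; apply: EC. Qed.

Let A (k : 'I_r) (p : V) := [&& p.1 == k, p.2 != ord0 & p.2 != lift ord0 ord0].

(** Each class has at least four vertices, so at least half of it remains after removing the two
    special second coordinates. *)
Lemma class_weight k : (2 * r%:R)^-1 <= Pr R (A k).
Proof.
pose B (y : 'I_M.+4) := (y != ord0) && (y != lift ord0 ord0).
have M0 : (0 < #|'I_M.+4|)%N by rewrite card_ord.
have -> : Pr R (A k) = Pr R B * Pr R (fun x => x == k).
  by rewrite /Pr Ex_pair -ExZ; apply: eq_Ex => x; rewrite mulrC -/(Pr R B) -Pr_andl.
rewrite Pr_eq1 card_ord invfM ler_pM2r ?invr_gt0 ?ltr0n //.
have : 1 <= Pr R B + (Pr R (fun y : 'I_M.+4 => y == ord0) +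
    Pr R (fun y : 'I_M.+4 => y == lift ord0 ord0)).
  rewrite -[leLHS](Ex_const 1 M0); apply: le_trans (_ : Pr R (fun _ : 'I_M.+4 => true) <= _) => //.
  apply: le_trans (Pr_union (Qs := [:: B; eq_op^~ ord0; eq_op^~ (lift ord0 ord0)]) _ _) _.
    by move=> y _; rewrite /= /B; case: eqP; case: eqP.
  by rewrite !big_cons big_nil addr0.
rewrite !Pr_eq1 card_ord.
have : M.+4%:R^-1 <= 4^-1 :> R by rewrite lef_pV2 ?posrE ?ltr0n // ler_nat.
set x := M.+4%:R^-1; move: x (Pr R B) => x y; lra.
Qed.

Let n := #|V|%:R : R.
Let nE : n = r%:R * M.+4%:R. Proof. by rewrite /n card_prod !card_ord natrM. Qed.

(* If the recoloring creates at most a bounded number of new triangles, then the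
   triangle density grows by O(|V|^-3), while the density of k31 is of order |V|^-2. *)
Lemma flip_bound : (forall z w p q, p = u -> q = v -> A j z -> A j w ->
    k31 h' p q z w) \/ (forall z w p q, p = v -> q = u -> A i z -> A i w -> k31 h' p q z w) ->
  (codeg h0 u v d <= codeg h0 u v (E i j) + 2)%N -> s * M.+4%:R <= 72 * r%:R.
Proof.
move=> K cod.
have rp : 0 < r%:R :> R by rewrite ltr0n.
have n0 : 0 < n by rewrite ltr0n.
have Q : n^-1 * (n^-1 * ((2 * r%:R)^-1 * (2 * r%:R)^-1)) <= q31 R h'.
  have H (p q : V) (k : 'I_r) : (forall z w, A k z -> A k w -> k31 h' p q z w) ->
      n^-1 * (n^-1 * ((2 * r%:R)^-1 * (2 * r%:R)^-1)) <= q31 R h'.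
    move=> Hk; apply: le_trans (_ : Pr4 R (fun x y z w => [&& x == p, y == q, A k z & A k w]) <= _).
      rewrite Pr4_prod !Pr_eq1 !ler_pM2l ?invr_gt0 //.
      by apply: ler_pM; rewrite ?class_weight // invr_ge0 mulr_ge0.
    by apply: Pr4_mono => x y z w /and4P[/eqP-> /eqP-> Az Aw]; apply: Hk.
  by case: K => K; [apply: (H u v j)|apply: (H v u i)] => z w Az Aw; apply: K.
have h'C := recolor_sym u v d h0C.
(* [18 = 6 * 2 + 6]: two additional common neighbors with six ordered triangles each, and six
   degenerate triples. *)
have N' : (mono_count h' <= mono_count h0 + 18)%N.
  have eh : h0 u v = E i j by [].
  have := tri_count_recolor d h0C uv; have := degenerate_recolor d uv h0C.
  by rewrite -/h' !mono_count_split; move: cod; rewrite eh; lia.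
have T0 : Pr3 R (mono3 h0) = vs.
  have -> : Pr3 R (mono3 h0) = Pr3 R (fun x y z : V => (x.1 == y.1) && (y.1 == z.1)).
    apply: eq_Ex => x; apply: eq_Ex => y; apply: eq_Ex => z.
    by rewrite -(looped_ex_mono x.1 y.1 z.1 LE).
  rewrite (Pr_same_class R (fun x : V => x.1)) (eq_bigr (fun=> r%:R^-1 ^+ 3)) => [|k _].
    rewrite vsE sumr_const card_ord -[LHS]mulr_natl exprSr mulrCA mulfV ?mulr1 ?exprVn //.
    by rewrite gt_eqF.
  congr (_ ^+ 3); rewrite /Pr Ex_pair -[in RHS](card_ord r) -(Pr_eq1 R k).
  by apply: eq_Ex => x; rewrite Ex_const // card_ord.
have T' : vs + s * (n^-1 * (n^-1 * ((2 * r%:R)^-1 * (2 * r%:R)^-1))) <= Pr3 R (mono3 h').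
  apply: le_trans (ineq h'C V0); rewrite lerD2l ler_pM2l //.
  by apply: le_trans Q _; rewrite lerDl q33_ge0.
have NR : n ^+ 3 * Pr3 R (mono3 h') <= n ^+ 3 * vs + 18.
  by rewrite -T0 -!mono_countE // -natrD ler_nat.
have H : n ^+ 3 * (vs + s * (n^-1 * (n^-1 * ((2 * r%:R)^-1 * (2 * r%:R)^-1)))) <= n ^+ 3 * vs + 18.
  by apply: le_trans NR; rewrite ler_pM2l // exprn_gt0.
have E1 : n ^+ 3 * (vs + s * (n^-1 * (n^-1 * ((2 * r%:R)^-1 * (2 * r%:R)^-1)))) =
    n ^+ 3 * vs + s * M.+4%:R / (4 * r%:R).
  have Mp : 0 < M.+4%:R :> R by rewrite ltr0n.
  rewrite nE; move: (r%:R : R) (M.+4%:R : R) rp Mp => x y x0 y0.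
  by field; rewrite !gt_eqF.
move: H; rewrite E1 lerD2l ler_pdivrMr ?mulr_gt0 // => H.
by apply: le_trans H _; rewrite (_ : 18 * (4 * r%:R) = 72 * r%:R) //; ring.
Qed.
End Flip.

Lemma large_blowup : exists M : nat, 72 * r%:R < s * M.+4%:R.
Proof.
have [m Hm] := unbounded (72 * r%:R / s); exists m.
rewrite [ltRHS]mulrC -ltr_pdivrMr //; apply: lt_le_trans Hm _.
by rewrite ler_nat !leqW.
Qed.

(** Recolor a pair inside class [i] with [d]: it loses [M.+2] triangles within the class. If at most
    one class is joined to [i] in color [d], it gains at most [M.+4], and the bound of [flip_bound]
    is false for large [M]. The forbidden pattern is (2,1,0) inside the class. *)
Lemma two_neighbours i d : d != a -> (2 <= #|[set j | E i j == d]|)%N.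
Proof.
move=> da; rewrite leqNgt; apply/negP => lt.
have [EE EC Ea _] := LE.
have [M] := large_blowup; apply/negP; rewrite -leNgt.
apply: (@flip_bound M i i d).
  right=> z w p q -> -> /and3P[/eqP z1 z0 zz] /and3P[/eqP w1 w0 ww].
  rewrite /k31 /mono3 recolor_vu !recolor_other ?xpair_eqE /= ?negb_and ?z0 ?zz ?w0 ?ww ?orbT //.
  by rewrite z1 w1 !EE eqxx K31_aab.
rewrite EE; apply: (@leq_trans M.+4).
  apply: (@leq_trans #|finset.setX [set j | E i j == d] [set: 'I_M.+4]%SET|).
    by apply: subset_leq_card; apply/fintype.subsetP => z; rewrite !inE => /and4P[_ _ -> _].
  by rewrite finset.cardsX cardsT card_ord -[leqRHS]mul1n leq_mul2r -ltnS lt orbT.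
rewrite -[X in (X <= _)%N](addn2 M.+2) leq_add2r.
apply: (@leq_trans #|finset.setX [set i] (~: [set ord0; lift ord0 ord0] : {set 'I_M.+4})|).
  by rewrite finset.cardsX cards1 mul1n cardsCs finset.setCK cards2 card_ord.
apply: subset_leq_card; apply/fintype.subsetP => -[z1 z2]; rewrite !inE negb_or /=.
move=> /andP[/eqP-> /andP[z0 zz]]; rewrite !xpair_eqE /= (negbTE z0) (negbTE zz).
by rewrite !andbF /= EE eqxx.
Qed.

(** Recolor a pair between the classes [i] and [j] with [d]. Without a common neighbor in color [d]
    no triangle is gained, while triangles in class [j] see the pattern (0,2,1) of [d], [E i j],
    [E i j]. *)
Lemma common_neighbour i j d : i != j -> d != a -> d != E i j ->
  exists k, E i k = d /\ E j k = d.
Proof.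
move=> ij da dE; have [EE EC Ea _] := LE.
case: (pickP (fun k => (E i k == d) && (E j k == d))) => [k /andP[/eqP ? /eqP ?]|no].
  by exists k.
have [M] := large_blowup; rewrite ltNge => /negP[].
apply: (@flip_bound M i j d).
  left=> z w p q -> -> /and3P[/eqP z1 z0 zz] /and3P[/eqP w1 w0 ww].
  rewrite /k31 /mono3 recolor_uv !recolor_other ?xpair_eqE /= ?negb_and ?z0 ?zz ?w0 ?ww ?orbT //.
  by rewrite z1 w1 !EE eqxx K31_dee ?Ea.
rewrite (_ : codeg _ _ _ d = 0%N) //; apply: eq_card0 => z; rewrite !inE /=.
by rewrite no !andbF.
Qed.
End ForcedColors.

(** * Minimizers *)

Definition minimal (c : nat) (V : finType) (h : V -> V -> 'I_c) :=
  forall h' : V -> V -> 'I_c, (forall x y, h' x y = h' y x) -> (tri_count h <= tri_count h')%N.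

Section VertexDegree.
Variables (R : realFieldType) (c : nat) (V : finType) (h : V -> V -> 'I_c).
Hypothesis hC : forall x y, h x y = h y x.
Hypothesis V0 : (0 < #|V|)%N.

Lemma mono3_swap12 x y z : mono3 h x y z = mono3 h y x z.
Proof. by rewrite /mono3 (hC y x) andbC. Qed.

Lemma mono3_swap23 x y z : mono3 h x y z = mono3 h x z y.
Proof.
rewrite /mono3 (hC z y) eq_sym; case: eqVneq => [->|] //=.
Qed.

Hypothesis hmin : minimal h.
Let n := #|V|%:R : R.

(** Some [u] has at most the average degree, and turning [v] into a twin of [u] must not lower the
    count of a minimizer. *)
Lemma min_degree v : (tri_deg h v * #|V| <= tri_count h + 2 * #|V| ^ 2)%N.
Proof.
have [u Hu] : exists u, (tri_deg h u * #|V| <= tri_count h)%N.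
  case: (pickP (fun u => (tri_deg h u * #|V| <= tri_count h)%N)) => [u ?|no]; first by exists u.
  suff : (tri_count h * #|V| < tri_count h * #|V|)%N by rewrite ltnn.
  have E1 : (tri_count h * #|V| = \sum_v tri_deg h v * #|V|)%N by rewrite big_distrl.
  have E2 : (tri_count h * #|V| = \sum_(v : V) tri_count h)%N by rewrite sum_nat_const mulnC.
  rewrite {1}E2 E1.
  have [w _] : exists w : V, w \in V by apply/card_gt0P.
  rewrite (bigD1 w) //= [ltnRHS](bigD1 w) //= -addSn.
  apply: leq_add; first by rewrite ltnNge no.
  by apply: leq_sum => x _; rewrite ltnW // ltnNge no.
have [->|uv] := eqVneq v u; first by rewrite (leq_trans Hu) ?leq_addr.
have := tri_deg_clone (u := u) (v := v) _ hC; rewrite eq_sym uv => /(_ isT).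
have := hmin (h' := fun x y => h (clone u v x) (clone u v y)) (fun x y => hC _ _).
by move: Hu; set N := tri_count _; set N' := tri_count _; rewrite -mulnn; nia.
Qed.

(** [5 = 2 + 3]: the error of cloning, and the pairs [(y, z)] with [y = v], [z = v] or [y = z]. *)
Lemma min_mono_degree v : Pr2 R (mono3 h v) <= Pr3 R (mono3 h) + 5 / n.
Proof.
have n0 : 0 < n by rewrite ltr0n.
have H1 : (\sum_y \sum_z mono3 h v y z <= tri_deg h v + 3 * #|V|)%N.
  have -> : (3 * #|V| = \sum_y \sum_z ((y == v) + ((z == v) + (y == z))))%N.
    have one (w : V) : (\sum_(i : V) (i == w) = 1)%N.
      by rewrite (bigD1 w) //= eqxx big1 // => i /negbTE->.
    under eq_bigr do rewrite !big_split /= sum_nat_const one.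
    have -> : (\sum_y (#|V| * (y == v) + (1 + \sum_(z : V) (y == z))) =
       \sum_y (#|V| * (y == v) + 2))%N.
      apply: eq_bigr => y _; congr (_ + (_ + _))%N; rewrite -(one y).
      by apply: eq_bigr => z _; rewrite eq_sym.
    by rewrite big_split /= -big_distrr /= one sum_nat_const cardE; lia.
  rewrite /tri_deg -big_split /=; apply: leq_sum => y _; rewrite -big_split /=.
  apply: leq_sum => z _; rewrite /tri (eq_sym v y) (eq_sym v z).
  by case: (y == v); case: (z == v); case: (y == z); case: (mono3 _ _ _ _).
have H2 := min_degree v.
have nEx (F : V -> R) : n * Ex F = \sum_x F x by rewrite mulrC divfK // gt_eqF.
have E1 : n ^+ 2 * Pr2 R (mono3 h v) = (\sum_y \sum_z mono3 h v y z)%:R.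
  rewrite exprSr expr1 -mulrA nEx natr_sum mulr_sumr; apply: eq_bigr => y _.
  by rewrite nEx natr_sum.
have E2 : (tri_count h)%:R <= n ^+ 3 * Pr3 R (mono3 h).
  by rewrite -mono_countE // ler_nat mono_count_split leq_addr.
have H3 : n ^+ 3 * Pr2 R (mono3 h v) <= n ^+ 3 * Pr3 R (mono3 h) + 5 * n ^+ 2.
  rewrite (_ : n ^+ 3 * Pr2 _ _ = n ^+ 2 * Pr2 R (mono3 h v) * n); last by ring.
  rewrite E1.
  apply: le_trans (_ : ((tri_count h + 2 * #|V| ^ 2) + 3 * #|V| * #|V|)%:R <= _).
    rewrite -natrM ler_nat; nia.
  by rewrite !natrD !natrM -/n; move: E2; lra.
rewrite -(ler_pM2l (exprn_gt0 3 n0)) mulrDr.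
apply: le_trans H3 _; by rewrite (_ : n ^+ 3 * (5 / n) = 5 * n ^+ 2) //; field; rewrite gt_eqF.
Qed.
End VertexDegree.

(* Give a vertex v of a minimizer extra weight eta: as v has average triangle degree,
   the triangle density changes by O(eta^2) only, whereas the density of k31 grows by
   eta times that of the copies through v. *)
Section VertexClean.
Variables (R : realFieldType) (c : nat) (V : finType) (h : V -> V -> 'I_c).
Hypothesis hC : forall x y, h x y = h y x.
Hypothesis V0 : (0 < #|V|)%N.
Variables (v : V) (M : nat).
Let W : finType := (V * 'I_M.+1)%type.
(** The layer [ord0] of the blow-up is collapsed to [v], so the uniform measure becomes the mixture
    [L] of the uniform measure on [V] and a point mass [eta] at [v]. *)
Let sg (p : W) := if p.2 == ord0 then v else p.1.
Let eta : R := M.+1%:R^-1.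
Let L (F : V -> R) := (1 - eta) * Ex F + eta * F v.

Lemma Ex_overweight (F : V -> R) : Ex (fun p => F (sg p)) = L F.
Proof.
rewrite Ex_pair Ex_swap [LHS]/Ex card_ord big_ord_recl /= /sg /= Ex_const //.
under eq_bigr do rewrite -/(Ex F).
rewrite sumr_const card_ord /L /eta -[_ *+ M]mulr_natl -natr1.
by field; rewrite natr1 pnatr_eq0.
Qed.

Lemma L_ge (F : V -> R) : (forall x, 0 <= F x) -> eta <= 1 ->
  (eta * F v <= L F) * ((1 - eta) * Ex F <= L F).
Proof.
move=> F0 e1; have e0 : 0 <= eta by rewrite invr_ge0.
by split; rewrite /L ?lerDl ?lerDr mulr_ge0 ?subr_ge0 ?Ex_ge0.
Qed.

Let h' (p q : W) := h (sg p) (sg q).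
Let m x y z : R := (mono3 h x y z)%:R.

Lemma overweight_mono : Pr3 R (mono3 h') = L (fun x => L (fun y => L (m x y))).
Proof.
rewrite -Ex_overweight; apply: eq_Ex => p; rewrite -Ex_overweight; apply: eq_Ex => q.
by rewrite -Ex_overweight; apply: eq_Ex => w.
Qed.

Lemma overweight_q31 : q31 R h' =
  L (fun x => L (fun y => L (fun z => L (fun w => (k31 h x y z w)%:R)))).
Proof.
rewrite -Ex_overweight; apply: eq_Ex => p; rewrite -Ex_overweight; apply: eq_Ex => q.
by rewrite -Ex_overweight; apply: eq_Ex => w; rewrite -Ex_overweight; apply: eq_Ex => w'.
Qed.

(** In the trilinear expansion, terms with at most one factor [eta] are bounded through [B] and the
    others by 1. Since total density and degree of [v] share the bound [B], nothing of first order
    in [eta] remains. *)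
Lemma overweight_mono_le B : 0 <= B -> Pr3 R (mono3 h) <= B -> Pr2 R (mono3 h v) <= B -> eta <= 1 ->
  Pr3 R (mono3 h') <= B + 4 * eta ^+ 2.
Proof.
move=> B0 TB tB e1; have e0 : 0 <= eta by rewrite invr_ge0.
set T := Pr3 R (mono3 h) in TB *; set t := Pr2 R (mono3 h v) in tB *.
have LL (F : V -> V -> R) : L (fun y => L (F y)) =
    (1 - eta) * ((1 - eta) * Ex (fun y => Ex (F y)) + eta * Ex (fun y => F y v))
    + eta * ((1 - eta) * Ex (F v) + eta * F v v).
  by rewrite /L ExD !ExZ.
have t1 : Ex (fun x => Ex (fun y => m x y v)) = t.
  apply: eq_Ex => x; apply: eq_Ex => y; rewrite /m.
  by rewrite (mono3_swap23 hC) (mono3_swap12 hC).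
have t2 : Ex (fun x => Ex (m x v)) = t.
  by apply: eq_Ex => x; apply: eq_Ex => y; rewrite /m (mono3_swap12 hC).
have m1 x y z : m x y z <= 1 by rewrite /m lern1 leq_b1.
have Em1 (F : V -> R) : (forall x, F x <= 1) -> Ex F <= 1 by move=> ?; apply: Ex_le_const.
rewrite overweight_mono {1}/L.
have -> : Ex (fun x => L (fun y => L (m x y))) =
    (1 - eta) * ((1 - eta) * T + eta * t) + eta * ((1 - eta) * t + eta * Ex (fun x => m x v v)).
  under eq_Ex do rewrite LL.
  by rewrite !(ExD, ExZ) t1 t2.
rewrite LL -/t.
have a1 : Ex (fun x => m x v v) <= 1 by apply: Em1.
have a2 : Ex (fun y => m v y v) <= 1 by apply: Em1.
have a3 : Ex (m v v) <= 1 by apply: Em1.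
have a4 := m1 v v v.
have -> : Ex (fun y => Ex (m v y)) = t by [].
move: e0 e1 a1 a2 a3 a4 TB tB B0; clear; move: (Ex _) (Ex _) (Ex _) (m _ _ _) T t eta.
move=> x1 x2 x3 x4 T t e e0 e1 a1 a2 a3 a4 TB tB B0.
have f0 : 0 <= 1 - e by rewrite subr_ge0.
have -> : B + 4 * e ^+ 2 = (1 - e) * ((1 - e) * ((1 - e) * B + e * B) + e * ((1 - e) * B + e * 1))
  + e * ((1 - e) * ((1 - e) * B + e * 1) + e * ((1 - e) * 1 + e * 1)) +
  (B * (e ^+ 2 * (3 - 2 * e)) + (e ^+ 2 * (1 + 2 * e))) by ring.
apply: le_trans (_ : (1 - e) * ((1 - e) * ((1 - e) * B + e * B) + e * ((1 - e) * B + e * 1))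
  + e * ((1 - e) * ((1 - e) * B + e * 1) + e * ((1 - e) * 1 + e * 1)) <= _).
  by do ?[apply: lerD | apply: ler_wpM2l].
have g1 : 0 <= 3 - 2 * e by lra.
have g2 : 0 <= 1 + 2 * e by lra.
have g3 := sqr_ge0 e.
by rewrite lerDl; apply: addr_ge0; rewrite !mulr_ge0.
Qed.

(** Place [v] on the apex or on a vertex of the triangle, with weight [eta]; the other three
    vertices are uniform, each with weight [1 - eta >= 1 / 2]. *)
Lemma overweight_q31_ge : eta <= 1 / 2 ->
  (eta / 8 * Pr3 R (k31 h v) <= q31 R h') *
  (eta / 8 * Pr3 R (fun x z w => k31 h x v z w) <= q31 R h').
Proof.
move=> e2; have e0 : 0 <= eta by rewrite invr_ge0.
have e1 : eta <= 1 by lra.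
have f0 : 0 <= 1 - eta by rewrite subr_ge0.
pose k x y z w : R := (k31 h x y z w)%:R.
have k0 x y z w : 0 <= k x y z w by rewrite /k.
have L0 (F : V -> R) : (forall x, 0 <= F x) -> 0 <= L F.
  by move=> F0; apply: addr_ge0; apply: mulr_ge0 => //; apply: Ex_ge0.
have L2 (F : V -> V -> R) : (forall x y, 0 <= F x y) ->
    (1 - eta) ^+ 2 * Ex (fun x => Ex (F x)) <= L (fun x => L (F x)).
  move=> F0; apply: le_trans (L_ge (fun x => L0 _ (F0 x)) e1).2.
  rewrite expr2 -mulrA ler_wpM2l // -ExZ; apply: le_Ex => x.
  exact: (L_ge (F0 x) e1).2.
have k1 x y z : 0 <= L (k x y z) by apply: L0 => w.
have k2 x y : 0 <= L (fun z => L (k x y z)) by apply: L0 => z.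
have k3 x : 0 <= L (fun y => L (fun z => L (k x y z))) by apply: L0 => y.
have h8 : (eta / 8 <= eta * ((1 - eta) * (1 - eta) ^+ 2)).
  rewrite ler_wpM2l // -exprS; rewrite (_ : 8^-1 = (1 / 2) ^+ 3); last by field.
  by apply: lerXn2r; rewrite ?nnegrE //; lra.
rewrite overweight_q31; split.
  apply: le_trans (_ : eta * ((1 - eta) * (1 - eta) ^+ 2) * Pr3 R (k31 h v) <= _).
    by rewrite ler_wpM2r ?Pr3_ge0.
  apply: le_trans (L_ge k3 e1).1.
  rewrite -mulrA ler_wpM2l //; apply: le_trans (L_ge (k2 v) e1).2.
  rewrite -mulrA ler_wpM2l // -ExZ; apply: le_Ex => y; exact: L2.
apply: le_trans (_ : eta * ((1 - eta) * (1 - eta) ^+ 2) * Pr3 R (fun x z w => k31 h x v z w) <= _).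
  by rewrite ler_wpM2r ?Pr3_ge0.
apply: le_trans (L_ge k3 e1).2.
rewrite [eta * _]mulrC -!mulrA ler_wpM2l // mulrCA -!ExZ; apply: le_Ex => x.
apply: le_trans (L_ge (k2 x) e1).1.
rewrite (_ : (1 - eta) * _ = eta * ((1 - eta) ^+ 2 * Pr2 R (k31 h x v))); last by ring.
by rewrite ler_wpM2l //; apply: L2.
Qed.

Lemma overweight_sym p q : h' p q = h' q p.
Proof. exact: hC. Qed.

Lemma overweight_card : (0 < #|W|)%N.
Proof. by rewrite card_prod card_ord muln_gt0 V0. Qed.
End VertexClean.

Section CleanMinimizers.
Variables (R : realFieldType) (c : nat) (vs s : R).
Hypotheses (vs0 : 0 < vs) (s0 : 0 < s).
Hypothesis ineq : forall (V : finType) (h : V -> V -> 'I_c),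
  (forall x y, h x y = h y x) -> (0 < #|V|)%N ->
  vs + s * (q31 R h + q33 R h) <= Pr3 R (mono3 h).
Hypothesis unbounded : forall x : R, exists n : nat, x < n%:R.

(** A density [D] of forbidden configurations at [v] raises the lower bound by [s * (eta / 8 * D)],
    while overweighting [v] leaves room for only [5 * eta ^+ 2]. Hence [s * D <= 40 * eta], and
    [eta] is chosen small compared with [s * nu]. *)
Lemma vertex_clean nu : 0 < nu -> exists n0 : nat, forall (V : finType) (h : V -> V -> 'I_c),
  (forall x y, h x y = h y x) -> (0 < #|V|)%N -> (n0 <= #|V|)%N -> minimal h ->
  Pr3 R (mono3 h) <= vs + 9 / #|V|%:R ->
  forall v, Pr3 R (k31 h v) <= nu /\ Pr3 R (fun x z w => k31 h x v z w) <= nu.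
Proof.
move=> nu0; have [M HM] := unbounded (64 / (s * nu)).
pose eta : R := M.+2%:R^-1.
have eta0 : 0 < eta by rewrite invr_gt0 ltr0n.
have eta2 : eta <= 1 / 2 by rewrite div1r lef_pV2 ?posrE ?ltr0n // ler_nat.
have etanu : 64 * eta <= s * nu.
  rewrite /eta ler_pdivrMr ?ltr0n //.
  move: HM; rewrite ltr_pdivrMr ?mulr_gt0 // => HM.
  apply: le_trans (ltW HM) _; rewrite mulrC ler_pM2l ?mulr_gt0 // ler_nat.
  by rewrite -addn2 leq_addr.
(* [14 = 9 + 5]: the excess allowed by the hypothesis and the error in [min_mono_degree]. *)
have [n0 Hn0] := unbounded (14 / eta ^+ 2); exists n0.+1 => V h hC V0 nV hmin TB v.
have n00 : 0 < #|V|%:R :> R by rewrite ltr0n.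
have nB : 14 / #|V|%:R <= eta ^+ 2.
  rewrite ler_pdivrMr // mulrC -ler_pdivrMr ?exprn_gt0 // (le_trans (ltW Hn0)) //.
  by rewrite ler_nat ltnW.
have ninv : 0 < #|V|%:R^-1 :> R by rewrite invr_gt0.
set B := vs + eta ^+ 2.
have B0 : 0 <= B by rewrite addr_ge0 ?ltW // exprn_gt0.
have TB1 : Pr3 R (mono3 h) <= B.
  by apply: le_trans TB _; rewrite lerD2l; apply: le_trans nB; rewrite ler_pM2r // ler_nat.
have TB2 : Pr2 R (mono3 h v) <= B.
  apply: le_trans (min_mono_degree R hC V0 hmin v) _.
  apply: le_trans (lerD TB (lexx _)) _; rewrite -addrA lerD2l -mulrDl.
  by apply: le_trans nB; rewrite ler_pM2r // -natrD ler_nat.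
have e1 : eta <= 1 by apply: le_trans eta2 _; rewrite div1r invf_le1 // ler1n.
have T' := overweight_mono_le hC V0 (v := v) (M := M.+1) B0 TB1 TB2 e1.
have I' := ineq (@overweight_sym c V h hC v M.+1) (overweight_card V0 M.+1).
have [Q1 Q2] := overweight_q31_ge h V0 v (M := M.+1) eta2.
set Q := q31 R _ in I' Q1 Q2; set Q' := q33 R _ in I'.
have Q'0 : 0 <= Q' by apply: q33_ge0.
have sQ : s * Q <= 5 * eta ^+ 2.
  have := le_trans I' T'; rewrite /B -!/eta => H.
  have : s * Q <= s * (Q + Q') by rewrite ler_pM2l // lerDl.
  move=> H0; apply: le_trans H0 _; rewrite -(lerD2l vs); apply: le_trans H _.
  by rewrite (_ : vs + eta ^+ 2 + _ = vs + 5 * eta ^+ 2) //; ring.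
have fin D : eta / 8 * D <= Q -> D <= nu.
  move=> H; rewrite -(ler_pM2l s0).
  have H1 : s * (eta / 8 * D) <= 5 * eta ^+ 2 by apply: le_trans sQ; rewrite ler_pM2l.
  have H2 : s * D <= 40 * eta.
    rewrite -(ler_pM2l eta0).
    rewrite (_ : eta * (s * D) = 8 * (s * (eta / 8 * D))); last by field.
    by rewrite (_ : eta * (40 * eta) = 8 * (5 * eta ^+ 2)) ?ler_pM2l //; ring.
  apply: le_trans H2 _; apply: le_trans etanu.
  by rewrite ler_pM2r // ler_nat.
by split; apply: fin.
Qed.
End CleanMinimizers.

(* A vertex v is attached to each class in one main color; by [ram] some class has
   main color a or two classes form a triangle with v, and the triangle degree of v
   leaves room for exactly one class of main color a and for no such triangle. *)
Section Attachment.
Variables (R : realFieldType) (c r : nat) (V : finType) (h : V -> V -> 'I_c).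
Hypothesis hC : forall x y, h x y = h y x.
Hypothesis V0 : (0 < #|V|)%N.
Hypothesis ram : ramsey_free c r.+1.
Variables (a : 'I_c) (E : 'I_r -> 'I_r -> 'I_c) (phi : V -> 'I_r).
Hypothesis LE : looped_ex a E.
Variables (q eps e2 e4 nu : R).
Let w i := Pr R (fun u => phi u == i).
Hypothesis bad : Pr2 R (fun u v => h u v != E (phi u) (phi v)) <= eps.
Hypothesis wq : forall i, q - eps <= w i.
Hypothesis single : forall v i, exists b, Pr R (fun z => (phi z == i) && (h v z != b)) <= e2.
Hypothesis deg : forall v, Pr2 R (mono3 h v) <= q ^+ 2 + e4.
Hypothesis tri_clean : forall v, Pr3 R (fun x z w => k31 h x v z w) <= nu.
Hypothesis eps_q : eps <= q.
Hypothesis small1 : q ^+ 2 + e4 + eps + 4 * e2 < 2 * (q - eps) ^+ 2.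
Hypothesis small2 : nu + 3 * e2 + 3 * eps < (q - eps) ^+ 3.
Hypothesis small3 : q / 4 <= q - eps - e2.

Definition main_color v i := odflt a [pick b | Pr R (fun z => (phi z == i) && (h v z != b)) <= e2].

Lemma main_colorP v i : Pr R (fun z => (phi z == i) && (h v z != main_color v i)) <= e2.
Proof.
rewrite /main_color; case: pickP => //= no.
by have [b Hb] := single v i; rewrite no in Hb.
Qed.

Lemma two_blocks v i1 j1 i2 j2 e : i1 != i2 -> E i1 j1 = e -> E i2 j2 = e ->
  main_color v i1 = e -> main_color v j1 = e -> main_color v i2 = e -> main_color v j2 = e ->
  False.
Proof.
move=> ne e1 e2' m1 m2 m3 m4.
pose P i j y z := (phi y == i) && (phi z == j).
have low : 2 * (q - eps) ^+ 2 <= Pr2 R (fun y z => P i1 j1 y z || P i2 j2 y z).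
  apply: le_trans (_ : Pr2 R (P i1 j1) + Pr2 R (P i2 j2) <= _).
    have qe : 0 <= q - eps by rewrite subr_ge0.
    have H i j : (q - eps) ^+ 2 <= Pr2 R (P i j).
      rewrite (Pr2_prod R (fun y => phi y == i) (fun z => phi z == j)) expr2.
      exact: (ler_pM qe qe (wq i) (wq j)).
    by have := lerD (H i1 j1) (H i2 j2); rewrite -mulr2n -[_ *+ 2]mulr_natl.
  rewrite -ExD; apply: le_Ex => y; rewrite -ExD; apply: le_Ex => z.
  rewrite -natrD ler_nat /P; case: (eqVneq (phi y) i1) => [->|_].
    by rewrite (negbTE ne) /= orbF addn0.
  by rewrite /=.
have up : Pr2 R (fun y z => P i1 j1 y z || P i2 j2 y z) <=
    Pr2 R (mono3 h v) + eps + 4 * e2.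
  pose B i y := (phi y == i) && (h v y != main_color v i).
  apply: le_trans (Pr2_union (Qs := [:: mono3 h v; fun u v => h u v != E (phi u) (phi v);
    fun y z => B i1 y; fun y z => B j1 z; fun y z => B i2 y; fun y z => B j2 z]) _ _) _.
    move=> y z /orP[] /andP[/eqP py /eqP pz]; rewrite /= /B py pz ?e1 ?e2' ?m1 ?m2 ?m3 ?m4 !eqxx /= orbF.
      case: (eqVneq (h v y) e) => [E0|]; last by rewrite !orbT.
      case: (eqVneq (h v z) e) => [E1|]; last by rewrite !orbT.
      case: (eqVneq (h y z) e) => [E2|]; last by rewrite !orbT.
      by rewrite /mono3 E0 E1 E2 eqxx.
    case: (eqVneq (h v y) e) => [E0|]; last by rewrite !orbT.
    case: (eqVneq (h v z) e) => [E1|]; last by rewrite !orbT.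
    case: (eqVneq (h y z) e) => [E2|]; last by rewrite !orbT.
    by rewrite /mono3 E0 E1 E2 eqxx.
  rewrite !big_cons big_nil !(Pr2_1 _ V0) !(Pr2_2 _ V0) !addr0.
  have B1 := main_colorP v i1; have B2 := main_colorP v j1.
  have B3 := main_colorP v i2; have B4 := main_colorP v j2.
  rewrite -addrA lerD2l; apply: le_trans (lerD bad (lexx _)) _; rewrite lerD2l.
  apply: le_trans (lerD B1 (lerD B2 (lerD B3 B4))) _.
  by rewrite (_ : e2 + _ = 4 * e2) //; ring.
have := le_lt_trans (le_trans low (le_trans up _)) small1; rewrite ltxx => H.
suff : false by []; apply: H; rewrite -!addrA; apply: le_trans (lerD (deg v) (lexx _)) _.
by rewrite -!addrA.
Qed.

(** Otherwise [v], adjoined to [E] as the vertex [ord0] with its main colors, gives [r.+1] vertices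
    without color [a]. The triangle found by [ram] contains [v], and its two classes [i], [j] yield
    the two blocks [(i, j)] and [(j, i)]. *)
Lemma main_color_ex v : exists i, main_color v i = a.
Proof.
have [EE EC Ea Et] := LE.
case: (pickP (fun i => main_color v i == a)) => [i /eqP|no]; first by exists i.
pose g (x y : 'I_r.+1) := match unlift ord0 x, unlift ord0 y with
  | Some i, Some j => E i j | None, Some i => main_color v i
  | Some i, None => main_color v i | None, None => a end.
have gC x y : g x y = g y x.
  by rewrite /g; case: unliftP => [i _|_]; case: unliftP => [j _|_].
have ga x y : x != y -> g x y != a.
  rewrite /g; case: unliftP => [i ->|->]; case: unliftP => [j ->|->] //.
  - by rewrite (inj_eq lift_inj) => /Ea.
  - by rewrite no.
  - by rewrite no.
have [x [y [z [xy yz xz]]]] := ram gC ga; rewrite /g.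
have bl i j e : i != j -> main_color v i = e -> main_color v j = e -> E i j = e -> False.
  move=> ij m1 m2 e1; apply: (@two_blocks v i j j i e) => //; by rewrite EC.
case: (unliftP ord0 x) xy xz => [i ->|->]; case: (unliftP ord0 y) yz => [j ->|->];
  case: (unliftP ord0 z) => [k ->|->] //; rewrite ?(inj_eq lift_inj).
- by move=> jk ij ik T; case: (Et i j k ij jk ik).
- by move=> _ ij _ [E1 E2]; case: (bl i j (E i j) ij) => //; rewrite E1.
- by move=> _ _ ik [E1 E2]; case: (bl i k (E i k) ik) => //; rewrite -E2.
- by move=> jk _ _ [E1 E2]; case: (bl j k (E j k) jk) => //; rewrite -E2.
Qed.

Definition own v := odflt (phi v) [pick i | main_color v i == a].

Lemma ownP v : main_color v (own v) = a.
Proof.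
rewrite /own; case: pickP => [i /eqP//|no].
by have [i Hi] := main_color_ex v; have := no i; rewrite Hi eqxx.
Qed.

Lemma own_unique v i : main_color v i = a -> i = own v.
Proof.
move=> Hi; apply/eqP/negPn/negP => ne; have [EE _ _ _] := LE.
by apply: (@two_blocks v i i (own v) (own v) a) => //; rewrite ownP.
Qed.

(** If [phi u] is not the own class of [u], then [u] has a main color other than [a] to the class
    [phi u], hence wrong edges of measure at least [q / 4]. *)
Lemma own_agree : Pr R (fun u => phi u != own u) * (q / 4) <= eps.
Proof.
apply: le_trans bad; rewrite mulrC -ExZ; apply: le_Ex => u.
case: (eqVneq (phi u) (own u)) => [_|ne] /=; first by rewrite mulr0 Pr_ge0.
rewrite mulr1; apply: le_trans small3 _.
have [EE _ _ _] := LE.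
have ma : main_color u (phi u) != a.
  by apply: contra ne => /eqP/own_unique->.
have : w (phi u) <= Pr R (fun z => h u z != E (phi u) (phi z)) + e2.
  apply: le_trans (lerD (lexx _) (main_colorP u (phi u))).
  apply: le_trans (Pr_union (Qs := [:: fun z => h u z != E (phi u) (phi z);
    fun z => (phi z == phi u) && (h u z != main_color u (phi u))]) _ _) _; last first.
    by rewrite !big_cons big_nil addr0.
  move=> z /eqP pz; rewrite /= pz EE eqxx /= orbF.
  by case: (eqVneq (h u z) a) => // ->; rewrite eq_sym.
by have := wq (phi u); lra.
Qed.

(** Take [z], [w] in the own class of [v] and [x] in class [j]: the triangle [v z w] of color [a]
    sees the apex [x] in the colors [main_color v j], [E i j], [E i j], which is the pattern (0,2,1)
    if these differ. *)
Lemma other_color v j : j != own v -> main_color v j = E (own v) j.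
Proof.
move=> ne; apply/eqP/negPn/negP => dif; have [EE EC Ea _] := LE.
set i := own v in ne dif *.
have ma : main_color v j != a by apply: contra ne => /eqP/own_unique->.
have Eij : E i j != a by apply: Ea; rewrite eq_sym.
have mi : main_color v i = a by apply: ownP.
have qe : 0 <= q - eps by rewrite subr_ge0.
pose B k y := (phi y == k) && (h v y != main_color v k).
pose D x y := h x y != E (phi x) (phi y).
have low : (q - eps) ^+ 3 <= Pr3 R (fun x z w => [&& phi x == j, phi z == i & phi w == i]).
  rewrite (Pr3_prod R (fun x => phi x == j) (fun x => phi x == i) (fun x => phi x == i)).
  rewrite !exprS expr0 mulr1; apply: ler_pM (wq j) _ => //; first exact: mulr_ge0.
  exact: (ler_pM qe qe (wq i) (wq i)).
have := le_lt_trans (le_trans low _) small2; rewrite ltxx => H.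
suff : false by []; apply: H.
apply: le_trans (Pr3_union (Qs := [:: fun x z w => k31 h x v z w;
   fun x z w => B j x; fun x z w => B i z; fun x z w => B i w;
   fun x z w => D z w; fun x z w => D x z; fun x z w => D x w]) _ _) _.
  move=> x z y /and3P[/eqP px /eqP pz /eqP py]; rewrite /= /B /D px pz py !eqxx mi EE /= orbF.
  case: (eqVneq (h v x) (main_color v j)) => [E1|]; last by rewrite !orbT.
  case: (eqVneq (h v z) a) => [E2|]; last by rewrite !orbT.
  case: (eqVneq (h v y) a) => [E3|]; last by rewrite !orbT.
  case: (eqVneq (h z y) a) => [E4|]; last by rewrite !orbT.
  case: (eqVneq (h x z) (E j i)) => [E5|]; last by rewrite !orbT.
  case: (eqVneq (h x y) (E j i)) => [E6|]; last by rewrite !orbT.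
  by rewrite /k31 /mono3 E2 E3 E4 eqxx /= (hC x v) E1 E5 E6 (EC j i) K31_dee.
rewrite !big_cons big_nil addr0.
rewrite (Pr3_12 _ V0 (fun x z => B j x)) (Pr2_1 _ V0).
rewrite (Pr3_12 _ V0 (fun x z => B i z)) (Pr2_2 _ V0).
rewrite (Pr3_13 _ V0 (fun x w => B i w)) (Pr2_2 _ V0).
rewrite (Pr3_23 _ V0) (Pr3_12 _ V0) (Pr3_13 _ V0).
have B1 := main_colorP v j; have B2 := main_colorP v i.
have T := tri_clean v.
apply: le_trans (lerD T (lerD B1 (lerD B2 (lerD B2 (lerD bad (lerD bad bad)))))) _.
by rewrite [leLHS](_ : _ = nu + 3 * e2 + 3 * eps) //; ring.
Qed.

Lemma own_wrong v : Pr R (fun z => h v z != E (own v) (own z)) <=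
  r%:R * e2 + Pr R (fun u => phi u != own u).
Proof.
have [EE EC Ea _] := LE.
pose B k y := (phi y == k) && (h v y != main_color v k).
apply: le_trans (Pr_union (Qs := [:: fun z => [exists k, B k z];
  fun u => phi u != own u]) _ _) _.
  move=> z; rewrite /= orbF; case: (eqVneq (phi z) (own z)) => [<-|]; last by rewrite orbT.
  rewrite orbF => ne; apply/existsP; exists (phi z); rewrite /B eqxx /=.
  apply: contra ne => /eqP->; case: (eqVneq (phi z) (own v)) => [->|/other_color->//].
  by rewrite ownP EE.
rewrite !big_cons big_nil addr0 lerD2r.
apply: le_trans (_ : \sum_k Pr R (B k) <= _).
  rewrite -Ex_sum; apply: le_Ex => z; case: existsP => [[k Bk]|_]; last exact: sumr_ge0.
  by rewrite (bigD1 k) //= Bk lerDl; apply: sumr_ge0.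
apply: le_trans (_ : \sum_(k < r) e2 <= _); first by apply: ler_sum => k _; apply: main_colorP.
by rewrite sumr_const card_ord -[X in X <= _]mulr_natl.
Qed.

Lemma own_size i d : `|w i - q| <= d ->
  `|Pr R (fun u => own u == i) - q| <= d + Pr R (fun u => phi u != own u).
Proof.
move=> H; set D := Pr R (fun u => phi u != own u).
have H1 : Pr R (fun u => own u == i) <= w i + D.
  apply: le_trans (Pr_union (Qs := [:: fun u => phi u == i; fun u => phi u != own u]) _ _) _.
    by move=> u /eqP <-; rewrite /= orbF orbN.
  rewrite !big_cons big_nil addr0; exact: lexx.
have H2 : w i <= Pr R (fun u => own u == i) + D.
  apply: le_trans (Pr_union (Qs := [:: fun u => own u == i; fun u => phi u != own u]) _ _) _.
    by move=> u /eqP <-; rewrite /= orbF (eq_sym (own u)) orbN.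
  rewrite !big_cons big_nil addr0; exact: lexx.
move: H; rewrite !ler_norml => /andP[H3 H4]; apply/andP; split; lra.
Qed.
End Attachment.

Lemma attachment_constants (R : realFieldType) (q k e4 eps e2 nu : R) :
  0 < q -> q <= 1 / 2 -> k = q ^+ 3 / 32 -> e4 <= k -> 0 <= eps -> eps <= k -> e2 <= k -> nu <= k ->
  [/\ eps <= q, q ^+ 2 + e4 + eps + 4 * e2 < 2 * (q - eps) ^+ 2,
      nu + 3 * e2 + 3 * eps < (q - eps) ^+ 3 & q / 4 <= q - eps - e2].
Proof.
move=> q0 q2 kE k4 eps0 keps k2 knu.
have q20 : 0 < q ^+ 2 by rewrite exprn_gt0.
have q21 : q ^+ 2 <= q / 2 by rewrite expr2 ler_pM2l //; lra.
have q31 : q ^+ 3 <= q ^+ 2 / 2 by rewrite exprS mulrC ler_pM2l //; lra.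
have q30 : 0 < q ^+ 3 by rewrite exprn_gt0.
have kq : k <= q / 16 by lra.
have kq2 : k <= q ^+ 2 / 64 by lra.
have m : 15 / 16 * q <= q - eps by lra.
have m0 : 0 <= 15 / 16 * q by rewrite mulr_ge0 ?divr_ge0 // ltW.
have p2 : (15 / 16 * q) ^+ 2 <= (q - eps) ^+ 2.
  by apply: lerXn2r m; rewrite nnegrE //; lra.
have p3 : (15 / 16 * q) ^+ 3 <= (q - eps) ^+ 3.
  by apply: lerXn2r m; rewrite nnegrE //; lra.
rewrite exprMn in p2; rewrite exprMn in p3.
have n2 : (15 / 16 : R) ^+ 2 = 225 / 256 by field.
have n3 : (15 / 16 : R) ^+ 3 = 3375 / 4096 by field.
rewrite n2 in p2; rewrite n3 in p3.
have e4q : e4 <= q ^+ 2 / 64 by apply: le_trans kq2.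
have epsq : eps <= q ^+ 2 / 64 by apply: le_trans kq2.
have e2q : e2 <= q ^+ 2 / 64 by apply: le_trans kq2.
split.
- by move: keps kq q0; clear; lra.
- by move: e4q epsq e2q q20 p2; clear; lra.
- by move: knu keps k2 kE q30 p3; clear; lra.
- by move: keps k2 kq q0; clear; lra.
Qed.

Lemma quarters_le (R : realFieldType) (g : R) : 0 < g -> g / 4 + g / 4 <= g.
Proof. lra. Qed.

Lemma sixteenth_le (R : realFieldType) (g q : R) : 0 < g -> q <= 1 / 2 -> g * q / 16 <= g / 4.
Proof. by move=> g0 q2; have : g * q <= g * (1 / 2); [rewrite ler_pM2l | lra]. Qed.

Section Exact.
Variables (R : realFieldType) (c r : nat) (vs s : R).
Hypothesis r2 : (2 <= r)%N.
Hypothesis ram : ramsey_free c r.+1.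
Hypothesis lex : exists (a : 'I_c) (E : 'I_r -> 'I_r -> 'I_c), looped_ex a E.
Hypotheses (vs0 : 0 < vs) (s0 : 0 < s).
Hypothesis ineq : forall (V : finType) (h : V -> V -> 'I_c),
  (forall x y, h x y = h y x) -> (0 < #|V|)%N ->
  vs + s * (q31 R h + q33 R h) <= Pr3 R (mono3 h).
Hypothesis tight : forall delta : R, 0 < delta -> exists (V : finType) (h : V -> V -> 'I_c),
  [/\ forall x y, h x y = h y x, (0 < #|V|)%N & Pr3 R (mono3 h) <= vs + delta].
Hypothesis unbounded : forall x : R, exists n : nat, x < n%:R.

Lemma class_concentration (kap e2 eps nu q : R) (V : finType) (h : V -> V -> 'I_c) a
    (E : 'I_r -> 'I_r -> 'I_c) (phi : V -> 'I_r) : (0 < #|V|)%N -> looped_ex a E ->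
  (forall (V : finType) (A : V -> bool) (g : V -> 'I_c) (a : 'I_c),
    (0 < #|V|)%N -> q <= Pr R A ->
    Pr3 R (fun z z' z'' => [&& A z, A z', A z'' & K31_pattern a (g z) (g z') (g z'')]) <= kap ->
    exists b, Pr R (fun z => A z && (g z != b)) <= e2) ->
  (forall i, q <= Pr R (fun u => phi u == i)) ->
  Pr2 R (fun u v => h u v != E (phi u) (phi v)) <= eps ->
  nu + 3 * eps <= kap ->
  forall v i, Pr3 R (k31 h v) <= nu ->
  exists b, Pr R (fun z => (phi z == i) && (h v z != b)) <= e2.
Proof.
move=> V0 [EE _ _ _] conc wq bad small v i Hv.
apply: (conc V (fun z => phi z == i) (h v) a V0 (wq i)); apply: le_trans small.
pose D x y := h x y != E (phi x) (phi y).
apply: le_trans (Pr3_union (Qs := [:: k31 h v; fun x y z => D x y; fun x y z => D x z;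
   fun x y z => D y z]) _ _) _.
  move=> x y z /and4P[/eqP px /eqP py /eqP pz K]; rewrite /= /D px py pz EE orbF.
  case: (eqVneq (h x y) a) => [E1|]; last by rewrite !orbT.
  case: (eqVneq (h x z) a) => [E2|]; last by rewrite !orbT.
  case: (eqVneq (h y z) a) => [E3|]; last by rewrite !orbT.
  by rewrite /k31 /mono3 E1 E2 E3 eqxx K.
rewrite !big_cons big_nil addr0 (Pr3_12 _ V0) (Pr3_13 _ V0) (Pr3_23 _ V0).
apply: le_trans (lerD Hv (lerD bad (lerD bad bad))) _.
by rewrite [leLHS](_ : _ = nu + 3 * eps) //; ring.
Qed.

Lemma div_small (x y : R) : 0 < y -> exists n0 : nat,
  forall n : nat, (0 < n)%N -> (n0 <= n)%N -> x / n%:R <= y.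
Proof.
move=> y0; have [n0 H] := unbounded (x / y); exists n0 => n n1 nn.
rewrite ler_pdivrMr ?ltr0n // mulrC -ler_pdivrMr //.
by apply: le_trans (ltW H) _; rewrite ler_nat.
Qed.

(** Minimality sharpens [stability], where only most pairs are right, to a bound on the wrong edges
    at every single vertex. *)
Lemma local_structure g : 0 < g -> exists n0 : nat, forall (V : finType) (h : V -> V -> 'I_c),
  (forall x y, h x y = h y x) -> (0 < #|V|)%N -> (n0 <= #|V|)%N -> minimal h ->
  Pr3 R (mono3 h) <= vs + 9 / #|V|%:R ->
  exists (a : 'I_c) (E : 'I_r -> 'I_r -> 'I_c) (psi : V -> 'I_r),
    [/\ looped_ex a E,
      forall v, Pr R (fun z => h v z != E (psi v) (psi z)) <= g &
      forall i, `|Pr R (fun u => psi u == i) - r%:R^-1| <= g].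
Proof.
move=> g0; pose q := r%:R^-1 : R.
have r0 : 0 < r%:R :> R by rewrite ltr0n ltnW.
have q0 : 0 < q by rewrite invr_gt0.
have q2 : q <= 1 / 2 by rewrite div1r lef_pV2 ?posrE // ler_nat.
have rq : r%:R * q = 1 by rewrite mulfV // gt_eqF.
pose k := q ^+ 3 / 32; have k0 : 0 < k by rewrite divr_gt0 // exprn_gt0.
have gq : 0 < g * q by rewrite mulr_gt0.
pose e2 := Num.min k (g * q / 4).
have e20 : 0 < e2 by rewrite lt_min k0 divr_gt0.
have e2k : e2 <= k by rewrite ge_min lexx.
have e2g : e2 <= g * q / 4 by rewrite ge_min lexx orbT.
have qh : 0 < q / 4 by rewrite divr_gt0.
have [kap kap0 conc] := concentration c e20 qh.
pose eps := Num.min k (Num.min (kap / 6) (g * q / 16)).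
have eps0 : 0 < eps by rewrite !lt_min k0 /= !divr_gt0.
have epsk : eps <= k by rewrite ge_min lexx.
have epskap : eps <= kap / 6 by rewrite !ge_min lexx !orbT.
have epsg : eps <= g * q / 16 by rewrite !ge_min lexx !orbT.
pose nu := Num.min k (kap / 2).
have nu0 : 0 < nu by rewrite !lt_min k0 divr_gt0.
have nuk : nu <= k by rewrite ge_min lexx.
have nukap : nu <= kap / 2 by rewrite ge_min lexx orbT.
have [c1 c2 c3 c4] := attachment_constants q0 q2 (erefl k) (lexx k) (ltW eps0) epsk e2k nuk.
have small : nu + 3 * eps <= kap.
  apply: le_trans (_ : kap / 2 + 3 * (kap / 6) <= _); first by rewrite lerD // ler_pM2l.
  by rewrite [leLHS](_ : _ = kap) //; field.
have [d d0 Hd] := stability r2 ram lex vs0 s0 ineq tight eps0.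
have [n1 Hn1] := vertex_clean vs0 s0 ineq unbounded nu0.
have [n2 Hn2] := div_small 9 d0.
have [n3 Hn3] := div_small 14 k0.
exists (maxn n1 (maxn n2 n3)) => V h hC V0; rewrite !geq_max => /and3P[l1 l2 l3] hmin TB.
have [a [E [phi [LE bad size]]]] := Hd V h hC V0 (le_trans TB (lerD (lexx _) (Hn2 _ V0 l2))).
have clean := Hn1 V h hC V0 l1 hmin TB.
have wq i : q - eps <= Pr R (fun u => phi u == i).
  by have := size i; rewrite ler_norml lerBlDr lerBrDr addrC => /andP[]; rewrite -lerBlDr addrC.
have wq2 i : q / 4 <= Pr R (fun u => phi u == i).
  by apply: le_trans (wq i); apply: le_trans c4 _; rewrite gerBl ltW.
have single v i := class_concentration V0 LE conc wq2 bad small i (proj1 (clean v)).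
have degv v : Pr2 R (mono3 h v) <= q ^+ 2 + k.
  apply: le_trans (min_mono_degree R hC V0 hmin v) _.
  apply: le_trans (lerD TB (lexx _)) _.
  rewrite -addrA -mulrDl (vsE r2 ram lex vs0 s0 ineq tight) -exprVn lerD2l.
  by apply: le_trans (Hn3 _ V0 l3); rewrite ler_pM2r ?invr_gt0 ?ltr0n // -natrD ler_nat.
have cl v := proj2 (clean v).
pose psi := own h a phi e2.
have agr := own_agree V0 ram LE bad wq single degv c1 c2 c4.
have wr := own_wrong hC V0 ram LE bad wq single degv cl c1 c2 c3.
have D : Pr R (fun u => phi u != psi u) <= g / 4.
  rewrite -(ler_pM2r (_ : 0 < q / 4)) ?divr_gt0 //; apply: le_trans agr _.
  by apply: le_trans epsg _; rewrite [leLHS](_ : _ = g / 4 * (q / 4)) //; field.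
exists a, E, psi; split=> // [v|i].
  apply: le_trans (wr v) _; apply: le_trans (_ : g / 4 + g / 4 <= _).
    apply: lerD D; apply: le_trans (_ : r%:R * (g * q / 4) <= _); first by rewrite ler_pM2l.
    by rewrite !mulrA (mulrAC r%:R g q) rq mul1r.
  exact: quarters_le.
apply: le_trans (own_size h a e2 (size i)) _.
apply: le_trans (_ : g / 4 + g / 4 <= _).
  by apply: lerD D; apply: le_trans epsg (sixteenth_le g0 q2).
exact: quarters_le.
Qed.
End Exact.

(** * Class sizes and wrong edges of a minimizer *)

Section ClassSizes.
Variables (R : realFieldType) (r : nat) (V : finType).
Implicit Types psi : V -> 'I_r.

Definition class psi i := [set z | psi z == i].

Lemma class_sum psi : (\sum_i #|class psi i| = #|V|)%N.
Proof.
rewrite -sum1_card (partition_big psi xpredT) //=; apply: eq_bigr => i _.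
by rewrite -sum1_card; apply: eq_bigl => z; rewrite inE.
Qed.

Lemma balanced_size psi : (forall i j, #|class psi i| <= #|class psi j| + 1)%N ->
  forall i, `|#|class psi i|%:R - #|V|%:R / r%:R| <= 1 :> R.
Proof.
move=> bal i; have rp : (0 < r)%N by apply: leq_ltn_trans (ltn_ord i).
have r0 : 0 < r%:R :> R by rewrite ltr0n.
have cst (x : nat) : (\sum_(j < r) x = x * r)%N by rewrite sum_nat_const card_ord mulnC.
have m1 : (#|class psi i| * r <= #|V| + r)%N.
  rewrite -(class_sum psi) -cst -[X in (_ <= _ + X)%N]mul1n -cst -big_split /=.
  by apply: leq_sum => j _; apply: bal.
have m2 : (#|V| <= #|class psi i| * r + r)%N.
  rewrite -{1}(class_sum psi) -cst -[X in (_ <= _ + X)%N]mul1n -cst -big_split /=.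
  by apply: leq_sum => j _; apply: bal.
have m3 : #|class psi i|%:R <= #|V|%:R / r%:R + 1 :> R.
  by rewrite -(ler_pM2r r0) mulrDl mul1r divfK ?gt_eqF // -natrM -natrD ler_nat.
have m4 : #|V|%:R / r%:R <= #|class psi i|%:R + 1 :> R.
  by rewrite ler_pdivrMr // mulrDl mul1r -natrM -natrD ler_nat.
by rewrite ler_norml lerBlDr lerBrDr addrC lerBlDr m4 addrC m3.
Qed.
End ClassSizes.

Section BlowupCounts.
Variables (c r : nat) (V : finType) (a : 'I_c) (E : 'I_r -> 'I_r -> 'I_c).
Hypothesis LE : looped_ex a E.
Implicit Types psi : V -> 'I_r.

Definition blow psi x y := E (psi x) (psi y).

Lemma blow_sym psi x y : blow psi x y = blow psi y x.
Proof. by case: LE => _ EC _ _; apply: EC. Qed.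

Lemma tri_blow psi x y z : tri (blow psi) x y z =
  [&& x != y, y != z, x != z, psi x == psi y & psi y == psi z].
Proof. by rewrite /tri -(looped_ex_mono (psi x) (psi y) (psi z) LE). Qed.

Lemma tri_deg_blow psi v :
  tri_deg (blow psi) v = (#|class psi (psi v)|.-1 * #|class psi (psi v)|.-2)%N.
Proof.
set A := class psi (psi v) :\ v.
have cA : #|A| = #|class psi (psi v)|.-1.
  by rewrite (cardsD1 v (class _ _)) inE eqxx.
rewrite -cA -sum_nat_const /tri_deg [RHS]big_mkcond; apply: eq_bigr => y _.
have memA z : (z \in A) = (z != v) && (psi z == psi v) by rewrite !inE.
case yA: (y \in A); last first.
  apply: big1 => z _; rewrite tri_blow; move: yA; rewrite memA eq_sym (eq_sym (psi y)).
  by case: (v != y) => //= ->; rewrite !andbF.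
rewrite (cardsD1 y A) yA /= -sum1_card [RHS]big_mkcond; apply: eq_bigr => z _.
rewrite tri_blow finset.in_setD1 memA; move: yA; rewrite memA => /andP[yv /eqP ->].
rewrite eqxx /= (eq_sym v y) yv (eq_sym y z) (eq_sym v z) (eq_sym (psi v)) /=.
by case: (z != y); case: (z != v); case: (psi z == psi v).
Qed.

(** For class sizes [x] and [y], moving a vertex from [i] to [j] replaces its degree
    [(x - 1) * (x - 2)] by [y * (y - 1)], which is smaller for [x > y + 1] and [y > 0]. The move is
    a cloning of a vertex of class [j]. *)
Lemma min_blow_balanced psi i j : minimal (blow psi) -> (0 < #|class psi j|)%N ->
  (#|class psi i| <= #|class psi j| + 1)%N.
Proof.
move=> hmin j0; rewrite leqNgt; apply/negP => lt.
have ij : i != j by apply: contraTneq lt => ->; rewrite -leqNgt leq_addr.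
have [u] := card_gt0P j0; rewrite inE => /eqP uj.
have [v] : exists v, v \in class psi i by apply/card_gt0P; lia.
rewrite inE => /eqP vi.
pose psi' x := psi (clone u v x).
have := hmin (blow psi') (blow_sym psi').
rewrite (tri_count_split (blow_sym psi) v) (tri_count_split (blow_sym psi') v).
have -> : tri_off (blow psi') v = tri_off (blow psi) v.
  apply: eq_bigr => x xv; apply: eq_bigr => y yv; apply: eq_bigr => z zv.
  by rewrite !tri_blow /psi' /clone (negbTE xv) (negbTE yv) (negbTE zv).
have pv : psi' v = j by rewrite /psi' /clone eqxx.
have cj : class psi' j = v |: class psi j.
  apply/finset.setP => z; rewrite !inE /psi' /clone; case: (eqVneq z v) => [->|] //=.
  by rewrite uj eqxx.
rewrite !tri_deg_blow pv vi cj cardsU1 inE vi (negbTE ij) /=.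
by move: lt j0; set x := #|_|; set y := #|_|; move: x y => x y; nia.
Qed.
End BlowupCounts.

Section WrongEdges.
Variables (R : realFieldType) (c r : nat) (V : finType) (h : V -> V -> 'I_c).
Hypothesis hC : forall x y, h x y = h y x.
Hypothesis V0 : (0 < #|V|)%N.
Hypothesis hmin : minimal h.
Variables (a : 'I_c) (E : 'I_r -> 'I_r -> 'I_c) (psi : V -> 'I_r) (g q : R).
Hypothesis LE : looped_ex a E.
Hypothesis right : forall v, Pr R (fun z => h v z != E (psi v) (psi z)) <= g.
Hypothesis size : forall i, `|Pr R (fun u => psi u == i) - q| <= g.
Let n := #|V|%:R : R.
Hypothesis small : 7 * g + 2 / n < q.
Hypothesis two : forall i d, d != a -> (2 <= #|[set j | E i j == d]|)%N.
Hypothesis common : forall i j d, i != j -> d != a -> d != E i j ->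
  exists k, E i k = d /\ E j k = d.

Let n0 : 0 < n. Proof. by rewrite ltr0n. Qed.

Let both u v e z := (E (psi u) (psi z) == e) && (E (psi v) (psi z) == e).

Lemma codegE u v e :
  (codeg h u v e)%:R = n * Pr R (fun z => [&& z != u, z != v, h u z == e & h v z == e]).
Proof. by rewrite PrE mulrC divfK // gt_eqF. Qed.

Lemma codeg_le u v e : (codeg h u v e)%:R <= n * (Pr R (both u v e) + 2 * g).
Proof.
rewrite codegE ler_pM2l //.
apply: le_trans (Pr_union (Qs := [:: both u v e; fun z => h u z != E (psi u) (psi z);
  fun z => h v z != E (psi v) (psi z)]) _ _) _.
  move=> z /and4P[_ _ /eqP hu /eqP hv]; rewrite /= /both hu hv orbF.
  by rewrite ![e == _]eq_sym; case: (_ == e); case: (_ == e).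
rewrite !big_cons big_nil addr0 lerD2l.
by apply: le_trans (lerD (right u) (right v)) _; rewrite mulr_natl mulr2n.
Qed.

Lemma codeg_ge u v e : n * (Pr R (both u v e) - 2 * g - 2 / n) <= (codeg h u v e)%:R.
Proof.
rewrite codegE ler_pM2l // !lerBlDr.
apply: le_trans (Pr_union (Qs := [:: fun z => [&& z != u, z != v, h u z == e & h v z == e];
  eq_op^~ u; eq_op^~ v; fun z => h u z != E (psi u) (psi z);
  fun z => h v z != E (psi v) (psi z)]) _ _) _.
  move=> z /andP[/eqP hu /eqP hv]; rewrite /= hu hv orbF.
  by case: (z == u); case: (z == v); case: (h u z == e); case: (h v z == e).
rewrite !big_cons big_nil addr0 !Pr_eq1 -/n.
have := right u; have := right v; set A := Pr R _; set B := Pr R _ => H1 H2.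
rewrite -!addrA lerD2l; apply: le_trans (lerD (lexx _) (lerD (lexx _) (lerD H2 H1))) _.
by rewrite addrA [2 / n]mulr_natl [2 * g]mulr_natl.
Qed.

Lemma size_bounds i : (q - g <= Pr R (fun u => psi u == i)) * (Pr R (fun u => psi u == i) <= q + g).
Proof.
have := size i; rewrite ler_norml => /andP[H1 H2]; split; lra.
Qed.

Lemma g_ge0 : 0 <= g.
Proof. by have [v _] := card_gt0P V0; apply: le_trans (right v); apply: Pr_ge0. Qed.

Lemma codeg_min u v : u != v -> (codeg h u v (h u v) <= codeg h u v (E (psi u) (psi v)))%N.
Proof.
move=> uv; set e := E _ _.
have := tri_count_recolor e hC uv; have := hmin (recolor_sym u v e hC); lia.
Qed.

(** A minimizer does not profit from giving [u v] its right color. If the color [d] is wrong and not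
    [a], then inside a class [two] gives [d] a codegree of about [2 * q] against [q], and between
    classes [common] gives [q] against 0. The first case needs [7 * g + 2 / n < q]. *)
Lemma edge_right_or_loop u v : u != v -> h u v = E (psi u) (psi v) \/ h u v = a.
Proof.
move=> uv; case: (eqVneq (h u v) (E (psi u) (psi v))) => [|wr]; first by left.
case: (eqVneq (h u v) a) => [|da]; first by right.
exfalso; have [EE EC Ea Et] := LE; set d := h u v in wr da.
have gg := g_ge0; have sm := small.
have H := codeg_min uv; rewrite -/d -(ler_nat R) in H.
have {H} := le_trans (codeg_ge u v d) (le_trans H (codeg_le u v _)).
rewrite ler_pM2l //; apply/negP; rewrite -ltNge.
case: (eqVneq (psi u) (psi v)) => [puv|puv].
  have [j1 [j2 [J1 J2 j12]]] := card_gt1P (two (psi u) da).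
  rewrite !inE in J1 J2.
  have L : 2 * (q - g) <= Pr R (both u v d).
    apply: le_trans (_ : Pr R (fun z => psi z == j1) + Pr R (fun z => psi z == j2) <= _).
      by have [b1 _] := size_bounds j1; have [b2 _] := size_bounds j2; lra.
    rewrite -ExD; apply: le_Ex => z; rewrite -natrD ler_nat /both -puv andbb.
    case: (eqVneq (psi z) j1) => [->|_]; first by rewrite (negbTE j12) J1.
    by case: (eqVneq (psi z) j2) => [->|_]; first by rewrite J2.
  have U : Pr R (both u v (E (psi u) (psi v))) <= q + g.
    have [_ b] := size_bounds (psi u); apply: le_trans b; apply: Pr_mono => z.
    rewrite /both -puv andbb EE => /eqP Hz; apply/eqP; apply/eqP.
    by rewrite eq_sym; apply: contraTT (introT eqP Hz) => /Ea.
  lra.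
have [k [k1 k2]] := common puv da wr.
have L : q - g <= Pr R (both u v d).
  have [b _] := size_bounds k; apply: le_trans b _; apply: Pr_mono => z /eqP pz.
  by rewrite /both pz k1 k2 eqxx.
have U : Pr R (both u v (E (psi u) (psi v))) <= 0.
  rewrite -[leRHS](Ex_const 0 V0); apply: le_Ex => z.
  suff -> : both u v (E (psi u) (psi v)) z = false by [].
  apply/negP => /andP[/eqP h1 /eqP h2].
  case: (eqVneq (psi u) (psi z)) => [uz|uz].
    by move: (Ea _ _ puv); rewrite -h1 -uz EE eqxx.
  case: (eqVneq (psi v) (psi z)) => [vz|vz].
    by move: (Ea _ _ puv); rewrite -h2 -vz EE eqxx.
  by apply: (Et _ _ _ puv vz uz); rewrite h1 h2.
lra.
Qed.

(** Edges inside a class have the loop color in either case, so [h] contains every triangle of the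
    blow-up; by minimality it contains no other. *)
Lemma tri_minimal x y z : tri h x y z = tri (blow E psi) x y z.
Proof.
have [EE EC Ea Et] := LE.
have sub x' y' z' : tri (blow E psi) x' y' z' -> tri h x' y' z'.
  rewrite (tri_blow LE) => /and5P[xy yz xz /eqP pxy /eqP pyz].
  have ha s t : s != t -> psi s = psi t -> h s t = a.
    by move=> /edge_right_or_loop[->|//] ->; rewrite EE.
  by rewrite /tri xy yz xz /mono3 !ha ?eqxx //; rewrite pxy.
have le x' y' z' : (tri (blow E psi) x' y' z' <= tri h x' y' z')%N.
  by case: (tri (blow _ _) _ _ _) (sub x' y' z') => // ->.
have eqc : (tri_count h = tri_count (blow E psi) +
    \sum_x \sum_y \sum_z (tri h x y z - tri (blow E psi) x y z))%N.
  rewrite /tri_count -big_split /=; apply: eq_bigr => x' _; rewrite -big_split /=.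
  apply: eq_bigr => y' _; rewrite -big_split /=; apply: eq_bigr => z' _.
  by rewrite subnKC.
have /eqP : (\sum_x \sum_y \sum_z (tri h x y z - tri (blow E psi) x y z) = 0)%N.
  by have := hmin (blow_sym LE psi); lia.
rewrite sum_nat_eq0 => /forallP/(_ x)/implyP/(_ isT).
rewrite sum_nat_eq0 => /forallP/(_ y)/implyP/(_ isT).
rewrite sum_nat_eq0 => /forallP/(_ z)/implyP/(_ isT).
by have := le x y z; case: (tri h x y z); case: (tri _ x y z).
Qed.

Lemma blow_minimal : minimal (blow E psi).
Proof.
move=> h' h'C; apply: leq_trans (hmin h'C).
by apply: leq_sum => x _; apply: leq_sum => y _; apply: leq_sum => z _; rewrite tri_minimal.
Qed.

Lemma class_pos i : (0 < #|class psi i|)%N.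
Proof.
have [b _] := size_bounds i; have gg := g_ge0.
have : 0 < Pr R (fun u => psi u == i).
  apply: lt_le_trans b; have := small; have : 0 < 2 / n by rewrite divr_gt0.
  lra.
rewrite PrE; case: (posnP #|class psi i|) => // E0.
by rewrite -[[set x | _]]/(class psi i) E0 mul0r ltxx.
Qed.

Lemma classes_balanced i : `|#|class psi i|%:R - n / r%:R| <= 1.
Proof.
by apply: balanced_size => j k; rewrite (min_blow_balanced LE _ blow_minimal) ?class_pos.
Qed.
End WrongEdges.

Section ExactStructure.
Variables (R : realFieldType) (c r : nat) (vs s : R).
Hypothesis r2 : (2 <= r)%N.
Hypothesis ram : ramsey_free c r.+1.
Hypothesis lex : exists (a : 'I_c) (E : 'I_r -> 'I_r -> 'I_c), looped_ex a E.
Hypotheses (vs0 : 0 < vs) (s0 : 0 < s).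
Hypothesis ineq : forall (V : finType) (h : V -> V -> 'I_c),
  (forall x y, h x y = h y x) -> (0 < #|V|)%N ->
  vs + s * (q31 R h + q33 R h) <= Pr3 R (mono3 h).
Hypothesis tight : forall delta : R, 0 < delta -> exists (V : finType) (h : V -> V -> 'I_c),
  [/\ forall x y, h x y = h y x, (0 < #|V|)%N & Pr3 R (mono3 h) <= vs + delta].
Hypothesis unbounded : forall x : R, exists n : nat, x < n%:R.

Lemma exact_structure : exists n0 : nat, forall (V : finType) (h : V -> V -> 'I_c),
  (forall x y, h x y = h y x) -> (0 < #|V|)%N -> (n0 <= #|V|)%N -> minimal h ->
  Pr3 R (mono3 h) <= vs + 9 / #|V|%:R ->
  exists (a : 'I_c) (E : 'I_r -> 'I_r -> 'I_c) (psi : V -> 'I_r),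
    [/\ looped_ex a E,
      forall u v, u != v -> h u v = E (psi u) (psi v) \/ h u v = a,
      forall x y z, tri h x y z = tri (blow E psi) x y z &
      forall i, `|#|class psi i|%:R - #|V|%:R / r%:R| <= 1 :> R].
Proof.
have r0 : 0 < r%:R :> R by rewrite ltr0n ltnW.
pose q := r%:R^-1 : R; have q0 : 0 < q by rewrite invr_gt0.
have g0 : 0 < q / 16 by rewrite divr_gt0.
have [n1 H1] := local_structure r2 ram lex vs0 s0 ineq tight unbounded g0.
have [n2 H2] := div_small unbounded 2 g0.
exists (maxn n1 n2) => V h hC V0; rewrite geq_max => /andP[l1 l2] hmin TB.
have [a [E [psi [LE right size]]]] := H1 V h hC V0 l1 hmin TB.
have small : 7 * (q / 16) + 2 / #|V|%:R < q.
  apply: le_lt_trans (lerD (lexx _) (H2 _ V0 l2)) _.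
  rewrite (_ : 7 * (q / 16) + q / 16 = q / 2); last by field.
  by rewrite gtr_pMr // invf_lt1 // ltr1n.
have rp : (0 < r)%N by apply: ltnW.
have vq := vsE r2 ram lex vs0 s0 ineq tight.
have two := two_neighbours rp s0 vq ineq unbounded LE.
have com := common_neighbour rp s0 vq ineq unbounded LE.
exists a, E, psi; split=> //.
- exact: (edge_right_or_loop hC V0 hmin LE right size small two com).
- exact: (tri_minimal hC V0 hmin LE right size small two com).
- exact: (classes_balanced hC V0 hmin LE right size small two com).
Qed.
End ExactStructure.

(** * Balancing a partition by few moves *)

Section Rebalance.
Variables (r : nat) (V : finType).
Implicit Types phi psi : V -> 'I_r.

(* Truncated subtractions: the excess over floor(|V|/r) + 1 plus the deficit below
   floor(|V|/r). *)
Definition imbalance phi :=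
  (\sum_i ((#|class phi i| - (#|V| %/ r).+1) + (#|V| %/ r - #|class phi i|)))%N.

(** If two sizes differ by more than 1, the largest class exceeds [t] and the smallest does not.
    Moving a vertex from the former to the latter creates no new excess or deficit and removes at
    least one, so the number of moves is at most the imbalance. *)
Lemma rebalance phi : exists psi, (forall i j, #|class psi i| <= #|class psi j| + 1)%N /\
  (#|[set x | phi x != psi x]| <= imbalance phi)%N.
Proof.
have [d le] := ubnP (imbalance phi); elim: d => // d IH in phi le *.
case: (pickP (fun ij : 'I_r * 'I_r => (#|class phi ij.2| + 1 < #|class phi ij.1|)%N)); last first.
  move=> no; exists phi; split=> [i j|]; first by rewrite leqNgt; have := no (i, j) => /= ->.
  by rewrite (eq_card0 (A := [set x | phi x != phi x])) // => x; rewrite !inE eqxx.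
move=> [i0 j0] /= lt0.
pose i := [arg max_(k > i0) #|class phi k|]; pose j := [arg min_(k < i0) #|class phi k|].
have maxi k : (#|class phi k| <= #|class phi i|)%N by rewrite /i; case: arg_maxnP => // m _; apply.
have minj k : (#|class phi j| <= #|class phi k|)%N by rewrite /j; case: arg_minnP => // m _; apply.
have lt : (#|class phi j| + 1 < #|class phi i|)%N by have := maxi i0; have := minj j0; lia.
clearbody i j.
have r0 : (0 < r)%N by apply: leq_ltn_trans (ltn_ord i).
have ij : i != j by apply: contraTneq lt => ->; rewrite -leqNgt leq_addr.
set t := (#|V| %/ r)%N.
have tr : (t * r <= #|V|)%N by apply: leq_trunc_div.
have tr1 : (#|V| < t.+1 * r)%N by apply: ltn_ceil.
have jt : (#|class phi j| <= t)%N.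
  rewrite leqNgt; apply/negP => tj; move: tr1; rewrite ltnNge -(class_sum phi) => /negP; apply.
  rewrite mulnC -[X in (X * _)%N](card_ord r) -sum_nat_const; apply: leq_sum => k _.
  exact: leq_trans tj (minj k).
have it : (t < #|class phi i|)%N.
  rewrite ltnNge; apply/negP => ti; move: tr; rewrite leqNgt -(class_sum phi) => /negP; apply.
  rewrite mulnC -[X in (_ < X * _)%N](card_ord r) -sum_nat_const.
  rewrite (bigD1 j) //= [ltnRHS](bigD1 j) //= -addSn; apply: leq_add; first by lia.
  by apply: leq_sum => k _; apply: leq_trans (maxi k) ti.
have [v] : exists v, v \in class phi i by apply/card_gt0P; lia.
rewrite inE => /eqP vi.
pose phi1 x := if x == v then j else phi x.
have ci : #|class phi i| = (#|class phi1 i|).+1.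
  rewrite (cardsD1 v (class phi i)) inE vi eqxx add1n; congr _.+1; apply: eq_card => z.
  by rewrite !inE /phi1; case: (z == v) => //=; rewrite eq_sym (negbTE ij).
have cj : #|class phi1 j| = (#|class phi j|).+1.
  rewrite (cardsD1 v (class phi1 j)) inE /phi1 eqxx eqxx add1n; congr _.+1; apply: eq_card => z.
  by rewrite !inE; case: (eqVneq z v) => [->|] //=; rewrite vi (negbTE ij).
have ck k : k != i -> k != j -> #|class phi1 k| = #|class phi k|.
  move=> ki kj; apply: eq_card => z; rewrite !inE /phi1; case: (eqVneq z v) => [->|//].
  by rewrite vi eq_sym (negbTE kj) eq_sym (negbTE ki).
have D : (imbalance phi1 < imbalance phi)%N.
  rewrite /imbalance -/t (bigD1 i) //= (bigD1 j) ?(eq_sym j) //=.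
  rewrite [ltnRHS](bigD1 i) //= [X in (_ < _ + X)%N](bigD1 j) ?(eq_sym j) //=.
  rewrite (eq_bigr (fun k => (#|class phi k| - t.+1) + (t - #|class phi k|))%N); last first.
    by move=> k /andP[ki kj]; rewrite ck.
  move: (\sum_(_ | _) _)%N => S; rewrite cj; move: ci it jt lt; lia.
have [psi [bal dist]] := IH phi1 (leq_trans D le).
exists psi; split=> //; apply: leq_trans D.
apply: leq_trans (_ : #|v |: [set x | phi1 x != psi x]| <= _)%N.
  apply: subset_leq_card; apply/fintype.subsetP => x; rewrite !inE /phi1.
  by case: (eqVneq x v).
by rewrite cardsU1; apply: leq_trans (leq_add (leq_b1 _) dist) _; rewrite add1n.
Qed.
End Rebalance.

Local Notation col := Defs.col.

Local Notation o0 := ord0.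
Local Notation o1 := (lift ord0 ord0).
Local Notation o2 := (lift ord0 (lift ord0 ord0)).
Local Notation o3 := (lift ord0 (lift ord0 (lift ord0 ord0))).

(** * Densities of colorings *)

Lemma ord3P (P : 'I_3 -> Prop) : P o0 -> P o1 -> P o2 -> forall i, P i.
Proof.
move=> P0 P1 P2 [[|[|[|//]]] lt].
- by have -> : Ordinal lt = o0 by apply: val_inj.
- by have -> : Ordinal lt = o1 by apply: val_inj.
- by have -> : Ordinal lt = o2 by apply: val_inj.
Qed.

Section Counting.
Variables (I V : finType).

Lemma card_inj_image (P : {set V} -> bool) :
  #|[set t : {ffun I -> V} | injectiveb t && P (t @: [set: I]%SET)]| =
  ((#|I|)`! * #|[set S : {set V} | (#|S| == #|I|)%N && P S]|)%N.
Proof.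
set A := [set t : {ffun I -> V} | _]; set D := [set S | _].
rewrite -sum1_card (partition_big (fun t : {ffun I -> V} => t @: [set: I]%SET) (mem D)) /=.
  rewrite mulnC -sum_nat_const; apply: eq_bigr => S; rewrite inE => /andP[/eqP cS PS].
  rewrite sum1_card; transitivity (#|S| ^_ #|I|)%N; last by rewrite cS ffactnn.
  etransitivity; last exact: (card_inj_ffuns_on I (mem S)).
  apply: eq_card => t; rewrite !inE; apply/idP/idP.
    rewrite unfold_in /= inE => /andP[/andP[it _] /eqP <-]; rewrite it andbT.
    by apply/ffun_onP => i; apply: imset_f; rewrite inE.
  move=> /andP[/ffun_onP tS it]; rewrite unfold_in /= inE it /=.
  have E : t @: [set: I]%SET = S.
    apply/eqP; rewrite eqEcard; apply/andP; split.
      by apply/fintype.subsetP => x /imsetP[i _ ->]; apply: tS.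
    by rewrite card_imset ?cardsT ?cS //; apply/injectiveP.
  by rewrite E PS eqxx.
move=> t; rewrite !inE => /andP[it Pt]; rewrite Pt andbT.
by rewrite card_imset ?cardsT //; apply/injectiveP.
Qed.

Variable R : realType.

Lemma Pr_not_inj (V0 : (0 < #|V|)%N) :
  Pr R (fun t : {ffun I -> V} => ~~ injectiveb t) <= (#|I| ^ 2)%:R / #|V|%:R.
Proof.
apply: le_trans (_ : Ex (fun t : {ffun I -> V} =>
   \sum_(ij : I * I | ij.1 != ij.2) (t ij.1 == t ij.2)%:R) <= _).
  apply: le_Ex => t; case: (boolP (injectiveb t)) => [_|/injectivePn[i [j ij tij]]].
    by apply: sumr_ge0.
  by rewrite (bigD1 (i, j)) //= tij eqxx lerDl; apply: sumr_ge0.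
rewrite Ex_sum; apply: le_trans (_ : \sum_(ij : I * I | ij.1 != ij.2) #|V|%:R^-1 <= _).
  apply: ler_sum => ij ne; rewrite -/(Pr R _) (Pr_ffun2 R V0 (fun x y => x == y) ne).
  apply: Ex_le_const; first by rewrite invr_ge0.
  by move=> x; rewrite -(Pr_eq1 R x) /Pr; apply: le_Ex => y; rewrite eq_sym.
rewrite sumr_const -[X in X <= _]mulr_natl ler_wpM2r ?invr_ge0 // ler_nat.
by apply: leq_trans (max_card _) _; rewrite card_prod.
Qed.
End Counting.

Section Densities.
Variables (R : realType) (n c : nat) (G : coloring n c).
Implicit Types (I : finType).

Lemma col_sym u v : col G u v = col G v u.
Proof. by rewrite /col; case: ltngtP => // /val_inj->. Qed.

Lemma dens_ge0 k P : 0 <= dens R (n := n) k P.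
Proof. by rewrite divr_ge0. Qed.

Lemma dens_le1 k P : dens R (n := n) k P <= 1.
Proof.
rewrite /dens; case: (posnP 'C(n, k)) => [->|C0]; first by rewrite invr0 mulr0.
rewrite ler_pdivrMr ?ltr0n // mul1r ler_nat.
rewrite -[in leqRHS](card_ord n) -card_draws; apply: subset_leq_card.
by apply/fintype.subsetP => S; rewrite !inE => /andP[].
Qed.

Lemma Pr_inj_dens I P :
  Pr R (fun t : {ffun I -> 'I_n} => injectiveb t && P (t @: [set: I]%SET)) =
  dens R #|I| P * Pr R (fun t : {ffun I -> 'I_n} => injectiveb t).
Proof.
rewrite !PrE card_inj_image card_inj_ffuns card_ord mulrA; congr (_ / _).
rewrite /dens -bin_ffact natrM [in RHS]natrM.
(* For [n < #|I|] both sides vanish: there is no set of this size, and division by 0 gives 0. *)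
case: (posnP 'C(n, #|I|)) => [C0|C0].
  rewrite C0 invr0 !mulr0 mul0r -natrM.
  apply/eqP; rewrite pnatr_eq0 muln_eq0; apply/orP; right.
  rewrite -leqn0 -C0 -[in leqRHS](card_ord n) -card_draws; apply: subset_leq_card.
  by apply/fintype.subsetP => S; rewrite !inE => /andP[].
by rewrite mulrA divfK ?pnatr_eq0 -?lt0n // mulrC.
Qed.

Hypothesis n0 : (0 < n)%N.
Let V0 : (0 < #|'I_n|)%N. Proof. by rewrite card_ord. Qed.

Lemma Pr_le_dens I (Q : {ffun I -> 'I_n} -> bool) (P : {set 'I_n} -> bool) :
  (forall t : {ffun I -> 'I_n}, injectiveb t -> Q t -> P (t @: [set: I]%SET)) ->
  Pr R Q <= dens R #|I| P + (#|I| ^ 2)%:R / n%:R.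
Proof.
move=> QP; apply: le_trans (_ : Pr R (fun t : {ffun I -> 'I_n} =>
  injectiveb t && P (t @: [set: I]%SET)) + Pr R (fun t : {ffun I -> 'I_n} => ~~ injectiveb t) <= _).
  apply: le_trans (Pr_union (Qs := [:: fun t : {ffun I -> 'I_n} =>
    injectiveb t && P (t @: [set: I]%SET); fun t : {ffun I -> 'I_n} => ~~ injectiveb t]) _ _) _.
    by move=> t Qt /=; case it: (injectiveb t) => //=; rewrite QP.
  by rewrite !big_cons big_nil addr0.
apply: lerD; last by rewrite -[in leRHS](card_ord n); apply: Pr_not_inj.
by rewrite Pr_inj_dens ler_piMr ?dens_ge0 ?Pr_le1.
Qed.

Lemma dens_le_Pr I (Q : {ffun I -> 'I_n} -> bool) (P : {set 'I_n} -> bool) :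
  (forall t : {ffun I -> 'I_n}, injectiveb t -> P (t @: [set: I]%SET) -> Q t) ->
  dens R #|I| P <= Pr R Q + (#|I| ^ 2)%:R / n%:R.
Proof.
move=> PQ.
have H1 := Pr_inj_dens I P.
have H2 : Pr R (fun t : {ffun I -> 'I_n} => injectiveb t && P (t @: [set: I]%SET)) <= Pr R Q.
  by apply: Pr_mono => t /andP[]; apply: PQ.
have H3 : Pr R (fun t : {ffun I -> 'I_n} => ~~ injectiveb t) <= (#|I| ^ 2)%:R / n%:R.
  by rewrite -[in leRHS](card_ord n); apply: Pr_not_inj.
have H4 : Pr R (fun t : {ffun I -> 'I_n} => ~~ injectiveb t) =
  1 - Pr R (fun t : {ffun I -> 'I_n} => injectiveb t).
  by apply: Pr_compl; rewrite card_ffun expn_gt0 V0.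
have d0 := dens_ge0 #|I| P; have d1 := dens_le1 #|I| P.
have n1 := Pr_ge0 R (fun t : {ffun I -> 'I_n} => ~~ injectiveb t).
rewrite H1 in H2; apply: le_trans (lerD H2 H3); rewrite H4 in n1 *.
set p := Pr R _ in n1 *; set d := dens _ _ _ in d0 d1 *; nra.
Qed.

Lemma mono_tri_ffun (t : {ffun 'I_3 -> 'I_n}) : injectiveb t ->
  mono_tri G (t @: [set: 'I_3]%SET) = mono3 (col G) (t o0) (t o1) (t o2).
Proof.
move=> /injectiveP it; rewrite /mono_tri card_imset // cardsT card_ord eqxx /=.
have ne i j : i != j -> t i != t j by apply: contra => /eqP/it->.
apply/idP/idP.
  move=> /forall_inP H.
  have {}H i j i' j' : i != j -> i' != j' -> col G (t i) (t j) == col G (t i') (t j').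
    move=> ij ij'; have /forall_inP/(_ (t j) (imset_f _ _))/forall_inP := H (t i) (imset_f _ (finset.in_setT i)).
    move=> /(_ (finset.in_setT _) (t i') (imset_f _ (finset.in_setT i')))/forall_inP/(_ (t j') (imset_f _ (finset.in_setT j'))).
    by rewrite !ne.
  by rewrite /mono3 !H.
move=> /andP[/eqP h1 /eqP h2].
have H i j : i != j -> col G (t i) (t j) = col G (t o0) (t o1).
  move: i j; apply: ord3P; apply: ord3P => // _;
    by rewrite 1?col_sym -?h1 -?h2 // col_sym.
apply/forall_inP => u /imsetP[i _ ->]; apply/forall_inP => v /imsetP[j _ ->].
apply/forall_inP => u' /imsetP[i' _ ->]; apply/forall_inP => v' /imsetP[j' _ ->].
apply/implyP => ij; apply/implyP => ij'; rewrite !H //.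
  by apply: contra ij' => /eqP->.
by apply: contra ij => /eqP->.
Qed.

Let T := Pr3 R (mono3 (col G)).

Lemma mono_le_pK3 : T <= pK3 R G + 9 / n%:R.
Proof.
have := @Pr_le_dens 'I_3 (fun t => mono3 (col G) (t o0) (t o1) (t o2)) (mono_tri G).
rewrite Pr_ffun3 ?card_ord //; apply => t it; by rewrite mono_tri_ffun.
Qed.

Lemma pK3_le_mono : pK3 R G <= T + 9 / n%:R.
Proof.
have := @dens_le_Pr 'I_3 (fun t => mono3 (col G) (t o0) (t o1) (t o2)) (mono_tri G).
rewrite Pr_ffun3 ?card_ord //; apply => t it; by rewrite mono_tri_ffun.
Qed.

Lemma mono_tri_const (A : {set 'I_n}) a : #|A| = 3 ->
  {in A &, forall u v, u != v -> col G u v = a} -> mono_tri G A.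
Proof.
move=> cA H; rewrite /mono_tri cA eqxx /=.
apply/forall_inP => u uA; apply/forall_inP => v vA; apply/forall_inP => u' uA'.
by apply/forall_inP => v' vA'; apply/implyP => uv; apply/implyP => uv'; rewrite !H.
Qed.

Lemma mono_tri_set3 x y z : x != y -> y != z -> x != z ->
  mono3 (col G) x y z -> mono_tri G [set x; y; z].
Proof.
move=> xy yz xz /andP[/eqP h1 /eqP h2]; apply: (@mono_tri_const _ (col G x y)).
  by rewrite -finset.setUA cardsU1 cards2 yz !inE (negbTE xy) (negbTE xz).
move=> u v; rewrite !inE -!orbA => /or3P[] /eqP-> /or3P[] /eqP->;
  by rewrite ?eqxx // => _; rewrite 1?col_sym -?h1 -?h2 // col_sym.
Qed.

Lemma q31_le_pK31 : q31 R (col G) <= pK31 R G + 16 / n%:R.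
Proof.
have := @Pr_le_dens 'I_4 (fun t => k31 (col G) (t o0) (t o1) (t o2) (t o3)) (in_K31 G).
rewrite Pr_ffun4 ?card_ord //; apply => t /injectiveP it /andP[m K].
have ne i j : i != j -> t i != t j by apply: contra => /eqP/it->.
rewrite /in_K31 card_imset // cardsT card_ord eqxx /=.
apply/existsP; exists (t o0); apply/existsP; exists (t o1).
apply/existsP; exists (t o2); apply/existsP; exists (t o3).
rewrite mono_tri_set3 ?ne // K !inE !negb_or !ne // !andbT.
rewrite eqEcard; apply/andP; split; last first.
  rewrite card_imset // cardsT card_ord -!finset.setUA !cardsU1 cards1 !inE !negb_or.
  by rewrite !ne.
apply/fintype.subsetP => x /imsetP[[i lt] _ ->]; rewrite !inE.
have E (j : 'I_4) : i = j -> t (Ordinal lt) = t j by move=> ij; congr (t _); apply: val_inj.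
move: i lt E => [|[|[|[|//]]]] lt E.
- by rewrite (E o0) ?eqxx.
- by rewrite (E o1) ?eqxx ?orbT.
- by rewrite (E o2) ?eqxx ?orbT.
- by rewrite (E o3) ?eqxx ?orbT.
Qed.

Lemma q33_le_pK33 : q33 R (col G) <= pK33 R G + 36 / n%:R.
Proof.
have := @Pr_le_dens (bool * 'I_3)%type (@k33 c 'I_n (col G)) (in_K33 G).
rewrite card_prod card_bool card_ord; apply => t /injectiveP it.
move=> /existsP[a /existsP[b /existsP[d /and4P[ab ad bd /forallP H]]]].
have {}H p q : p != q -> col G (t p) (t q) = if p.1 != q.1 then d else if p.1 then a else b.
  by move=> pq; have /forallP/(_ q)/implyP/(_ pq)/eqP := H p.
pose A (e : bool) := [set t (e, i) | i in [set: 'I_3]%SET].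
have cA e : #|A e| = 3.
  by rewrite card_imset ?cardsT ?card_ord // => i j /it[].
have cS : #|t @: [set: bool * 'I_3]%SET| = 6.
  by rewrite card_imset // cardsT card_prod card_bool card_ord.
have memA e x : x \in A e -> exists i, x = t (e, i) by case/imsetP => i _ ->; exists i.
have AA : A true :|: A false = t @: [set: bool * 'I_3]%SET.
  apply/finset.setP => x; rewrite inE; apply/orP/imsetP => [[] /memA[i ->]|[[[] i] _ ->]].
  - by exists (true, i); rewrite ?inE.
  - by exists (false, i); rewrite ?inE.
  - by left; apply: imset_f; rewrite inE.
  - by right; apply: imset_f; rewrite inE.
have dis : [disjoint A true & A false].
  rewrite -finset.setI_eq0; apply/eqP/finset.setP => x; rewrite !inE; apply/negbTE/negP.
  by move=> /andP[/memA[i ->] /memA[j /it]].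
have AD : (t @: [set: bool * 'I_3]%SET) :\: A true = A false.
  by rewrite -AA finset.setDUl finset.setDv finset.set0U; apply/finset.setDidPl; rewrite disjoint_sym.
have colA e u v : u \in A e -> v \in A e -> u != v -> col G u v = if e then a else b.
  move=> /memA[i ->] /memA[j ->] ne; rewrite H ?eqxx //=.
  by apply: contra ne => /eqP->.
rewrite /in_K33 cS eqxx /=; apply/existsP; exists (A true).
apply/existsP; exists a; apply/existsP; exists b; apply/existsP; exists d.
rewrite AD ab ad bd -AA finset.subsetUl /=.
rewrite (@mono_tri_const _ a) //=; last by move=> u v uA vA; apply: (colA true).
rewrite (@mono_tri_const _ b) //=; last by move=> u v uA vA; apply: (colA false).
apply/and3P; split; apply/forall_inP => u uA; apply/forall_inP => v vA.
- by apply/implyP => uv; rewrite (colA true).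
- by apply/implyP => uv; rewrite (colA false).
- by have [i ->] := memA _ _ uA; have [j ->] := memA _ _ vA; rewrite H.
Qed.
End Densities.

(** * The exact inequality for all finite colorings *)

Local Open Scope classical_set_scope.
Local Open Scope ring_scope.

Section Pullback.
Variables (R : realFieldType) (W V : finType) (pi : W -> V).
Hypothesis V0 : (0 < #|V|)%N.
Hypothesis balanced : forall v, Pr R (fun w => pi w == v) = #|V|%:R^-1.

(** [pi] maps the uniform measure to the uniform measure, hence so does its action on tuples;
    expanding over the image tuple reduces this to single coordinates. *)
Lemma Ex_ffun_pullback (I : finType) (F : {ffun I -> V} -> R) :
  Ex (fun t : {ffun I -> W} => F [ffun i => pi (t i)]) = Ex F.
Proof.
transitivity (Ex (fun t : {ffun I -> W} =>
   \sum_s F s * \prod_i (pi (t i) == s i)%:R)).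
  apply: eq_Ex => t; rewrite (bigD1 [ffun i => pi (t i)]) //= [X in _ * X]big1; last first.
    by move=> i _; rewrite ffunE eqxx.
  rewrite mulr1 big1 ?addr0 // => s ne.
  have [i Hi] : exists i, pi (t i) != s i.
    apply/existsP; rewrite -[[exists _, _]]negbK negb_exists; apply: contra ne => /forallP H.
    by apply/eqP/ffunP => i; rewrite ffunE; apply/eqP; rewrite eq_sym -[_ == _]negbK.
  by rewrite (bigD1 i) //= (negbTE Hi) mul0r mulr0.
rewrite Ex_sum [RHS]/Ex mulr_suml; apply: eq_bigr => s _; rewrite ExZ; congr (_ * _).
rewrite (Ex_ffun_prod (fun i w => (pi w == s i)%:R)).
under eq_bigr do rewrite -/(Pr R _) balanced.
by rewrite prodr_const card_ffun natrX exprVn.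
Qed.

Variables (c : nat) (h : V -> V -> 'I_c).
Let h' x y := h (pi x) (pi y).

Lemma mono_pullback : Pr3 R (mono3 h') = Pr3 R (mono3 h).
Proof.
rewrite -!Pr_ffun3 /Pr -[RHS]Ex_ffun_pullback.
by apply: eq_Ex => t; rewrite !ffunE.
Qed.

Lemma q31_pullback : q31 R h' = q31 R h.
Proof.
rewrite /q31 -!Pr_ffun4 /Pr -[RHS]Ex_ffun_pullback.
by apply: eq_Ex => t; rewrite !ffunE.
Qed.

Lemma q33_pullback : q33 R h' = q33 R h.
Proof.
rewrite /q33 /Pr -[RHS]Ex_ffun_pullback; apply: eq_Ex => t; congr ((nat_of_bool _)%:R).
apply: eq_existsb => a; apply: eq_existsb => b; apply: eq_existsb => d.
congr [&& _, _, _ & _]; apply: eq_forallb => p; apply: eq_forallb => q.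
by rewrite !ffunE.
Qed.
End Pullback.

Definition mkcol n c (h : 'I_n -> 'I_n -> 'I_c) : coloring n c :=
  [ffun p => h p.1 p.2].

Lemma col_mkcol n c (h : 'I_n -> 'I_n -> 'I_c) : (forall x y, h x y = h y x) ->
  col (mkcol h) = h.
Proof.
move=> hC; apply/funext => u; apply/funext => v.
by rewrite /col /mkcol !ffunE /=; case: ifP.
Qed.

Section DensityInequality.
Variables (R : realType) (c : nat) (vs s : R).
Hypothesis s0 : 0 < s.
Hypothesis A2 : forall (k : nat -> nat) (G : forall m, coloring (k m) c),
  k @ \oo --> \oo ->
  0 <= limn_inf (fun m => pK3 R (G m) - vs - s * (pK31 R (G m) + pK33 R (G m))).

(** The bound [B] gives access to the limit inferior as a supremum of infima over tails, each of
    which is at most a term of the sequence. *)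
Lemma limn_inf_le (u : R ^nat) (B g : R) : (forall m, `|u m| <= B) ->
  (forall m, u m <= g) -> limn_inf u <= g.
Proof.
move=> uB ug; have bu : bounded_fun (u : (R^o) ^nat).
  exists B; split; first exact: num_real.
  by move=> x Bx m _; apply: le_trans (uB m) (ltW Bx).
rewrite limn_infE //; apply: ge_sup.
  by exists (infs u 0%N); exists 0%N.
move=> _ [n _ <-]; apply: le_trans (ug n).
apply: inf_lbound; last by exists n => /=.
by exists (- B) => _ [m _ <-]; have := uB m; rewrite ler_norml => /andP[].
Qed.

(* Blowing up does not change the densities over all tuples, so the error terms of
   [A2] vanish and the inequality holds for every single h. *)
Theorem blowup_inequality (V : finType) (h : V -> V -> 'I_c) :
  (forall x y, h x y = h y x) -> (0 < #|V|)%N ->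
  vs + s * (q31 R h + q33 R h) <= Pr3 R (mono3 h).
Proof.
move=> hC V0; have sp := s0; rewrite leNgt; apply/negP => lt.
pose g := vs + s * (q31 R h + q33 R h) - Pr3 R (mono3 h).
have g0 : 0 < g by rewrite subr_gt0.
(* A random tuple indexed by [I] has a repetition with probability at most [#|I| ^ 2 / n]: 9 for
   triangles, and [52 = 16 + 36] for the two families. *)
pose C := 9 + 52 * s.
have C0 : 0 < C by rewrite /C; lra.
(* Shifting the blow-up factor by [M0] makes the error at most [g / 2] for every [m], as
   [limn_inf_le] requires. *)
have [M0 HM0] : exists M0 : nat, 2 * C / g < M0.+1%:R.
  have H : 0 <= 2 * C / g by rewrite divr_ge0 ?mulr_ge0 // ltW.
  by exists (Num.bound (2 * C / g)); apply: lt_trans (archi_boundP H) _; rewrite ltr_nat.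
pose W m : finType := (V * 'I_(m + M0).+1)%type.
pose pi m (i : 'I_#|W m|) := (enum_val i).1.
have bal m v : Pr R (fun i => pi m i == v) = #|V|%:R^-1.
  rewrite -(Pr_eq1 R v) /Pr (Ex_enum_val (fun w : W m => (w.1 == v)%:R)) Ex_pair.
  by apply: eq_Ex => x /=; rewrite Ex_const // card_ord.
pose h' m x y := h (pi m x) (pi m y).
have h'C m x y : h' m x y = h' m y x by apply: hC.
pose G m := mkcol (h' m).
have kW m : #|W m| = (#|V| * (m + M0).+1)%N by rewrite card_prod card_ord.
have N0 m : (0 < #|W m|)%N by rewrite kW muln_gt0 V0.
have Gcol m : col (G m) = h' m by apply: col_mkcol.
have k_cvg : (fun m => #|W m|) @ \oo --> \oo.
  apply/cvgnyPge => A; near=> m; rewrite kW.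
  apply: leq_trans (_ : m <= _)%N; first by near: m; exact: nbhs_infty_ge.
  by apply: leq_trans (leq_pmull _ V0); rewrite -addnS leq_addr.
have := A2 G k_cvg; apply/negP; rewrite -ltNge.
apply: le_lt_trans (_ : - (g / 2) < _); last by rewrite oppr_lt0 divr_gt0.
apply: (@limn_inf_le _ (1 + `|vs| + 2 * s)) => m.
  have := dens_ge0 R (n := #|W m|) 3 (mono_tri (G m)).
  have := dens_le1 R (n := #|W m|) 3 (mono_tri (G m)).
  have := dens_ge0 R (n := #|W m|) 4 (in_K31 (G m)).
  have := dens_le1 R (n := #|W m|) 4 (in_K31 (G m)).
  have := dens_ge0 R (n := #|W m|) 6 (in_K33 (G m)).
  have := dens_le1 R (n := #|W m|) 6 (in_K33 (G m)).
  rewrite -/(pK3 _ _) -/(pK31 _ _) -/(pK33 _ _) => a1 a2 a3 a4 a5 a6.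
  have [v1 v2] : vs <= `|vs| /\ - vs <= `|vs| by rewrite ler_norm -normrN ler_norm.
  rewrite ler_norml; apply/andP; split; nra.
have E1 := @pK3_le_mono R _ _ (G m) (N0 m).
have E2 := @q31_le_pK31 R _ _ (G m) (N0 m).
have E3 := @q33_le_pK33 R _ _ (G m) (N0 m).
rewrite Gcol mono_pullback // in E1.
rewrite Gcol q31_pullback // in E2.
rewrite Gcol q33_pullback // in E3.
set x := #|W m|%:R^-1 in E1 E2 E3.
have x0 : 0 < x by rewrite invr_gt0 ltr0n.
have xC : C * x <= g / 2.
  rewrite /x ler_pdivrMr ?ltr0n // ltW //.
  have : 2 * C / g < #|W m|%:R.
    apply: lt_le_trans HM0 _; rewrite ler_nat kW.
    by apply: leq_trans (leq_pmull _ V0); rewrite ltnS leq_addl.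
  by rewrite ltr_pdivrMr // => H; lra.
have E23 : s * (q31 R h + q33 R h) <= s * (pK31 R (G m) + pK33 R (G m) + 52 * x).
  by rewrite ler_pM2l //; lra.
rewrite /C mulrDl in xC; rewrite /g in xC *.
rewrite !mulrDr in E23 *; lra.
Unshelve. all: by end_near.
Qed.
End DensityInequality.

(** * The minimum density and its monotonicity in n *)

Definition num_mono n c (G : coloring n c) : nat := #|[set S : {set 'I_n} | mono_tri G S]%SET|.

Lemma pK3E (R : realType) n c (G : coloring n c) :
  pK3 R G = (num_mono G)%:R / 'C(n, 3)%:R.
Proof.
congr (_%:R / _); apply: eq_card => S; rewrite !inE.
by rewrite andb_idl // => /andP[].
Qed.

Section Minimum.
Variables (R : realType) (c : nat).
Hypothesis c0 : (0 < c)%N.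

Lemma mc3n_le n (G : coloring n c) : mc3n R c n <= pK3 R G.
Proof. exact: bigmin_le. Qed.

Lemma mc3n_attained n : exists G : coloring n c, pK3 R G = mc3n R c n.
Proof.
pose G0 : coloring n c := [ffun=> Ordinal c0].
rewrite /mc3n (bigmin_eq_arg _ G0) //; first by eexists; reflexivity.
by move=> G _; apply: dens_le1.
Qed.

Lemma mc3n_ge0 n : 0 <= mc3n R c n.
Proof. by have [G <-] := mc3n_attained n; apply: dens_ge0. Qed.

Lemma mc3n_le1 n : mc3n R c n <= 1.
Proof. by have [G <-] := mc3n_attained n; apply: dens_le1. Qed.

Definition delete_vertex n (G : coloring n.+1 c) (v : 'I_n.+1) : coloring n c :=
  mkcol (fun x y => col G (lift v x) (lift v y)).

Lemma mono_tri_delete n (G : coloring n.+1 c) v S :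
  mono_tri (delete_vertex G v) S -> mono_tri G (lift v @: S).
Proof.
rewrite /mono_tri (card_imset _ (@lift_inj _ v)) => /andP[-> /= /forall_inP H].
have E : col (delete_vertex G v) = fun x y => col G (lift v x) (lift v y).
  by apply: col_mkcol => x y; apply: col_sym.
apply/forall_inP => _ /imsetP[u uS ->]; apply/forall_inP => _ /imsetP[w wS ->].
apply/forall_inP => _ /imsetP[u' u'S ->]; apply/forall_inP => _ /imsetP[w' w'S ->].
have /forall_inP/(_ w wS)/forall_inP/(_ u' u'S)/forall_inP/(_ w' w'S) := H u uS.
by rewrite !(inj_eq (@lift_inj _ v)) E.
Qed.

(** A triangle survives the deletion of each of the [n.+1 - 3] vertices outside it. *)
Lemma num_mono_delete n (G : coloring n.+1 c) :
  (\sum_v num_mono (delete_vertex G v) <= (n.+1 - 3) * num_mono G)%N.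
Proof.
apply: (@leq_trans (\sum_v #|[set S : {set 'I_n.+1} | mono_tri G S && (v \notin S)]%SET|)).
  apply: leq_sum => v _; rewrite /num_mono -(card_imset _ (imset_inj (@lift_inj _ v))).
  apply: subset_leq_card; apply/fintype.subsetP => S' /imsetP[S]; rewrite inE => mS ->.
  rewrite inE mono_tri_delete //=; apply/negP => /imsetP[x _ /eqP].
  by rewrite (negbTE (neq_lift v x)).
rewrite mulnC -sum_nat_const /=.
under eq_bigr do rewrite -sum1_card big_mkcond /=.
rewrite exchange_big /= [leqRHS]big_mkcond /=; apply: leq_sum => S _.
rewrite inE; case mS: (mono_tri G S); last first.
  by rewrite big1 // => v _; rewrite inE mS.
have /andP[/eqP cS _] := mS.
rewrite -[in leqRHS](card_ord n.+1) -cS -(cardsC S) addKn -sum1_card [leqRHS]big_mkcond /=.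
by apply: leq_sum => v _; rewrite !inE mS.
Qed.

(** Average the densities of the vertex-deleted colorings of a minimizer. For [n < 3] the density is
    0, since ['C(n, 3) = 0]. *)
Lemma mc3nS n : mc3n R c n <= mc3n R c n.+1.
Proof.
case: (leqP 3 n) => n3; last first.
  have [G0 <-] := mc3n_attained n; rewrite pK3E bin_small // invr0 mulr0.
  exact: mc3n_ge0.
have [G <-] := mc3n_attained n.+1.
rewrite pK3E ler_pdivlMr ?ltr0n ?bin_gt0 ?(leq_trans n3) //.
have B : ((n.+1 - 3) * 'C(n.+1, 3) = n.+1 * 'C(n, 3))%N.
  by rewrite -mul_bin_down.
have n2 : (0 < n.+1 - 3)%N by lia.
rewrite -(ler_pM2l (_ : 0 < (n.+1 - 3)%:R)) ?ltr0n // mulrCA -natrM B natrM.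
rewrite -natrM; apply: le_trans (_ : (\sum_v num_mono (delete_vertex G v))%:R <= _); last first.
  by rewrite -natrM ler_nat num_mono_delete.
rewrite natr_sum.
apply: le_trans (_ : \sum_(v < n.+1) mc3n R c n * 'C(n, 3)%:R <= _).
  by rewrite sumr_const card_ord -[X in _ <= X]mulr_natl natrM; lra.
apply: ler_sum => v _; have := mc3n_le (delete_vertex G v).
by rewrite pK3E ler_pdivlMr // ltr0n bin_gt0.
Qed.

Lemma mc3n_le_lim n : mc3n R c n <= limn (fun n => mc3n R c n).
Proof.
have mono : {homo (fun n => mc3n R c n) : n m / (n <= m)%N >-> n <= m}.
  by apply: homo_leq => //; [exact: le_trans | exact: mc3nS].
apply: (nondecreasing_cvgn_le mono).
have ub : has_ubound (range (fun n => mc3n R c n)).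
  by exists 1 => _ [m _ <-]; apply: mc3n_le1.
by apply/cvg_ex; exists (sup (range (fun n => mc3n R c n))); exact: nondecreasing_cvgn.
Qed.
End Minimum.

(** * The Ramsey number: extremal looped colorings and positivity of the density *)

Section RamseyNumber.
Variables (c RR : nat).
Hypotheses (c2 : (2 <= c)%N) (HR : is_R3 c.-1 RR).

Lemma RR_ge3 : (3 <= RR)%N.
Proof.
have c1 : (0 < c.-1)%N by case: c c2 => [|[]].
have [S /andP[/eqP <- _]] := HR.1 [ffun=> Ordinal c1].
by rewrite -[leqRHS](card_ord RR) max_card.
Qed.

(** [unlift a] identifies the colors other than [a] with ['I_c.-1]; the default color occurs only on
    the diagonal. *)
Lemma ramsey_free_RR : ramsey_free c RR.
Proof.
move=> a g gC ga.
have c1 : (0 < c.-1)%N by case: c c2 => [|[]].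
pose g' x y := odflt (Ordinal c1) (unlift a (g x y)).
have g'C x y : g' x y = g' y x by rewrite /g' gC.
have [S mS] := HR.1 (mkcol g').
have /andP[/eqP cS H] := mS; rewrite col_mkcol // in H.
have [x [y [z [[xS yS zS] [xy yz zx]]]]] : exists x y z : 'I_RR,
    [/\ x \in S, y \in S & z \in S] /\ [/\ x != y, y != z & z != x].
  by apply/card_gt2P; rewrite cS.
have xz : x != z by rewrite eq_sym.
have {}H u v u' v' : u \in S -> v \in S -> u' \in S -> v' \in S -> u != v -> u' != v' ->
    g u v = g u' v'.
  move=> uS vS u'S v'S uv uv'.
  have /forall_inP/(_ u uS)/forall_inP/(_ v vS)/forall_inP/(_ u' u'S)/forall_inP/(_ v' v'S) := H.
  rewrite uv uv' /= /g'.
  case: unliftP (ga u v uv) => [i ->|->]; last by rewrite eqxx.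
  case: unliftP (ga u' v' uv') => [j ->|->]; last by rewrite eqxx.
  by move=> _ _ /eqP /= ->.
by exists x, y, z; split=> //; split; apply: H.
Qed.

(** Minimality of [RR] gives a coloring of [RR.-1] vertices with [c.-1] colors and no monochromatic
    triangle; [lift a] embeds its colors. *)
Lemma looped_ex_exists (a : 'I_c) : exists E : 'I_RR.-1 -> 'I_RR.-1 -> 'I_c, looped_ex a E.
Proof.
have [G noG] : exists G : coloring RR.-1 c.-1, forall S, ~ mono_tri G S.
  apply: contrapT => no; have : ramsey_tri c.-1 RR.-1.
    move=> G; apply: contrapT => noS; apply: no; exists G => S mS.
    by apply: noS; exists S.
  by move/(HR.2); have := RR_ge3; lia.
pose E i j := if i == j then a else lift a (col G i j).
exists E; split=> [i|i j|i j ij|i j k ij jk ik].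
- by rewrite /E eqxx.
- by rewrite /E eq_sym col_sym.
- by rewrite /E (negbTE ij) eq_sym neq_lift.
rewrite /E (negbTE ij) (negbTE jk) (negbTE ik) => -[/lift_inj E1 /lift_inj E2].
apply: (noG [set i; j; k]%SET); apply: mono_tri_set3 => //.
by rewrite /mono3 E1 E2 eqxx.
Qed.

(** Among the [c * RR + 1] neighbors of a vertex, some [RR] are joined to it in one color [a]. They
    span an edge of color [a], or else only [c.-1] colors occur among them. *)
Lemma ramsey_all_colors (G : coloring (c * RR).+2 c) : exists S, mono_tri G S.
Proof.
pose v : 'I_(c * RR).+2 := ord0.
pose N a := [set i : 'I_(c * RR).+1 | col G v (lift v i) == a]%SET.
have [a Na] : exists a, (RR <= #|N a|)%N.
  case: (pickP (fun a => (RR <= #|N a|)%N)) => [a ?|no]; first by exists a.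
  suff : (#|'I_(c * RR).+1| <= c * RR)%N by rewrite card_ord ltnn.
  apply: (@leq_trans (\sum_(a < c) #|N a|)).
    rewrite -sum1_card (partition_big (fun i => col G v (lift v i)) xpredT) //=.
    apply: leq_sum => a _; rewrite sum1_card; apply: subset_leq_card.
    by apply/fintype.subsetP => i Hi; rewrite inE; exact: Hi.
  rewrite -[X in (_ <= X * _)%N](card_ord c) -sum_nat_const; apply: leq_sum => a _.
  by rewrite ltnW // ltnNge no.
pose w (i : 'I_RR) := lift v (enum_val (widen_ord Na i)).
have winj i j : i != j -> w i != w j.
  by apply: contra => /eqP/lift_inj/enum_val_inj/eqP; rewrite -val_eqE /= => ?; apply/eqP/val_inj/eqP.
have vw i : v != w i by apply: neq_lift.
have wv i : w i != v by rewrite eq_sym.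
have wa i : col G v (w i) = a by have := enum_valP (widen_ord Na i); rewrite inE => /eqP.
case: (pickP (fun ij : 'I_RR * 'I_RR => (ij.1 != ij.2) && (col G (w ij.1) (w ij.2) == a))).
  move=> [i j] /= /andP[ij /eqP E]; exists [set v; w i; w j]%SET; apply: mono_tri_set3 => //.
    exact: winj.
  by rewrite /mono3 !wa E eqxx.
move=> no.
have [||x [y [z [xy yz xz [E1 E2]]]]] := ramsey_free_RR (a := a) (g := fun x y => col G (w x) (w y)).
- by move=> x y; rewrite col_sym.
- by move=> x y xy; have := no (x, y); rewrite /= xy => /negbT.
exists [set w x; w y; w z]%SET; apply: mono_tri_set3; rewrite ?winj //.
by rewrite /mono3 E1 E2 eqxx.
Qed.

Lemma mc3n_pos (R : realType) : 0 < mc3n R c (c * RR).+2.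
Proof.
have [|G <-] := @mc3n_attained R c _ (c * RR).+2; first by lia.
have [S mS] := ramsey_all_colors G.
rewrite pK3E divr_gt0 // ltr0n ?bin_gt0.
  by apply/card_gt0P; exists S; rewrite inE.
by have := RR_ge3; have := c2; nia.
Qed.
End RamseyNumber.

(** * Between colorings of ['I_n] and symmetric functions *)

Lemma mono_tri_set3P n c (G : coloring n c) (S : {set 'I_n}) : mono_tri G S ->
  exists x y z, S = [set x; y; z]%SET /\ tri (col G) x y z.
Proof.
move=> mS; have /andP[/eqP cS /forall_inP H] := mS.
have [x [y [z [[xS yS zS] [xy yz zx]]]]] : exists x y z : 'I_n,
    [/\ x \in S, y \in S & z \in S] /\ [/\ x != y, y != z & z != x].
  by apply/card_gt2P; rewrite cS.
have xz : x != z by rewrite eq_sym.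
exists x, y, z; split.
  apply/esym/eqP; rewrite eqEcard cS; apply/andP; split.
    by apply/fintype.subsetP => w; rewrite !inE -!orbA => /or3P[] /eqP->.
  by rewrite -finset.setUA cardsU1 cards2 yz !inE (negbTE xy) (negbTE xz).
have {}H u v u' v' : u \in S -> v \in S -> u' \in S -> v' \in S -> u != v -> u' != v' ->
    col G u v = col G u' v'.
  move=> uS vS u'S v'S uv uv'.
  have /forall_inP/(_ v vS)/forall_inP/(_ u' u'S)/forall_inP/(_ v' v'S) := H u uS.
  by rewrite uv uv' /= => /eqP.
by rewrite /tri xy yz xz /mono3 (H x y x z) // -(H x y x z) // (H x y y z) // eqxx.
Qed.

Section Coloring.
Variables (R : realType) (n c : nat).
Hypothesis n0 : (0 < n)%N.

Lemma tri_count_pK3 (G : coloring n c) : (tri_count (col G))%:R =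
  n%:R ^+ 3 * (pK3 R G * Pr R (fun t : {ffun 'I_3 -> 'I_n} => injectiveb t)).
Proof.
have V0 : (0 < #|'I_n|)%N by rewrite card_ord.
have n1 : n%:R != 0 :> R by rewrite pnatr_eq0 -lt0n.
rewrite /pK3 -[X in dens R X]card_ord -Pr_inj_dens.
have -> : Pr R (fun t : {ffun 'I_3 -> 'I_n} => injectiveb t && mono_tri G (t @: [set: 'I_3]%SET)) =
    Pr3 R (tri (col G)).
  rewrite -Pr_ffun3; apply: eq_Ex => t; congr ((nat_of_bool _)%:R); rewrite /tri.
  case it: (injectiveb t) => /=.
    have /injectiveP it' := it; rewrite mono_tri_ffun // !(inj_eq it').
    by rewrite -!val_eqE.
  apply/esym/negP => /and4P[xy yz xz _]; case/negP: (negbT it); apply/injectiveP.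
  by apply: ord3P; apply: ord3P => // e; exfalso; move: xy yz xz; rewrite e eqxx.
have nEx (F : 'I_n -> R) : n%:R * Ex F = \sum_x F x by rewrite /Ex card_ord mulrC divfK.
rewrite exprSr -mulrA nEx natr_sum mulr_sumr; apply: eq_bigr => x _.
rewrite exprSr expr1 -mulrA nEx natr_sum mulr_sumr; apply: eq_bigr => y _.
by rewrite nEx natr_sum.
Qed.

Lemma minimal_col (G : coloring n c) : pK3 R G <= mc3n R c n -> minimal (col G).
Proof.
move=> Gm h' h'C; rewrite -(ler_nat R) -(col_mkcol h'C) !tri_count_pK3.
rewrite ler_wpM2l ?exprn_ge0 // ler_wpM2r ?Pr_ge0 //.
by apply: le_trans Gm _; apply: bigmin_le.
Qed.
End Coloring.

Section FromStructure.
Variables (R : realType) (n c r : nat) (a : 'I_c) (E : 'I_r -> 'I_r -> 'I_c) (psi : 'I_n -> 'I_r).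
Hypothesis LE : looped_ex a E.

Lemma in_Lex_looped_ex : in_Lex a E.
Proof.
have [EE EC Ea Et] := LE.
have lE u v : lcol E u v = E u v by rewrite /lcol; case: ifP => // _; rewrite EC.
split; first by move=> u; rewrite lE EE.
split; first by move=> u v uv; rewrite lE; exact: Ea.
move=> u v w uv vw uw; rewrite !lE.
exact: Et.
Qed.

Lemma in_Gex_of_structure (H : coloring n c) :
  (forall i, `|#|class psi i|%:R - n%:R / r%:R| <= 1 :> R) ->
  (forall u v, u != v -> col H u v = E (psi u) (psi v) \/ col H u v = a) ->
  (forall x y z, tri (col H) x y z -> tri (blow E psi) x y z) ->
  in_Gex R r H.
Proof.
move=> size edges tris; have [EE EC Ea Et] := LE.
exists a, E, psi, (mkcol (blow E psi)); rewrite (col_mkcol (blow_sym LE psi)).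
split; first exact: in_Lex_looped_ex.
split; first by move=> u v _; rewrite /lcol /blow; case: ifP => // _; rewrite EC.
split=> //; split=> // S /mono_tri_set3P[x [y [z [-> /tris]]]].
by case/and4P => xy yz xz m; apply: mono_tri_set3 => //; rewrite col_mkcol //; apply: blow_sym LE psi.
Qed.
End FromStructure.

(** At most one of the two truncated differences is nonzero, and it is at most the distance of the
    class size from [#|V| / r], which lies between the floor and its successor. *)
Lemma imbalance_le (R : realFieldType) (r : nat) (V : finType) (phi : V -> 'I_r) (e : R) :
  (0 < #|V|)%N ->
  (forall i, `|Pr R (fun u => phi u == i) - r%:R^-1| <= e) ->
  (imbalance phi)%:R <= #|V|%:R * (r%:R * e).
Proof.
move=> V0 H; have n0 : 0 < #|V|%:R :> R by rewrite ltr0n.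
have rp : (0 < r)%N.
  by have [v _] := card_gt0P V0; apply: leq_ltn_trans (ltn_ord (phi v)).
have r0 : 0 < r%:R :> R by rewrite ltr0n.
rewrite natr_sum; apply: le_trans (_ : \sum_(i < r) #|V|%:R * e <= _); last first.
  by rewrite sumr_const card_ord -[leLHS]mulr_natl mulrCA.
apply: ler_sum => i _; apply: le_trans (_ : #|V|%:R * `|Pr R (fun u => phi u == i) - r%:R^-1| <= _); last first.
  by rewrite ler_pM2l.
rewrite -[X in X * _](ger0_norm (ltW n0)) -normrM mulrBr PrE [#|V|%:R * (_ / _)]mulrC divfK ?gt_eqF //.
rewrite -/(class phi i); set t := (#|V| %/ r)%N; set k := #|class phi i|.
have t1 : t%:R <= #|V|%:R / r%:R :> R.
  by rewrite ler_pdivlMr // -natrM ler_nat leq_trunc_div.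
have t2 : #|V|%:R / r%:R <= t.+1%:R :> R.
  by rewrite ler_pdivrMr // -natrM ler_nat ltnW // ltn_ceil.
case: (leqP k t) => kt.
  rewrite (_ : (k - t.+1 + (t - k) = t - k)%N); last by lia.
  by rewrite distrC natrB // ler_normr lerB.
rewrite (_ : (k - t.+1 + (t - k) = k - t.+1)%N); last by lia.
by rewrite natrB // ler_normr lerB.
Qed.

Lemma sqr_le_bin2 n : (2 <= n)%N -> (n ^ 2 <= 4 * 'C(n, 2))%N.
Proof.
move=> n2; have := mul_bin_diag n 1; rewrite bin1.
have E : (n ^ 2 = n * n.-1 + n)%N by rewrite -mulnSr prednK // ltnW.
have : (n <= n * n.-1)%N by rewrite leq_pmulr // -ltnS prednK // ltnW.
lia.
Qed.

Theorem theorem5p1 (R : realType) (c : nat) (vs : R) (RR : nat) :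
  (2 <= c)%N ->
  is_R3 c.-1 RR ->
  (* (A1) *)
  vs = limn (fun n => mc3n R c n) ->
  (* (A2) *)
  (exists s : R, 0 < s /\
     forall (k : nat -> nat) (G : forall m, coloring (k m) c),
       k @ \oo --> \oo ->
       0 <= limn_inf (fun m => pK3 R (G m) - vs
                                - s * (pK31 R (G m) + pK33 R (G m)))) ->
  vs = ((RR.-1)%:R ^+ 2)^-1 /\
  exists n0 : nat, forall eps : R, 0 < eps -> exists delta : R, 0 < delta /\
    forall (n : nat) (G : coloring n c), (n0 <= n)%N ->
      pK3 R G <= mc3n R c n + delta ->
      exists H : coloring n c, in_Gex R RR.-1 H /\
        (cdist G H)%:R <= eps * ('C(n, 2))%:R.
Proof.
move=> c2 HR vsL [s [s0 A2]].
have c0 : (0 < c)%N by apply: ltnW.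
have RR3 := RR_ge3 c2 HR.
have r2 : (2 <= RR.-1)%N by case: (RR) RR3.
have ram : ramsey_free c RR.-1.+1 by rewrite prednK ?(ltnW (ltnW RR3)) //; apply: ramsey_free_RR.
have lex : exists (a : 'I_c) (E : 'I_RR.-1 -> 'I_RR.-1 -> 'I_c), looped_ex a E.
  by exists (Ordinal c0); apply: looped_ex_exists.
have mle n : mc3n R c n <= vs by rewrite vsL; apply: mc3n_le_lim.
have vs0 : 0 < vs by apply: lt_le_trans (mc3n_pos c2 HR R) (mle _).
have ineq := blowup_inequality s0 A2.
have unbounded (x : R) : exists n : nat, x < n%:R.
  exists (Num.bound `|x|); apply: le_lt_trans (ler_norm x) _.
  by apply: archi_boundP; apply: normr_ge0.
have monoB n (G : coloring n c) d : (0 < n)%N -> pK3 R G <= mc3n R c n + d ->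
    Pr3 R (mono3 (col G)) <= vs + d + 9 / n%:R.
  move=> n0 HG; apply: le_trans (mono_le_pK3 R G n0) _; rewrite lerD2r.
  by apply: le_trans HG _; rewrite lerD2r.
have tight d : 0 < d -> exists (V : finType) (h : V -> V -> 'I_c),
    [/\ forall x y, h x y = h y x, (0 < #|V|)%N & Pr3 R (mono3 h) <= vs + d].
  move=> d0; have [n1 Hn1] := div_small unbounded 9 d0.
  have [G HG] := mc3n_attained R c0 n1.+1.
  exists 'I_n1.+1, (col G); split; [exact: col_sym | by rewrite card_ord |].
  have := @monoB n1.+1 G 0 isT; rewrite addr0 HG => /(_ (lexx _)) H.
  by apply: le_trans H _; rewrite addr0 lerD2l Hn1.
have vq := vsE r2 ram lex vs0 s0 ineq tight.
split=> //.
have [N0 HN0] := exact_structure r2 ram lex vs0 s0 ineq tight unbounded.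
(* This threshold is independent of [eps]; the 3 makes ['C(n, 3)] positive. *)
exists (maxn 3 N0) => eps eps0.
set r := RR.-1 in r2 ram lex vq HN0 *.
(* The wrong pairs amount to [e1] from stability and [r * e1] for each end moved by rebalancing; the
   4 comes from [n ^ 2 <= 4 * 'C(n, 2)]. *)
pose e1 := eps / (4 * (1 + 2 * r%:R)).
have e10 : 0 < e1 by rewrite divr_gt0 // mulr_gt0 // ltr_pwDl.
have [d1 d10 Hd1] := stability r2 ram lex vs0 s0 ineq tight e10.
have d2 : 0 < d1 / 2 by rewrite divr_gt0.
have [n1 Hn1] := div_small unbounded 9 d2.
pose d := Num.min (d1 / 2) ('C(n1, 3).+1%:R^-1).
exists d; split; first by rewrite lt_min d2 invr_gt0 ltr0n.
move=> n G; rewrite geq_max => /andP[n3 nN0] HG.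
have n0 : (0 < n)%N by apply: leq_trans n3.
have V0 : (0 < #|'I_n|)%N by rewrite card_ord.
have np : 0 < n%:R :> R by rewrite ltr0n.
have dd1 : d <= d1 / 2 by rewrite ge_min lexx.
(* Below n1 the densities are multiples of 1 / 'C(n, 3), so d leaves only exact minimizers. *)
case: (leqP n1 n) => n1n; last first.
  have Gm : pK3 R G <= mc3n R c n.
    have [G0 HG0] := mc3n_attained R c0 n; rewrite -HG0 in HG *.
    have C0 : 0 < 'C(n, 3)%:R :> R by rewrite ltr0n bin_gt0.
    move: HG; rewrite !pK3E -(ler_pM2r C0) mulrDl !divfK ?gt_eqF // => HG.
    rewrite ler_pM2r ?invr_gt0 // ler_nat leqNgt; apply/negP => lt.
    have : (num_mono G0).+1%:R <= (num_mono G0)%:R + d * 'C(n, 3)%:R.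
      by apply: le_trans HG; rewrite ler_nat.
    rewrite -natr1 lerD2l leNgt => /negP; apply.
    apply: le_lt_trans (_ : 'C(n1, 3).+1%:R^-1 * 'C(n, 3)%:R < _).
      by rewrite ler_pM2r // ge_min lexx orbT.
    rewrite mulrC ltr_pdivrMr // mul1r ltr_nat ltnS.
    by apply: leq_bin2l; apply: ltnW.
  have TB : Pr3 R (mono3 (col G)) <= vs + 9 / #|'I_n|%:R.
    by rewrite card_ord; have := @monoB n G 0 n0; rewrite !addr0; apply.
  have nN0' : (N0 <= #|'I_n|)%N by rewrite card_ord.
  have [a [E [psi [LE edges tris size]]]] :=
    HN0 _ (col G) (@col_sym n c G) V0 nN0' (minimal_col n0 Gm) TB.
  (* An exact minimizer already belongs to the extremal class, so nothing is recolored. *)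
  exists G; split.
    apply: (in_Gex_of_structure LE) edges _; first by move=> i; have := size i; rewrite card_ord.
    by move=> x y z; rewrite tris.
  rewrite /cdist (eq_card0 (A := [set p | _]%SET)); last first.
    by move=> p; rewrite !inE eqxx andbF.
  by rewrite mulr_ge0 // ltW.
have TB : Pr3 R (mono3 (col G)) <= vs + d1.
  apply: le_trans (monoB n G d n0 HG) _; rewrite -addrA lerD2l.
  by apply: le_trans (lerD dd1 (Hn1 _ n0 n1n)) _; rewrite -splitr.
have [a [E [phi [LE bad size]]]] := Hd1 _ (col G) (@col_sym n c G) V0 TB.
have [psi [bal dist]] := rebalance phi.
have bC := blow_sym LE psi.
(* Here the balanced blow-up itself is the target, without any edge recolored to the loop color. *)
exists (mkcol (blow E psi)); split.
  apply: (in_Gex_of_structure LE (psi := psi)); rewrite ?col_mkcol //.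
    by move=> i; have := balanced_size R bal i; rewrite card_ord.
  by move=> u v _; left.
have P1 : Pr R (fun x => phi x != psi x) <= r%:R * e1.
  rewrite PrE ler_pdivrMr ?card_ord // mulrC; apply: le_trans (_ : (imbalance phi)%:R <= _).
    by rewrite ler_nat.
  by have := imbalance_le V0 size; rewrite card_ord.
have P2 : Pr2 R (fun u v => col G u v != blow E psi u v) <= (1 + 2 * r%:R) * e1.
  apply: le_trans (Pr2_union (Qs := [:: fun u v => col G u v != E (phi u) (phi v);
    fun u v => phi u != psi u; fun u v => phi v != psi v]) _ _) _.
    move=> u v; rewrite /= orbF /blow.
    case: (eqVneq (phi u) (psi u)) => [->|]; last by rewrite orbT.
    by case: (eqVneq (phi v) (psi v)) => [->|]; rewrite ?orbF ?orbT.
  rewrite !big_cons big_nil addr0 (Pr2_1 _ V0) (Pr2_2 _ V0).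
  apply: le_trans (lerD bad (lerD P1 P1)) _.
  by rewrite [leRHS](_ : _ = e1 + (r%:R * e1 + r%:R * e1)) //; ring.
have n2E : n%:R ^+ 2 * Pr2 R (fun u v => col G u v != blow E psi u v) =
    (\sum_u \sum_v (col G u v != blow E psi u v))%:R.
  have nEx (F : 'I_n -> R) : n%:R * Ex F = \sum_x F x.
    by rewrite /Ex card_ord mulrC divfK // gt_eqF.
  rewrite exprSr expr1 -mulrA nEx natr_sum mulr_sumr; apply: eq_bigr => x _.
  by rewrite nEx natr_sum.
have cd : (cdist G (mkcol (blow E psi)))%:R <=
    n%:R ^+ 2 * Pr2 R (fun u v => col G u v != blow E psi u v).
  rewrite n2E ler_nat /cdist col_mkcol // pair_bigA /= -sum1_card big_mkcond /=.
  by apply: leq_sum => p _; rewrite inE; case: (_ < _)%N; case: (_ != _).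
apply: le_trans cd _; apply: le_trans (_ : n%:R ^+ 2 * (eps / 4) <= _).
  rewrite ler_pM2l ?exprn_gt0 //; apply: le_trans P2 _; rewrite /e1.
  have rr : 0 < 1 + 2 * r%:R :> R by rewrite ltr_pwDl.
  move: (1 + 2 * r%:R : R) rr => x x0.
  by rewrite (_ : x * (eps / (4 * x)) = eps / 4) //; field; rewrite gt_eqF.
have bn := sqr_le_bin2 (ltnW n3).
have : (n%:R ^+ 2 : R) <= 4 * 'C(n, 2)%:R by rewrite -natrX -natrM ler_nat.
by move=> H; rewrite mulrCA ler_pM2l // ler_pdivrMr // mulrC.
Qed.
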